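(* Let $\Omega=(-1,1)\times(0,\pi)$ and let $\omega\subset\Omega$ be open. If for some $y_0\in(0,\pi)$ and some $a>0$ the horizontal open segment $\{(x,y_0):\ |x|<a\}$ is disjoint from $\overline{\omega}$, then the Grushin equation on $\Omega$ with control region $\omega$ is not null-controllable in any time $T$ with $0<T<a^2/2$.
   Context: Let $\Omega=(-1,1)\times(0,\pi)$, let $\omega\subset\Omega$ and $T>0$. The (controlled) Grushin equation on $\Omega$ with control region $\omega$ is $$\begin{cases}(\partial_t-\partial_x^2-x^2\partial_y^2)f(t,x,y)=\mathbf 1_\omega u(t,x,y), & t\in[0,T],\ (x,y)\in\Omega,\\ f(t,x,y)=0, & t\in[0,T],\ (x,y)\in\partial\Omega,\\ f(0,x,y)=f_0(x,y), & (x,y)\in\Omega,\end{cases}$$ with initial data $f_0\in L^2(\Omega)$ and control $u\in L^2((0,T)\times\Omega)$. Put $(f,g):=\int_\Omega(\partial_xf\,\partial_xg+x^2\partial_yf\,\partial_yg)\,dx\,dy$ for $f,g\in C_0^\infty(\Omega)$ and let $V(\Omega)$ be the completion of $C_0^\infty(\Omega)$ for the norm $(\cdot,\cdot)^{1/2}$. For all $f_0$ and $u$ the equation has a unique weak solution $f\in C([0,T];L^2(\Omega))\cap L^2(0,T;V(\Omega))$, i.e. $f(0)=f_0$ and $\frac{d}{dt}\langle f(t),\varphi\rangle_{L^2(\Omega)}+(f(t),\varphi)=\langle\mathbf 1_\omega u(t),\varphi\rangle_{L^2(\Omega)}$ for all $\varphi\in V(\Omega)$, in the sense of distributions on $(0,T)$.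 The equation is null-controllable (on $\omega$) in time $T>0$ if for every $f_0\in L^2(\Omega)$ there exists a control $u\in L^2((0,T)\times\Omega)$ such that the solution satisfies $f(T,\cdot,\cdot)=0$ in $\Omega$. *)

(* Defs.v *)
From HB Require Import structures.
From mathcomp Require Import all_boot all_order all_algebra.
From mathcomp Require Import all_classical all_reals all_analysis.

Set Implicit Arguments.
Unset Strict Implicit.
Unset Printing Implicit Defensive.
Import Order.TTheory GRing.Theory Num.Theory.
Import numFieldNormedType.Exports.

Local Open Scope classical_set_scope.
Local Open Scope ring_scope.

(* Functions are real-valued and total on the ambient space; a function "on D"
   is only used through its values on D, and equality of L^2 classes is
   equality almost everywhere.  Measurable means Borel measurable: every class
   of Lebesgue measurable functions has a Borel representative. *)

Definition leb2 (R : realType) :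
    set (measurableTypeR R * measurableTypeR R)%type -> \bar R :=
  (@lebesgue_measure R \x @lebesgue_measure R)%E.

Arguments leb2 : clear implicits.

HB.instance Definition _ (R : realType) := Measure.on (leb2 R).

Lemma leb2_sigma_finite (R : realType) : sigma_finite setT (leb2 R).
Proof.
have /sigma_finiteP[F [TF ndF Foo]] := sigma_finiteT (@lebesgue_measure R).
exists (fun n => F n `*` F n).
  rewrite -setXTT TF predeqE => -[x y]; split.
    move=> [/= [n _ Fnx] [k _ Fky]]; exists (maxn n k) => //; split.
    - by move: x Fnx; exact/subsetPset/ndF/leq_maxl.
    - by move: y Fky; exact/subsetPset/ndF/leq_maxr.
  by move=> [n _ []/= ? ?]; split; exists n.
move=> k; have [? ?] := Foo k; split; first exact: measurableX.
by rewrite /leb2 product_measure1E// lte_mul_pinfty// ge0_fin_numE.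
Qed.

(* The library's instance for [\x] only covers finite measures. *)
HB.instance Definition _ (R : realType) :=
  Measure_isSigmaFinite.Build _ _ _ (leb2 R) (@leb2_sigma_finite R).

Definition leb3 (R : realType) :
    set (measurableTypeR R * (measurableTypeR R * measurableTypeR R))%type
      -> \bar R :=
  (@lebesgue_measure R \x leb2 R)%E.

Arguments leb3 : clear implicits.

HB.instance Definition _ (R : realType) := Measure.on (leb3 R).

Definition L2on d (X : measurableType d) (R : realType)
    (mu : {measure set X -> \bar R}) (D : set X) (f : X -> R) : Prop :=
  f \_ D \in Lfun mu 2%:E.

Definition L2dist d (X : measurableType d) (R : realType)
    (mu : {measure set X -> \bar R}) (D : set X) (f g : X -> R) : \bar R :=
  'N[mu]_2%:E[EFin \o ((f \- g)%R \_ D)]%E.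

Definition Omega (R : realType) : set (R * R) :=
  [set z | -1 < z.1 < 1 /\ 0 < z.2 < pi].
Arguments Omega : clear implicits.

Definition L2dot (R : realType) (f g : R * R -> R) : R :=
  \int[leb2 R]_(z in Omega R) (f z * g z).

Definition dX (R : realType) (f : R * R -> R) (z : R * R) : R :=
  'D_((1, 0) : R * R) f z.
Definition dY (R : realType) (f : R * R -> R) (z : R * R) : R :=
  'D_((0, 1) : R * R) f z.

Fixpoint Ck (R : realType) (k : nat) (f : R * R -> R) : Prop :=
  continuous f /\
  if k is k'.+1 then
    [/\ forall z, derivable f z ((1, 0) : R * R),
        forall z, derivable f z ((0, 1) : R * R),
        Ck k' (dX f) & Ck k' (dY f)]
  else True.

Definition supported_in (X : topologicalType) (R : realType) (D : set X)
    (f : X -> R) : Prop :=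
  compact (closure [set x | f x != 0]) /\ closure [set x | f x != 0] `<=` D.

Definition test_Omega (R : realType) (f : R * R -> R) : Prop :=
  (forall k, Ck k f) /\ supported_in (Omega R) f.

Definition test_time (R : realType) (T : R) (th : R -> R) : Prop :=
  (forall n t, derivable (derive1n n th) t 1) /\
  supported_in `]0, T[ th.

(* The completion V(Omega) of C_0^oo(Omega), realized inside L^2(Omega): by the
   Poincare inequality in x, a sequence of test functions that is Cauchy for
   the norm (.,.)^(1/2) converges in L^2(Omega), and its limit determines the
   limits of its degenerate gradients (d/dx, x d/dy).  An element is therefore
   a function together with the L^2 limits of the degenerate gradients of some
   approximating sequence of test functions. *)
Record grushinV (R : realType) := GrushinV {
  Vfun : R * R -> R ;
  Vdx : R * R -> R ;
  Vxdy : R * R -> R ;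
  Vfun_L2 : L2on (leb2 R) (Omega R) Vfun ;
  Vdx_L2 : L2on (leb2 R) (Omega R) Vdx ;
  Vxdy_L2 : L2on (leb2 R) (Omega R) Vxdy ;
  V_approx : exists phi : nat -> R * R -> R,
    [/\ forall n, test_Omega (phi n),
        L2dist (leb2 R) (Omega R) (phi n) Vfun @[n --> \oo] --> 0%E,
        L2dist (leb2 R) (Omega R) (dX (phi n)) Vdx @[n --> \oo] --> 0%E &
        L2dist (leb2 R) (Omega R) (fun z => z.1 * dY (phi n) z) Vxdy
          @[n --> \oo] --> 0%E] }.

Definition Vdot (R : realType) (v w : grushinV R) : R :=
  L2dot (Vdx v) (Vdx w) + L2dot (Vxdy v) (Vxdy w).

(* The squared distance of [V(Omega)], in [\bar R]. *)
Definition Vdist2 (R : realType) (v w : grushinV R) : \bar R :=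
  (\int[leb2 R]_(z in Omega R)
    ((Vdx v z - Vdx w z) ^+ 2 + (Vxdy v z - Vxdy w z) ^+ 2)%:E)%E.

(* Bochner measurability on (0,T): almost everywhere limit of simple maps. *)
Definition V_measurable (R : realType) (T : R) (F : R -> grushinV R) : Prop :=
  exists s : nat -> R -> grushinV R,
    [/\ forall n, finite_set (range (s n)),
        forall n v, measurable (s n @^-1` [set v] : set (measurableTypeR R)) &
        {ae @lebesgue_measure R, forall t, 0 < t < T ->
          Vdist2 (s n t) (F t) @[n --> \oo] --> 0%E}].

Definition L2_0T_V (R : realType) (T : R) (F : R -> grushinV R) : Prop :=
  V_measurable T F /\
  (\int[@lebesgue_measure R]_(t in `]0%R, T[)
    (Vdot (F t) (F t))%:E < +oo)%E.

Definition C_0T_L2 (R : realType) (T : R) (f : R -> R * R -> R) : Prop :=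
  (forall t, 0 <= t <= T -> L2on (leb2 R) (Omega R) (f t)) /\
  (forall s, 0 <= s <= T ->
    L2dist (leb2 R) (Omega R) (f t) (f s)
      @[t --> within `[0, T] (nbhs s)] --> 0%E).

(* [F t] is [f t] seen as an element of [V(Omega)]; the last clause is the weak
   formulation in the sense of distributions on (0,T). *)
Definition weak_solution (R : realType) (omega : set (R * R)) (T : R)
    (f0 : R * R -> R) (u : R * (R * R) -> R) (f : R -> R * R -> R) : Prop :=
  [/\ C_0T_L2 T f,
      ae_eq (leb2 R) (Omega R) (f 0) f0 &
      exists F : R -> grushinV R,
        [/\ L2_0T_V T F,
            {ae @lebesgue_measure R, forall t, 0 < t < T ->
              ae_eq (leb2 R) (Omega R) (Vfun (F t)) (f t)} &
            forall (phi : grushinV R) (th : R -> R), test_time T th ->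
              - (\int[@lebesgue_measure R]_(t in `]0, T[)
                   (derive1 th t * L2dot (f t) (Vfun phi)))
              + \int[@lebesgue_measure R]_(t in `]0, T[)
                   (th t * Vdot (F t) phi)
              = \int[@lebesgue_measure R]_(t in `]0, T[)
                   (th t *
                    L2dot (fun z => \1_omega z * u (t, z)) (Vfun phi))]].

(* The weak solution exists and is unique for all data, so "the solution
   vanishes at time T" is stated as: some weak solution does. *)
Definition null_controllable (R : realType) (omega : set (R * R)) (T : R) :
    Prop :=
  forall f0 : R * R -> R, L2on (leb2 R) (Omega R) f0 ->
  exists u : R * (R * R) -> R,
    L2on (leb3 R) [set p | 0 < p.1 < T /\ Omega R p.2] u /\
    exists f : R -> R * R -> R,
      weak_solution omega T f0 u f /\ ae_eq (leb2 R) (Omega R) (f T) (cst 0).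

(* Main.v *)
Require Import Defs.
From mathcomp Require Import all_boot all_order all_algebra.
From mathcomp Require Import all_classical all_reals all_analysis.
From mathcomp Require Import measurable_realfun ring lra.
From mathcomp Require complex.
Import Order.TTheory GRing.Theory Num.Theory.
Import numFieldNormedType.Exports.
Local Open Scope classical_set_scope.
Local Open Scope ring_scope.
Set Implicit Arguments.
Unset Strict Implicit.

(* Suppose that every datum can be steered to 0. Testing the weak formulation
   against e^(m_n (t - T)) Phi_n(x) sin(n y) yields one identity per n between the
   moments of f_0 and of the control, up to an error governed by the residual
   -Phi_n'' + (n x)^2 Phi_n - m_n Phi_n, which is only required to be O(e^(-nJ)).
   Choose f_0 so that its moments are e^(-nS) sin(n y_0), with T < S < J, and combine
   the identities with coefficients a_n: the left side is the imaginary part of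
   p(z) = sum a_n z^n at e^(-S + i y_0), while the control only sees, essentially,
   the values of Im p at the points of modulus e^(-s - x^2/2) and argument y with
   (x, y) in omega. By Runge's theorem (pushing poles to infinity along the ray of
   argument y_0) the coefficients a_n can be chosen so that Im p is bounded by 1 at
   the latter points, sum |a_n| e^(-nJ) <= 1, and the left side is as large as wanted.

   For T < 1/2, take Phi_n = e^(-n x^2/2) - e^(-n/2) and m_n = n, with J < 1/2.
   For T >= 1/2 one has a > 1, so omega avoids a whole strip around y = y_0, but J
   must be large and Phi_n more accurate. Let Phi_n be a multiple of
   e^(-n x^2/2) sum_(j <= D) (-rho)^j a_j(x) with m_n = n + rho, where a_0 = 1,
   a_j'' - 2 n x a_j' = a_(j-1), and rho = rho_n is the small root of the sum at
   x = 1. The extra factors are harmless because, as sequences in n, they are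
   multipliers for the sup norm of polynomials on [0, 1] up to O(e^(-nJ)); for rho_n
   this follows by bootstrapping its defining equation. *)

(** * Smooth functions of one variable *)

(** The order of choices is decisive. The datum, hence the control and the solution, is fixed before
    the a_n, so the right side is bounded by a fixed number while Runge's theorem still allows any
    size on the left. S > T makes the prescribed moments those of an L^2 datum: after division by
    e^(-m_n T) and by an x-integral of Phi_n, the sine series must still decay geometrically; half
    of the margin S - T is reserved for the decay of Phi_n. S < J keeps the target point outside the
    disc of radius e^(-J), inside which the bound on sum |a_n| e^(-nJ) would bound the left side
    too.

    The simple Phi_n forces J < 1/2 because its boundary correction e^(-n/2) leaves a residual of
    that order. Hence every identity is multiplied by a large power of q_n, which is the multiple
    occurring in Phi_n. Since q_n decays more slowly than any chosen exponential, this power costs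
    only part of the margin S - T. *)

Fixpoint smoothn {R : realType} (n : nat) (f : R -> R) : Prop :=
  if n is m.+1 then (forall x, derivable f x 1) /\ smoothn m (derive1 f) else True.

Definition smooth {R : realType} (f : R -> R) : Prop := forall n, smoothn n f.

Section Smooth.
Context {R : realType}.
Implicit Types (f g : R -> R) (x y : R).

Lemma is_derive1E f x (d : R) : is_derive x 1 f d -> (derive1 f) x = d.
Proof. by move=> h; rewrite derive1E; exact: derive_val. Qed.

Lemma is_derive_derivable f x (d : R) : is_derive x 1 f d -> derivable f x 1.
Proof. by move=> h; exact: ex_derive. Qed.

Lemma derivable_is_derive1 f x : derivable f x 1 -> is_derive x 1 f ((derive1 f) x).
Proof. by move=> h; rewrite derive1E; exact: derivableP. Qed.

Lemma is_derive1_continuous f x (d : R) : is_derive x 1 f d -> {for x, continuous f}.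
Proof. by move=> h; apply: differentiable_continuous; apply/derivable1_diffP; exact: ex_derive. Qed.

Lemma is_derive1D f g x (a b : R) : is_derive x 1 f a -> is_derive x 1 g b ->
  is_derive x 1 (fun t => f t + g t) (a + b).
Proof. exact: is_deriveD. Qed.

Lemma is_derive1M f g x (a b : R) : is_derive x 1 f a -> is_derive x 1 g b ->
  is_derive x 1 (fun t => f t * g t) (a * g x + f x * b).
Proof.
move=> hf hg; apply: is_derive_eq (is_deriveM hf hg) _.
by rewrite addrC mulrC.
Qed.

Lemma is_derive1N f x (a : R) : is_derive x 1 f a -> is_derive x 1 (fun t => - f t) (- a).
Proof. exact: is_deriveN. Qed.

Lemma is_derive1Z f x (c a : R) : is_derive x 1 f a -> is_derive x 1 (fun t => c * f t) (c * a).
Proof. exact: is_deriveZ. Qed.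

Lemma is_derive1_cst (c x : R) : is_derive x 1 (fun=> c) 0.
Proof. exact: is_derive_cst. Qed.

Lemma is_derive1_id x : is_derive x 1 (fun t : R => t) 1.
Proof. exact: is_derive_id. Qed.

Lemma is_derive1_sum (I : Type) (r : seq I) (F : I -> R -> R) (dF : I -> R) x :
  (forall i, is_derive x 1 (F i) (dF i)) ->
  is_derive x 1 (fun t => \sum_(i <- r) F i t) (\sum_(i <- r) dF i).
Proof.
move=> h; elim: r => [|i r IH].
  by under eq_fun do rewrite big_nil; rewrite big_nil; exact: is_derive1_cst.
by under eq_fun do rewrite big_cons; rewrite big_cons; exact: is_derive1D.
Qed.

Lemma is_derive1_comp f g x (a b : R) : is_derive x 1 f a -> is_derive (f x) 1 g b ->
  is_derive x 1 (fun t => g (f t)) (b * a).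
Proof.
move=> hf hg.
have df : derivable f x 1 by exact: is_derive_derivable hf.
have dg : derivable g (f x) 1 by exact: is_derive_derivable hg.
have dgf : derivable (g \o f) x 1.
  apply/derivable1_diffP/differentiable_comp; first exact/derivable1_diffP.
  exact/derivable1_diffP.
apply: (DeriveDef dgf); rewrite -derive1E (derive1_comp df dg).
by rewrite (is_derive1E hf) (is_derive1E hg).
Qed.

Lemma smoothnSP n f g : (forall x, is_derive x 1 f (g x)) -> smoothn n g -> smoothn n.+1 f.
Proof.
move=> h sg; split=> [x|]; first exact: is_derive_derivable (h x).
by have -> : (derive1 f) = g by apply/funext => x; exact: is_derive1E (h x).
Qed.

Lemma smoothnS n f : smoothn n.+1 f -> exists2 g, (forall x, is_derive x 1 f (g x)) & smoothn n g.
Proof.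
by move=> [h1 h2]; exists (derive1 f) => // x; exact: derivable_is_derive1.
Qed.

Lemma smoothn_le n f : smoothn n.+1 f -> smoothn n f.
Proof.
elim: n f => // n IH f [h1 h2]; split => //; exact: IH.
Qed.

Lemma smooth_derive f g : (forall x, is_derive x 1 f (g x)) -> smooth g -> smooth f.
Proof. by move=> h sg [//|n]; apply: smoothnSP h _; exact: sg. Qed.

Lemma smooth_derivable f x : smooth f -> derivable f x 1.
Proof. by move=> h; have [] := h 1%N. Qed.

Lemma smooth_derive1 f : smooth f -> smooth (derive1 f).
Proof. by move=> h n; have [] := h n.+1. Qed.

Lemma smooth_is_derive f x : smooth f -> is_derive x 1 f ((derive1 f) x).
Proof. by move=> h; apply: derivable_is_derive1; exact: smooth_derivable. Qed.

Lemma smooth_continuous f : smooth f -> continuous f.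
Proof. by move=> h x; apply: is_derive1_continuous (smooth_is_derive x h). Qed.

Lemma smooth_derive1n f n x : smooth f -> derivable (derive1n n f) x 1.
Proof.
move=> h; suff : smooth (derive1n n f) by exact: smooth_derivable.
elim: n f h => [//|n IH] f h; rewrite derive1Sn; apply: IH; exact: smooth_derive1.
Qed.

Lemma smoothn_cst n (c : R) : smoothn n (fun=> c).
Proof.
elim: n c => // n IH c.
have h (x : R) : is_derive x 1 (fun=> c) 0 by exact: is_derive_cst.
exact: smoothnSP h (IH 0).
Qed.

Lemma smoothnD n f g : smoothn n f -> smoothn n g -> smoothn n (fun x => f x + g x).
Proof.
elim: n f g => // n IH f g /smoothnS[f' hf sf'] /smoothnS[g' hg sg'].
have h x : is_derive x 1 (fun x => f x + g x) (f' x + g' x) by exact: is_deriveD.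
by apply: smoothnSP h _; exact: IH.
Qed.

Lemma smoothnM n f g : smoothn n f -> smoothn n g -> smoothn n (fun x => f x * g x).
Proof.
elim: n f g => // n IH f g sf sg.
have [f' hf sf'] := smoothnS sf; have [g' hg sg'] := smoothnS sg.
have h x : is_derive x 1 (fun x => f x * g x) (f' x * g x + f x * g' x).
  exact: is_derive1M.
by apply: (smoothnSP h); apply: smoothnD; apply: IH => //; exact: smoothn_le.
Qed.

Lemma smooth_cst (c : R) : smooth (fun=> c).
Proof. by move=> n; exact: smoothn_cst. Qed.

Lemma smooth_id : smooth (fun x : R => x).
Proof.
have h (x : R) : is_derive x 1 (fun x : R => x) 1 by exact: is_derive_id.
exact: smooth_derive h (smooth_cst 1).
Qed.

Lemma smoothD f g : smooth f -> smooth g -> smooth (fun x => f x + g x).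
Proof. by move=> hf hg n; exact: smoothnD. Qed.

Lemma smoothM f g : smooth f -> smooth g -> smooth (fun x => f x * g x).
Proof. by move=> hf hg n; exact: smoothnM. Qed.

Lemma smoothN f : smooth f -> smooth (fun x => - f x).
Proof.
move=> h; have := smoothM (smooth_cst (-1)) h.
by under eq_fun do rewrite mulN1r.
Qed.

Lemma smooth_sum (I : Type) (r : seq I) (F : I -> R -> R) :
  (forall i, smooth (F i)) -> smooth (fun x => \sum_(i <- r) F i x).
Proof.
move=> h; elim: r => [|i r IH].
  by under eq_fun do rewrite big_nil; exact: smooth_cst.
by under eq_fun do rewrite big_cons; exact: smoothD.
Qed.

Lemma smoothn_comp n f g : smoothn n f -> smooth g -> smoothn n (fun x => g (f x)).
Proof.
elim: n f g => // n IH f g sf sg.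
have [f' hf sf'] := smoothnS sf.
have h x : is_derive x 1 (fun x => g (f x)) (derive1 g (f x) * f' x).
  by apply: is_derive1_comp => //; exact: smooth_is_derive.
by apply: (smoothnSP h); apply: smoothnM => //; apply: IH; [exact: smoothn_le|exact: smooth_derive1].
Qed.

Lemma smooth_comp f g : smooth f -> smooth g -> smooth (fun x => g (f x)).
Proof. by move=> hf hg n; exact: smoothn_comp. Qed.

Lemma smooth_expR : smooth (@expR R).
Proof. by elim=> // n IH; exact: smoothnSP (@is_derive_expR R) IH. Qed.

Lemma smoothn_sin_cos n : smoothn n (@sin R) /\ smoothn n (@cos R).
Proof.
elim: n => // n [h1 h2]; split.
  exact: smoothnSP (@is_derive_sin R) h2.
apply: smoothnSP (@is_derive_cos R) _.
have := smoothnM (smoothn_cst n (-1)) h1.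
by under eq_fun do rewrite mulN1r.
Qed.

Lemma smooth_sin : smooth (@sin R).
Proof. by move=> n; have [] := smoothn_sin_cos n. Qed.

Lemma smooth_affine (a b : R) : smooth (fun x => a * x + b).
Proof. by apply: smoothD; [apply: smoothM; [exact: smooth_cst|exact: smooth_id]|exact: smooth_cst]. Qed.

Lemma mvt_le f g (a b B : R) : a <= b -> (forall x, is_derive x 1 f (g x)) ->
  (forall x, a <= x <= b -> `|g x| <= B) -> `|f b - f a| <= B * (b - a).
Proof.
move=> ab df gB.
have cf : {within `[a, b], continuous f}.
  by apply: continuous_subspaceT => x; exact: is_derive1_continuous (df x).
have [c cab ->] := MVT_segment ab (fun x _ => df x) cf.
rewrite normrM (ger0_norm (x := b - a)) ?subr_ge0//.
by apply: ler_wpM2r; [rewrite subr_ge0|apply: gB; rewrite in_itv in cab].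
Qed.

Lemma derive_ge0_le f g (a b : R) : a <= b -> (forall x, is_derive x 1 f (g x)) ->
  (forall x, a <= x <= b -> 0 <= g x) -> f a <= f b.
Proof.
move=> ab df g0.
have cf : {within `[a, b], continuous f}.
  by apply: continuous_subspaceT => x; exact: is_derive1_continuous (df x).
have [c cab e] := MVT_segment ab (fun x _ => df x) cf.
rewrite -subr_ge0 e mulr_ge0 ?subr_ge0//; apply: g0.
by rewrite in_itv in cab.
Qed.

Lemma derive0_eq f (a b : R) : (forall x, is_derive x 1 f 0) -> f a = f b.
Proof.
move=> h; wlog ab : a b / a <= b.
  by move=> W; case/orP: (le_total a b) => /W // ->.
have := mvt_le (B := 0) ab h.
rewrite normr0 mul0r => /(_ (fun _ _ => lexx _)).
by rewrite normr_le0 subr_eq0 => /eqP.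
Qed.

End Smooth.

(** * Global primitives of continuous functions *)

Section Primitive.
Context {R : realType}.
Implicit Types (f g : R -> R) (x y : R).
Notation mu := (@lebesgue_measure R).

Lemma continuous_integrable_itv f (a b : R) : continuous f ->
  mu.-integrable `[a, b] (EFin \o f).
Proof.
move=> cf; apply: continuous_compact_integrable; first exact: segment_compact.
by apply: continuous_subspaceT => x; exact: cf.
Qed.

Lemma mvt_eq f g (dff dg : R -> R) (a b : R) : a <= b ->
  (forall x, a <= x <= b -> is_derive x 1 f (dff x)) ->
  (forall x, a <= x <= b -> is_derive x 1 g (dff x)) ->
  f b - f a = g b - g a.
Proof.
move=> ab hf hg.
have h x : x \in `[a, b] -> is_derive x 1 (fun x => f x - g x) 0.
  rewrite in_itv /= => hx; rewrite -(subrr (dff x)).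
  by apply: is_derive1D; [exact: hf|apply: is_derive1N; exact: hg].
have cf : {within `[a, b], continuous (fun x => f x - g x)}.
  apply: continuous_in_subspaceT => x; rewrite inE => hx.
  exact: is_derive1_continuous (h x hx).
have h' x : x \in `]a, b[ -> is_derive x 1 (fun x => f x - g x) 0.
  by move=> hx; apply: h; exact: subset_itv_oo_cc.
have [c _] := MVT_segment ab h' cf.
rewrite mul0r => e; lra.
Qed.

(** Subtracting the integral up to 0 makes the value at [y] independent of the base point [- M].
    Primitives that are each valid only to the right of their base point thus glue into one on the
    whole line. *)
Let H f (M y : R) := \int[mu]_(t in `[- M, y]) f t - \int[mu]_(t in `[- M, 0]) f t.

Let is_derive_H f (M y : R) : continuous f -> - M < y -> is_derive y 1 (H f M) (f y).
Proof.
move=> cf My; rewrite -(addr0 (f y)).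
refine (@is_derive1D _ (fun y => \int[mu]_(t in `[- M, y]) f t) _ _ _ _ _ (is_derive1_cst _ _)).
have yu : y < y + 1 by rewrite ltrDl.
have [h1 h2] := continuous_FTC1_closed yu (@continuous_integrable_itv f (- M) (y + 1) cf) My (cf y).
by apply: (DeriveDef h1); rewrite -derive1E; exact: h2.
Qed.

Lemma primitive_exists f : continuous f ->
  exists F : R -> R, F 0 = 0 /\ forall x : R, is_derive x 1 F (f x).
Proof.
move=> cf.
have HE (M N y : R) : `|y| < M -> `|y| < N -> H f M y = H f N y.
  move=> yM yN; have ny := normr_ge0 y.
  have H0 K : H f K 0 = 0 by rewrite /H subrr.
  have [y0|y0] := leP 0 y.
    have := @mvt_eq (H f M) (H f N) f f 0 y y0.
    rewrite !H0 !subr0; apply => x /andP[x0 xy]; apply: is_derive_H => //; lra.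
  have := @mvt_eq (H f M) (H f N) f f y 0 (ltW y0).
  rewrite !H0 !sub0r => h; apply: oppr_inj; apply: h => x /andP[x0 xy];
    apply: is_derive_H => //; rewrite ltr0_norm// in yM yN; lra.
(* The base point moves with [y], but on a neighbourhood of a given [x] it may be frozen at
   [- (|x| + 2)]. *)
exists (fun y => H f (`|y| + 1) y); split; first by rewrite /H normr0 add0r subrr.
move=> x; apply: (@near_eq_is_derive _ _ _ (H f (`|x| + 2))); last first.
  apply: is_derive_H => //; have := ler_norm (- x); rewrite normrN; lra.
near=> y; apply: HE; last by rewrite ltrDl.
have : `|x - y| < 1 by near: y; apply: cvgr_dist_lt.
have := ler_normD (y - x) x; rewrite subrK distrC; lra.
Unshelve. all: by end_near. Qed.

Definition prim f : R -> R :=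
  xget (fun=> 0) [set F : R -> R | F 0 = 0 /\ forall x : R, is_derive x 1 F (f x)].

Lemma primP f : continuous f -> prim f 0 = 0 /\ forall x : R, is_derive x 1 (prim f) (f x).
Proof.
move=> /primitive_exists[F hF].
exact: (@xgetPex _ (fun=> 0) [set F : R -> R | F 0 = 0 /\ forall x : R, is_derive x 1 F (f x)] (ex_intro _ F hF)).
Qed.

Lemma prim0 f : continuous f -> prim f 0 = 0.
Proof. by move=> /primP[]. Qed.

Lemma is_derive_prim f (x : R) : continuous f -> is_derive x 1 (prim f) (f x).
Proof. by move=> /primP[]. Qed.

Lemma smooth_prim f : smooth f -> smooth (prim f).
Proof.
move=> sf; apply: (smooth_derive _ sf) => x; apply: is_derive_prim => y.
exact: (smooth_continuous sf).
Qed.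

Lemma is_derive1_compN f (x a : R) : is_derive (- x) 1 f a -> is_derive x 1 (fun t => f (- t)) (- a).
Proof.
move=> h; rewrite -mulrN1.
have hN : is_derive x 1 (fun t : R => - t) (-1) by apply: is_derive1N; exact: is_derive1_id.
exact: is_derive1_comp hN h.
Qed.

Lemma prim_odd f : continuous f -> (forall x, f (- x) = f x) -> forall x, prim f (- x) = - prim f x.
Proof.
move=> cf ev x.
have h y : is_derive y 1 (fun y => prim f (- y) + prim f y) 0.
  rewrite -(addNr (f y)); apply: is_derive1D; last exact: is_derive_prim.
  by apply: is_derive1_compN; rewrite -ev; exact: is_derive_prim.
have := derive0_eq x 0 h; rewrite oppr0 prim0// addr0 => /eqP.
by rewrite addr_eq0 => /eqP.
Qed.

Lemma prim_even f : continuous f -> (forall x, f (- x) = - f x) -> forall x, prim f (- x) = prim f x.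
Proof.
move=> cf ev x.
have h y : is_derive y 1 (fun y => prim f (- y) - prim f y) 0.
  rewrite -(subrr (f y)); apply: is_derive1D; last by apply: is_derive1N; exact: is_derive_prim.
  by rewrite -[f y]opprK -ev; apply: is_derive1_compN; exact: is_derive_prim.
have := derive0_eq x 0 h; rewrite oppr0 prim0// subr0 => /eqP.
by rewrite subr_eq0 => /eqP.
Qed.

End Primitive.

(** * Flat functions and a smooth step *)

Section Bump.
Context {R : realType}.
Implicit Types (f g : R -> R) (p : {poly R}) (x y : R).

(** The polynomial parameter makes the family stable under differentiation: the derivative of p(1/x)
    e^(-1/x) is q(1/x) e^(-1/x) with q = X^2 (p - p'). Smoothness is then an induction over all p at
    once. *)
Definition flat p (x : R) : R := if 0 < x then p.[x^-1] * expR (- x^-1) else 0.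

Lemma is_derive_quad f (C : R) : (forall h, `|f h| <= C * h ^+ 2) -> is_derive (0 : R) 1 f 0.
Proof.
move=> hf.
have f0 : f 0 = 0 by apply/eqP; have := hf 0; rewrite expr0n mulr0 normr_le0.
have C0 : 0 <= C by have := le_trans (normr_ge0 _) (hf 1); rewrite expr1n mulr1.
suff h : h^-1 *: (f (h *: (1 : R) + 0) - f 0) @[h --> 0^'] --> (0 : R).
  by apply: DeriveDef; [apply/cvg_ex; exists 0|exact: cvg_lim h].
apply/cvgrPdist_le => e e0; near=> h.
have h0 : h != 0 by near: h; exact: nbhs_dnbhs_neq.
rewrite f0 subr0 addr0 sub0r normrN /GRing.scale/= mulr1 normrM normfV.
rewrite ler_pdivrMl ?normr_gt0//; apply: le_trans (hf h) _.
rewrite -normr_id -[h ^+ 2]ger0_norm ?sqr_ge0// normrX expr2 normr_id mulrCA.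
apply: ler_wpM2l => //.
have : `|h| <= e / (C + 1).
  by near: h; apply: dnbhs0_le; rewrite divr_gt0// ltr_wpDl.
rewrite ler_pdivlMr ?ltr_wpDl// => h2; apply: le_trans h2.
by rewrite mulrC ler_wpM2l// lerDl.
Unshelve. all: by end_near. Qed.

Lemma horner_growth p : exists2 K : R, 0 <= K & forall t, 1 <= t -> `|p.[t]| <= K * t ^+ (size p).
Proof.
exists (\sum_(i < size p) `|p`_i|); first exact: sumr_ge0.
move=> t t1; rewrite horner_coef mulr_suml; apply: le_trans (ler_norm_sum _ _ _) _.
apply: ler_sum => i _; rewrite normrM; apply: ler_wpM2l => //.
have t0 : 0 <= t by apply: le_trans t1.
by rewrite ger0_norm ?exprn_ge0// ler_weXn2l// ltnW.
Qed.

(** A quadratic bound gives derivative 0 at the origin. For 0 < h <= 1 it follows from e^t >=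
    t^(n+2) / (n+2)! at t = 1/h; for h > 1 the polynomial in 1/h is at most the sum of its absolute
    coefficients. *)
Lemma flat_quad p : exists C, forall h, `|flat p h| <= C * h ^+ 2.
Proof.
have [K K0 hK] := horner_growth p.
pose n := size p.
pose D := \sum_(i < size p) `|p`_i|.
have D0 : 0 <= D by exact: sumr_ge0.
pose F : R := (n.+2)`!%:R.
have F0 : 0 <= F by exact: ler0n.
exists (K * F + D) => h; rewrite /flat; case: ifP => h0; last first.
  by rewrite normr0 mulr_ge0 ?sqr_ge0// addr_ge0// mulr_ge0.
rewrite normrM (ger0_norm (expR_ge0 _)).
have [h1|h1] := leP h 1; last first.
  apply: (@le_trans _ _ (D * 1)).
    apply: ler_pM => //.
      rewrite horner_coef; apply: le_trans (ler_norm_sum _ _ _) _.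
      apply: ler_sum => i _; rewrite normrM -[leRHS]mulr1; apply: ler_wpM2l => //.
      rewrite normrX normfV (gtr0_norm h0); apply: exprn_ile1; first by rewrite invr_ge0 ltW.
      by rewrite invf_le1// ltW.
    by rewrite expR_le1 oppr_le0 invr_ge0 ltW.
  apply: ler_pM => //; first by rewrite lerDr mulr_ge0.
  by rewrite exprn_ege1// ltW.
set t := h^-1.
have t1 : 1 <= t by rewrite invf_ge1.
have t0 : 0 < t by rewrite invr_gt0.
apply: (@le_trans _ _ (K * F * h ^+ 2)); last first.
  by rewrite ler_wpM2r ?sqr_ge0// lerDl.
apply: (@le_trans _ _ (K * t ^+ n * expR (- t))).
  by rewrite ler_wpM2r ?expR_ge0// hK.
rewrite -!mulrA; apply: ler_wpM2l => //.
rewrite expRN ler_pdivrMr ?expR_gt0//.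
have -> : t ^+ n = h ^+ 2 * t ^+ n.+2.
  by rewrite -(add2n n) exprD mulrA -exprMn mulfV ?gt_eqF// expr1n mul1r.
have -> : F * h ^+ 2 * expR t = h ^+ 2 * (F * expR t) by ring.
apply: ler_wpM2l; first exact: sqr_ge0.
have := expR_ge1Dxn n.+1 (ltW t0).
rewrite -ler_pdivrMl ?ltr0n ?fact_gt0// mulrC.
apply: le_trans; rewrite -/F; lra.
Qed.

Lemma is_derive_flat p (x : R) : is_derive x 1 (flat p) (flat ('X^2 * (p - p^`()))%R x).
Proof.
have [x0|x0|->] := ltgtP x 0.
- have -> : flat ('X^2 * (p - p^`()))%R x = 0 by rewrite /flat ltNge ltW.
  refine (near_eq_is_derive _ (is_derive1_cst 0 _)).
  near=> y; rewrite /flat ltNge ltW//; near: y; exact: lt_nbhsl.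
- apply: (@near_eq_is_derive _ _ _ (fun y => p.[y^-1] * expR (- y^-1))).
    near=> y; rewrite /flat ifT//; near: y; exact: lt_nbhsr.
  have hV : is_derive x 1 (fun y : R => y^-1) (- x ^- 2).
    apply: is_derive_eq (is_deriveV _ (is_derive1_id x)) _; first by rewrite gt_eqF.
    by rewrite /GRing.scale/= mulr1.
  have hp : is_derive (x^-1) 1 (fun t => p.[t]) (p^`()%R.[x^-1]).
    by rewrite derivE; apply: derivable_is_derive1; exact: derivable_horner.
  have h1 := is_derive1_comp hV hp.
  have h2 := is_derive1_comp (is_derive1N hV) (is_derive_expR (- x^-1)).
  apply: is_derive_eq (is_derive1M h1 h2) _.
  by rewrite /flat x0 hornerM hornerXn hornerD hornerN exprVn; ring.
- have [C hC] := flat_quad p.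
  by rewrite {2}/flat ltxx; exact: is_derive_quad hC.
Unshelve. all: by end_near. Qed.

Lemma smooth_flat p : smooth (flat p).
Proof.
move=> n; elim: n p => // n IH p.
exact: smoothnSP (is_derive_flat p) (IH _).
Qed.

Definition stepd (x : R) : R := flat 1 (x - 1) * flat 1 (2 - x).

Lemma flat_ge0 x : 0 <= flat 1 x.
Proof. by rewrite /flat; case: ifP => // _; rewrite hornerC mul1r expR_ge0. Qed.

Lemma stepd_ge0 x : 0 <= stepd x.
Proof. by rewrite mulr_ge0// flat_ge0. Qed.

Lemma stepd_eq0 x : x <= 1 \/ 2 <= x -> stepd x = 0.
Proof.
rewrite /stepd /flat => -[h|h]; first by rewrite ltNge subr_le0 h mul0r.
by rewrite [X in _ * X]ifF ?mulr0//; rewrite ltNge subr_le0 h.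
Qed.

Lemma smooth_stepd : smooth stepd.
Proof.
apply: smoothM.
  have h := smooth_comp (smooth_affine 1 (-1)) (smooth_flat 1).
  by move: h; under eq_fun do rewrite mul1r.
have h := smooth_comp (smooth_affine (-1) 2) (smooth_flat 1).
by move: h; under eq_fun do rewrite mulN1r addrC.
Qed.

Lemma smooth_step_exists : exists S : R -> R, smooth S /\
  [/\ forall x, 0 <= derive1 S x, forall x, 0 <= S x <= 1,
      forall x, x <= 1 -> S x = 0, forall x, 2 <= x -> S x = 1 &
      forall x, x <= 1 \/ 2 <= x -> derive1 S x = 0].
Proof.
pose G := prim stepd.
have cs : continuous stepd by exact: smooth_continuous smooth_stepd.
have dG x : is_derive x 1 G (stepd x) by exact: is_derive_prim.
have G0 : G 0 = 0 by exact: prim0.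
have mG a b : a <= b -> G a <= G b.
  by move=> ab; apply: derive_ge0_le ab dG _ => x _; exact: stepd_ge0.
have cG a b : a <= b -> (forall x, a <= x <= b -> stepd x = 0) -> G a = G b.
  move=> ab h; apply/esym/eqP; rewrite -subr_eq0 -normr_le0.
  have := mvt_le (B := 0) ab dG; rewrite mul0r; apply => x hx.
  by rewrite h// normr0.
have G1 x : x <= 1 -> G x = 0.
  move=> x1; rewrite -G0; case/orP: (le_total x 0) => h.
    by apply: cG => // y hy; apply: stepd_eq0; left; lra.
  by apply/esym; apply: cG => // y hy; apply: stepd_eq0; left; lra.
have G2 x : 2 <= x -> G x = G 2.
  by move=> x2; apply/esym; apply: cG => // y hy; apply: stepd_eq0; right; lra.
have Gpos : 0 < G 2.
  rewrite lt_neqAle; apply/andP; split; last by rewrite -(G1 1)// mG// ler1n.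
  (* If [G 2] were 0, monotonicity would make [G] vanish on (1, 2), against [stepd] being positive
     at 3/2. *)
  apply/eqP => e.
  have Gz x : 1 < x < 2 -> G x = 0.
    move=> hx; apply/eqP; rewrite eq_le; apply/andP; split.
      by rewrite e; apply: mG; lra.
    by rewrite -(G1 1)//; apply: mG; lra.
  have : is_derive (3 / 2 : R) 1 G 0.
    refine (near_eq_is_derive _ (is_derive1_cst 0 _)).
    near=> y; rewrite Gz//; apply/andP; split; near: y.
      by apply: lt_nbhsr; lra.
    by apply: lt_nbhsl; lra.
  move=> h; have := is_derive1E h; rewrite (is_derive1E (dG _)) /stepd /flat.
  rewrite ifT; last by lra.
  rewrite ifT; last by lra.
  rewrite !hornerC !mul1r => /eqP; rewrite mulf_eq0 !expR_eq0//.
exists (fun x => (G 2)^-1 * G x).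
have dS x : is_derive x 1 (fun x => (G 2)^-1 * G x) ((G 2)^-1 * stepd x).
  exact: is_derive1Z.
split.
  by apply: smoothM; [exact: smooth_cst|exact: (smooth_prim smooth_stepd)].
split.
- by move=> x; rewrite (is_derive1E (dS x)) mulr_ge0 ?stepd_ge0// invr_ge0 ltW.
- move=> x; apply/andP; split.
    rewrite mulr_ge0 ?invr_ge0 ?(ltW Gpos)//; case/orP: (le_total x 1) => h; first by rewrite G1.
    by rewrite -(G1 1)// mG.
  rewrite ler_pdivrMl// mulr1; case/orP: (le_total x 2) => h; first exact: mG.
  by rewrite G2.
- by move=> x x1; rewrite (G1 x)// mulr0.
- by move=> x x2; rewrite (G2 x)// mulVf// gt_eqF.
- by move=> x hx; rewrite (is_derive1E (dS x)) stepd_eq0// mulr0.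
Unshelve. all: by end_near. Qed.

End Bump.

(** * Cutoffs exhausting an interval *)

Section Cutoff.
Context {R : realType}.
Implicit Types (x y l r e : R).

(** Each cutoff is a product of two rescaled steps, one per endpoint. Monotonicity on the two halves
    turns the derivative into approximate point masses at the endpoints, which later recovers
    initial and final values. The bound of the derivative by the inverse distance to the boundary
    lets a function vanishing at [l] and [r] be cut off while its derivative stays bounded. *)
Lemma smooth_cutoffs l r : l < r -> exists c : nat -> R -> R, exists K : R,
  [/\ forall k, smooth (c k), forall k x, 0 <= c k x <= 1,
      forall k, exists2 e, 0 < e & forall x, c k x != 0 -> l + e <= x <= r - e,
      forall k, [/\ c k ((l + r) / 2) = 1,
         forall x, x <= (l + r) / 2 -> 0 <= derive1 (c k) x &
         forall x, (l + r) / 2 <= x -> derive1 (c k) x <= 0] &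
      (forall k x, l <= x <= r -> `|derive1 (c k) x| * ((x - l) * (r - x)) <= K) /\
      (forall d, 0 < d -> \forall k \near \oo, forall x, l + d <= x <= r - d ->
         c k x = 1 /\ derive1 (c k) x = 0)].
Proof.
move=> lr.
have [S [sS [dS0 S01 S0 S1 dS]]] := @smooth_step_exists R.
have [C hC] : exists C, forall x, `|derive1 S x| <= C.
  have cf : continuous (derive1 S) by exact: (smooth_continuous (smooth_derive1 sS)).
  have [c _ hc] := @EVT_max R (derive1 S) 1 2 (ler1n _ 2) (continuous_subspaceT cf).
  exists (derive1 S c) => x; rewrite ger0_norm//.
  have h12 : derive1 S 1 <= derive1 S c by apply: hc; rewrite in_itv/= lexx ler1n.
  have [h|h] := leP x 1; first by rewrite dS; [rewrite -(dS 1)//; left|left].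
  have [h'|h'] := leP 2 x; first by rewrite dS; [rewrite -(dS 1)//; left|right].
  by apply: hc; rewrite in_itv/= !ltW.
have C0 : 0 <= C by apply: le_trans (hC 0).
(* With the divisor 8 each step is already 1 on the half of the interval away from its own endpoint,
   so only one factor varies on each half. *)
pose e (k : nat) : R := (r - l) / 8 / k.+1%:R.
have e0 k : 0 < e k by rewrite !divr_gt0// subr_gt0.
have e8 k : e k <= (r - l) / 8.
  by rewrite ler_pdivrMr ?ltr0n// ler_peMr ?ler1n// divr_ge0 ?subr_ge0// ltW.
pose c k x := S ((x - l) / e k) * S ((r - x) / e k).
pose dc k x := (e k)^-1 * (derive1 S ((x - l) / e k) * S ((r - x) / e k) -
                 S ((x - l) / e k) * derive1 S ((r - x) / e k)).
have dcE k x : derive1 (c k) x = dc k x.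
  apply: is_derive1E.
  have ha : is_derive x 1 (fun x => (x - l) / e k) (e k)^-1.
    have := is_derive1M (is_derive1D (is_derive1_id x) (is_derive1_cst (- l) x)) (is_derive1_cst (e k)^-1 x).
    by rewrite addr0 mul1r mulr0 addr0.
  have hb : is_derive x 1 (fun x => (r - x) / e k) (- (e k)^-1).
    have := is_derive1M (is_derive1D (is_derive1_cst r x) (is_derive1N (is_derive1_id x))) (is_derive1_cst (e k)^-1 x).
    by rewrite add0r mulN1r mulr0 addr0.
  have := is_derive1M (is_derive1_comp ha (smooth_is_derive _ sS)) (is_derive1_comp hb (smooth_is_derive _ sS)).
  by move=> h; apply: is_derive_eq h _; rewrite /dc; ring.
have left1 k x : x <= (l + r) / 2 -> 2 <= (r - x) / e k.
  by move=> hx; rewrite ler_pdivlMr//; have := e8 k; lra.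
have right1 k x : (l + r) / 2 <= x -> 2 <= (x - l) / e k.
  by move=> hx; rewrite ler_pdivlMr//; have := e8 k; lra.
have dcL k x : x <= (l + r) / 2 -> dc k x = (e k)^-1 * derive1 S ((x - l) / e k).
  move=> hx; rewrite /dc (S1 ((r - x) / e k)) ?left1// (dS ((r - x) / e k)); last by right; exact: left1.
  by rewrite mulr1 mulr0 subr0.
have dcR k x : (l + r) / 2 <= x -> dc k x = - ((e k)^-1 * derive1 S ((r - x) / e k)).
  move=> hx; rewrite /dc (S1 ((x - l) / e k)) ?right1// (dS ((x - l) / e k)); last by right; exact: right1.
  by rewrite mul0r mul1r sub0r mulrN.
exists c, (2 * C * (r - l)); split.
- move=> k; apply: smoothM.
    apply: (smooth_comp (f := fun x => (x - l) / e k)) => //.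
    have := smooth_affine (e k)^-1 (- l / e k).
    by congr smooth; apply/funext => x; ring.
  apply: (smooth_comp (f := fun x => (r - x) / e k)) => //.
  have := smooth_affine (- (e k)^-1) (r / e k).
  by congr smooth; apply/funext => x; ring.
- move=> k x; have /andP[a0 a1] := S01 ((x - l) / e k).
  have /andP[b0 b1] := S01 ((r - x) / e k).
  by rewrite mulr_ge0//= mulr_ile1.
- move=> k; exists (e k) => // x; apply: contraR; rewrite negb_and -!ltNge => /orP[h|h].
    by rewrite /c S0 ?mul0r// ler_pdivrMr// mul1r; lra.
  by rewrite /c [X in _ * X]S0 ?mulr0// ler_pdivrMr// mul1r; lra.
- move=> k; split.
  + by rewrite /c !S1 ?mulr1//; [exact: left1|exact: right1].
  + by move=> x hx; rewrite dcE dcL// mulr_ge0// invr_ge0 ltW.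
  + by move=> x hx; rewrite dcE dcR// oppr_le0 mulr_ge0// invr_ge0 ltW.
split.
  move=> k x /andP[lx xr]; rewrite dcE.
  have key y : 0 <= y <= r - l -> (e k)^-1 * derive1 S (y / e k) * (y * (r - l)) <= 2 * C * (r - l).
    move=> /andP[y0 yr]; rewrite mulrA ler_wpM2r ?subr_ge0 ?(ltW lr)//.
    have [h|h] := leP 2 (y / e k).
      rewrite dS; last by right.
      by rewrite mulr0 mul0r mulr_ge0.
    have -> : (e k)^-1 * derive1 S (y / e k) * y = y / e k * derive1 S (y / e k) by ring.
    apply: ler_pM => //; [by rewrite divr_ge0// ltW|exact: ltW|].
    exact: le_trans (ler_norm _) (hC _).
  have [h|h] := leP x ((l + r) / 2).
    rewrite dcL// ger0_norm ?mulr_ge0 ?invr_ge0 ?(ltW (e0 k))//.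
    apply: le_trans (key (x - l) _); last by lra.
    apply: ler_wpM2l; first by rewrite mulr_ge0 ?invr_ge0 ?(ltW (e0 k)).
    by apply: ler_wpM2l; lra.
  rewrite dcR ?(ltW h)// normrN ger0_norm ?mulr_ge0 ?invr_ge0 ?(ltW (e0 k))//.
  apply: le_trans (key (r - x) _); last by lra.
  apply: ler_wpM2l; first by rewrite mulr_ge0 ?invr_ge0 ?(ltW (e0 k)).
  by rewrite [leLHS]mulrC; apply: ler_wpM2l; lra.
move=> d d0.
have ecvg : e k @[k --> \oo] --> (0 : R).
  rewrite -(mulr0 ((r - l) / 8)); apply: cvgM; first exact: cvg_cst.
  by have := @cvg_harmonic R; apply.
near=> k.
have ed : 2 * e k <= d.
  have : `|0 - e k| < d / 2.
    by near: k; move/cvgrPdist_lt : ecvg; apply; rewrite divr_gt0.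
  by rewrite sub0r normrN gtr0_norm//; lra.
move=> x /andP[h1 h2].
have a2 : 2 <= (x - l) / e k by rewrite ler_pdivlMr//; lra.
have b2 : 2 <= (r - x) / e k by rewrite ler_pdivlMr//; lra.
split; first by rewrite /c !S1// mulr1.
by rewrite dcE /dc !dS ?mulr0 ?mul0r ?subr0 ?mulr0//; right.
Unshelve. all: by end_near. Qed.

End Cutoff.

(** * Approximation by sine polynomials *)

Section PolePushing.
Import complex ComplexField.Normc.
Context {R : realType}.
Local Notation C := R[i].
Local Notation nrm := (@normc R).
Implicit Types (p q : {poly C}) (z w : C) (f g u : C -> C) (X : set C).

Lemma normc_ge0 z : 0 <= nrm z.
Proof. by case: z => a b; exact: sqrtr_ge0. Qed.

Lemma normc_triangle z w : nrm (z + w) <= nrm z + nrm w.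
Proof. exact: (@le_normcD R z w). Qed.

Lemma normc_opp z : nrm (- z) = nrm z.
Proof. exact: (@normcN R z). Qed.

Lemma normcB_sym z w : nrm (z - w) = nrm (w - z).
Proof. by rewrite -normc_opp opprB. Qed.

Lemma normcX z n : nrm (z ^+ n) = nrm z ^+ n.
Proof. by elim: n => [|n IH]; rewrite ?expr0 ?normc1// !exprS normcM IH. Qed.

Lemma normc_lerB z w : nrm z - nrm w <= nrm (z - w).
Proof. by rewrite lerBlDr -{1}(subrK w z) normc_triangle. Qed.

(** The Wiener algebra norm on the disc of radius [k]. It is submultiplicative, so it passes through
    products and Neumann series and follows a pole while it is moved. *)
Definition l1norm (k : R) p : R := \sum_(i < size p) nrm p`_i * k ^+ i.

Lemma l1normE k p m : (size p <= m)%N -> l1norm k p = \sum_(i < m) nrm p`_i * k ^+ i.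
Proof.
move=> h; rewrite /l1norm (big_ord_widen m (fun i => nrm p`_i * k ^+ i) h).
rewrite big_mkcond/=; apply: eq_bigr => i _; case: ltnP => // hi.
by rewrite nth_default// normc0 mul0r.
Qed.

Lemma l1norm_ge0 k p : 0 <= k -> 0 <= l1norm k p.
Proof. by move=> k0; apply: sumr_ge0 => i _; rewrite mulr_ge0 ?normc_ge0 ?exprn_ge0. Qed.

Lemma l1normD k p q : 0 <= k -> l1norm k (p + q) <= l1norm k p + l1norm k q.
Proof.
move=> k0; pose m := maxn (size p) (size q).
rewrite (@l1normE k (p + q) m) ?size_polyD// (@l1normE k p m) ?leq_maxl//.
rewrite (@l1normE k q m) ?leq_maxr// -big_split/=; apply: ler_sum => i _.
by rewrite coefD -mulrDl ler_wpM2r ?exprn_ge0// normc_triangle.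
Qed.

Lemma l1normZ k (c : C) p : l1norm k (c *: p) = nrm c * l1norm k p.
Proof.
rewrite (@l1normE k _ (size p)) ?size_scale_leq// /l1norm mulr_sumr.
by apply: eq_bigr => i _; rewrite coefZ normcM mulrA.
Qed.

Lemma l1normC k (c : C) : l1norm k c%:P = nrm c.
Proof.
rewrite (@l1normE k _ 1) ?size_polyC_leq1// big_ord_recl big_ord0 addr0.
by rewrite coefC/= expr0 mulr1.
Qed.

Lemma l1normMXC k p (c : C) : l1norm k (p * 'X + c%:P) = k * l1norm k p + nrm c.
Proof.
rewrite (@l1normE k _ (size p).+1); last first.
  by rewrite size_MXaddC; case: ifP.
rewrite big_ord_recl coefD coefMX coefC/= add0r expr0 mulr1 addrC; congr (_ + _).
rewrite /l1norm mulr_sumr; apply: eq_bigr => i _.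
by rewrite coefD coefMX coefC/= addr0 exprS mulrCA.
Qed.

Lemma l1normMX k p : l1norm k (p * 'X) = k * l1norm k p.
Proof. by have := l1normMXC k p 0; rewrite polyC0 addr0 => ->; rewrite normc0 addr0. Qed.

Lemma l1normM k p q : 0 <= k -> l1norm k (p * q) <= l1norm k p * l1norm k q.
Proof.
move=> k0; elim/poly_ind: p => [|p c IH].
  by rewrite mul0r -(scale0r 0) !l1normZ normc0 !mul0r.
rewrite mulrDl mulrAC l1normMXC mulrDl; apply: le_trans (l1normD _ _ k0) _.
by rewrite l1normMX mul_polyC l1normZ lerD2r -mulrA ler_wpM2l.
Qed.

Lemma l1normMXn k p n : l1norm k ('X^n * p) = k ^+ n * l1norm k p.
Proof.
elim: n => [|n IH]; first by rewrite expr0 mul1r mul1r.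
by rewrite exprSr -mulrA (mulrC 'X) mulrA l1normMX IH exprS mulrA.
Qed.

(* Uniform polynomial approximability on [X] with a simultaneous bound on the
   coefficients: the second clause replaces Cauchy's estimates. *)
Definition approximable X (k : R) f (A : R) := forall e, 0 < e ->
  exists2 p, forall z, X z -> nrm (p.[z] - f z) <= e & l1norm k p <= A.

Lemma approximable_le X k f A B : A <= B -> approximable X k f A -> approximable X k f B.
Proof. by move=> AB h e /h[p h1 h2]; exists p => //; exact: le_trans AB. Qed.

Lemma approximable_eq X k f g A : (forall z, X z -> f z = g z) ->
  approximable X k f A -> approximable X k g A.
Proof. by move=> fg h e /h[p h1 h2]; exists p => // z Xz; rewrite -fg// h1. Qed.

Lemma approximable_lim X k f A :
  (forall e, 0 < e -> exists2 g, forall z, X z -> nrm (g z - f z) <= e & approximable X k g A) ->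
  approximable X k f A.
Proof.
move=> h e e0; have e20 : 0 < e / 2 by rewrite divr_gt0.
have [g hg /(_ _ e20)[p hp pA]] := h _ e20.
exists p => // z Xz; rewrite -(subrK (g z) p.[z]) -addrA.
by apply: le_trans (normc_triangle _ _) _; rewrite [leRHS]splitr lerD ?hp ?hg.
Qed.

Lemma approximable_poly X k p : approximable X k (horner p) (l1norm k p).
Proof. by move=> e e0; exists p => // z _; rewrite subrr normc0 ltW. Qed.

Lemma approximableD X k f g A B : 0 <= k ->
  approximable X k f A -> approximable X k g B -> approximable X k (fun z => f z + g z) (A + B).
Proof.
move=> k0 hf hg e e0; have e20 : 0 < e / 2 by rewrite divr_gt0.
have [p hp pA] := hf _ e20; have [q hq qB] := hg _ e20.
exists (p + q) => [z Xz|]; last by apply: le_trans (l1normD _ _ k0) _; exact: lerD.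
rewrite hornerD opprD addrACA; apply: le_trans (normc_triangle _ _) _.
by rewrite [leRHS]splitr lerD ?hp ?hq.
Qed.

Lemma approximableM X k f g A B (D E : R) : 0 <= k ->
  (forall z, X z -> nrm (f z) <= D) -> (forall z, X z -> nrm (g z) <= E) ->
  approximable X k f A -> approximable X k g B -> approximable X k (fun z => f z * g z) (A * B).
Proof.
move=> k0 fD gE hf hg e e0.
(* The minimum with 1 keeps [|p.[z]|] below [|D| + 1]; the second term then makes both halves of the
   product error sum to at most [e]. *)
pose d := Num.min 1 (e / (`|D| + 1 + `|E|)).
have s0 : 0 < `|D| + 1 + `|E| by rewrite ltr_pwDl// ltr_wpDl.
have d0 : 0 < d by rewrite lt_min ltr01 divr_gt0.
have [p hp pA] := hf _ d0; have [q hq qB] := hg _ d0.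
exists (p * q) => [z Xz|]; last first.
  by apply: le_trans (l1normM _ _ k0) _; apply: ler_pM => //; exact: l1norm_ge0.
have -> : (p * q).[z] - f z * g z = p.[z] * (q.[z] - g z) + (p.[z] - f z) * g z.
  by rewrite hornerM; ring.
apply: le_trans (normc_triangle _ _) _; rewrite !normcM.
have d1 : d <= 1 by rewrite ge_min lexx.
have de : d * (`|D| + 1 + `|E|) <= e by rewrite -ler_pdivlMr// ge_min lexx orbT.
have h1 : nrm p.[z] <= `|D| + 1.
  rewrite -(subrK (f z) p.[z]) addrC; apply: le_trans (normc_triangle _ _) _.
  apply: lerD; first exact: le_trans (fD z Xz) (ler_norm _).
  exact: le_trans (hp z Xz) d1.
apply: le_trans de; rewrite mulrDr; apply: lerD.
  by rewrite mulrC; apply: ler_pM; rewrite ?normc_ge0// hq.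
apply: ler_pM; rewrite ?normc_ge0// ?hp//.
exact: le_trans (gE z Xz) (ler_norm _).
Qed.

(** The Neumann sums [S n.+1 = 1 + u * S n] converge geometrically, the error being u^n / (1 - u).
    Both bounds are fixed points of the recursion, since 1 + D / (1 - D) = 1 / (1 - D) and likewise
    for [A], so neither deteriorates with [n]. *)
Lemma approximable_geom X k u A (D : R) : 0 <= k -> 0 <= A < 1 -> 0 <= D < 1 ->
  (forall z, X z -> nrm (u z) <= D) -> approximable X k u A ->
  approximable X k (fun z => (1 - u z)^-1) (1 - A)^-1.
Proof.
move=> k0 /andP[A0 A1] /andP[D0 D1] uD hu.
pose S (n : nat) z := iter n (fun s => 1 + u z * s) 0.
have A1' : 0 < 1 - A by rewrite subr_gt0.
have D1' : 0 < 1 - D by rewrite subr_gt0.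
have hS n : (forall z, X z -> nrm (S n z) <= (1 - D)^-1) /\ approximable X k (S n) (1 - A)^-1.
  elim: n => [|n [IH1 IH2]]; split.
  - by move=> z _; rewrite (_ : S 0%N z = 0)// normc0 invr_ge0 ltW.
  - apply: approximable_le (_ : l1norm k 0%:P <= _) _.
      by rewrite l1normC normc0 invr_ge0 ltW.
    by apply: approximable_eq (approximable_poly _ _ _) => z _; rewrite hornerC.
  - move=> z Xz; rewrite (_ : S n.+1 z = 1 + u z * S n z)//; apply: le_trans (normc_triangle _ _) _.
    rewrite normc1 normcM.
    apply: (@le_trans _ _ (1 + D * (1 - D)^-1)).
      by rewrite lerD2l; apply: ler_pM; rewrite ?normc_ge0 ?uD// IH1.
    by rewrite -[X in X + _](@divff _ (1 - D)) ?gt_eqF// -mulrDl subrK mul1r.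
  - have : approximable X k (fun z => 1 + u z * S n z) (1 + A * (1 - A)^-1).
      apply: approximableD => //; last exact: approximableM uD IH1 hu IH2.
      have := @approximable_poly X k 1%:P; rewrite l1normC normc1.
      by apply: approximable_eq => z _; rewrite hornerC.
    by rewrite -[X in X + _](@divff _ (1 - A)) ?gt_eqF// -mulrDl subrK mul1r.
apply: approximable_lim => e e0.
have hne z : X z -> 1 - D <= nrm (1 - u z).
  move=> Xz; apply: le_trans (normc_lerB _ _); rewrite normc1 lerD2l lerN2; exact: uD.
have SE n z : X z -> S n z - (1 - u z)^-1 = - (u z ^+ n * (1 - u z)^-1).
  move=> Xz; have nz : 1 - u z != 0.
    by apply/eqP => h; have := hne z Xz; rewrite h normc0 leNgt D1'.
  elim: n => [|n IH]; first by rewrite /S/= expr0 mul1r sub0r.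
  have -> : S n.+1 z = 1 + u z * S n z by [].
  have -> : S n z = (1 - u z)^-1 - u z ^+ n * (1 - u z)^-1 by rewrite -[S n z](subrK (1 - u z)^-1) IH addrC.
  by rewrite exprS; field.
have [n hn] : exists n, D ^+ n / (1 - D) <= e.
  have cD : (fun n => D ^+ n) @ \oo --> (0 : R) by apply: cvg_expr; rewrite ger0_norm.
  have e1 : 0 < e * (1 - D) by rewrite mulr_gt0.
  have /cvgrPdist_le/(_ _ e1)[n _ hn] := cD.
  exists n; rewrite ler_pdivrMr//; apply: le_trans (hn n (leqnn n)).
  by rewrite sub0r normrN ler_norm.
exists (S n); last by have [] := hS n.
move=> z Xz; rewrite SE// normc_opp normcM normcX normcV; apply: le_trans hn.
apply: ler_pM; rewrite ?exprn_ge0 ?normc_ge0 ?invr_ge0 ?normc_ge0//.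
  by apply: lerXn2r; rewrite ?nnegrE ?normc_ge0// uD.
rewrite lef_pV2 ?posrE// ?hne//; exact: lt_le_trans D1' (hne z Xz).
Qed.

(** 1 / (w - z) is 1 / (w0 - z) times the geometric series of ratio (w0 - w) / (w0 - z). The series
    converges uniformly because |w0 - w| < d, and in coefficient norm because |w0 - w| B < 1. *)
Lemma approximable_pole_step X k w0 w B (d : R) : 0 <= k -> 0 < d -> 0 <= B ->
  (forall z, X z -> d <= nrm (w0 - z)) -> nrm (w0 - w) < d -> nrm (w0 - w) * B < 1 ->
  approximable X k (fun z => (w0 - z)^-1) B ->
  approximable X k (fun z => (w - z)^-1) (B / (1 - nrm (w0 - w) * B)).
Proof.
move=> k0 d0 B0 hd h1 h2 hw0.
set h := nrm (w0 - w) in h1 h2 *.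
have h0 : 0 <= h by exact: normc_ge0.
have fd z : X z -> nrm (w0 - z)^-1 <= d^-1.
  move=> Xz; rewrite normcV lef_pV2 ?posrE// ?hd//.
  exact: lt_le_trans (hd z Xz).
have ud z : X z -> nrm ((w0 - w) * (w0 - z)^-1) <= h / d.
  by move=> Xz; rewrite normcM -/h ler_wpM2l// fd.
have au : approximable X k (fun z => (w0 - w) * (w0 - z)^-1) (h * B).
  apply: (@approximableM X k (fun=> w0 - w) _ _ _ h d^-1) => //.
  have := @approximable_poly X k (w0 - w)%:P; rewrite l1normC.
  by apply: approximable_eq => z _; rewrite hornerC.
have hd1 : 0 <= h / d < 1 by rewrite divr_ge0 ?(ltW d0)//= ltr_pdivrMr// mul1r.
have gu : approximable X k (fun z => (1 - (w0 - w) * (w0 - z)^-1)^-1) (1 - h * B)^-1.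
  by apply: (approximable_geom k0 _ hd1 ud au); rewrite mulr_ge0.
have gb z : X z -> nrm (1 - (w0 - w) * (w0 - z)^-1)^-1 <= (1 - h / d)^-1.
  move=> Xz; have p1 : 0 < 1 - h / d by rewrite subr_gt0; case/andP: hd1.
  have p2 : 1 - h / d <= nrm (1 - (w0 - w) * (w0 - z)^-1).
    by apply: le_trans (normc_lerB _ _); rewrite normc1 lerD2l lerN2 ud.
  by rewrite normcV lef_pV2 ?posrE//; exact: lt_le_trans p2.
apply: approximable_eq (approximableM k0 fd gb hw0 gu) => z Xz.
rewrite -invfM; congr (_^-1).
have nz : w0 - z != 0.
  by apply/eqP => e; have := hd z Xz; rewrite e normc0 leNgt d0.
by rewrite mulrBr mulr1 mulrCA divff// mulr1; ring.
Qed.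

(** The coefficient bound 1 / (r - k) for a pole of modulus r is reproduced exactly by a step of
    length h: B / (1 - h B) with B = 1 / (r - k) equals 1 / (r - h - k). Hence the final bound
    depends neither on the number of steps nor on the distance [d] that dictates their length. *)
Lemma approximable_pole_ray X (k : R) (e : C) (r1 d : R) : 0 <= k <= 1 -> nrm e = 1 -> k < r1 ->
  0 < d -> (forall z, X z -> nrm z <= 1) ->
  (forall r z, r1 <= r -> X z -> d <= nrm (r%:C%C * e - z)) ->
  approximable X k (fun z => (r1%:C%C * e - z)^-1) (r1 - k)^-1.
Proof.
move=> /andP[k0 k1] e1 kr d0 X1 hd.
have nr (r : R) : 0 <= r -> nrm (r%:C%C * e) = r.
  by move=> r0; rewrite normcM e1 mulr1 /= expr0n/= addr0 sqrtr_sqr ger0_norm.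
(* Starting at modulus at least 2, the pole is so far from the unit disc that the power series at 0
   serves as approximation. *)
pose P := r1 + 2.
have P2 : 2 <= P by rewrite /P lerDr; apply: le_trans (ltW kr).
have P0 : 0 < P by apply: lt_le_trans P2.
have hP : approximable X k (fun z => (P%:C%C * e - z)^-1) (P - k)^-1.
  set w := P%:C%C * e; have nw : nrm w = P by rewrite nr// ltW.
  have w0 : w != 0 by apply/eqP => h; move: P0; rewrite -nw h normc0 ltxx.
  have au : approximable X k (fun z => w^-1 * z) (P^-1 * k).
    have := @approximable_poly X k (w^-1 *: 'X); rewrite l1normZ normcV nw.
    have -> : l1norm k 'X = k by rewrite -['X]mul1r l1normMX l1normC normc1 mulr1.
    by apply: approximable_eq => z _; rewrite hornerZ hornerX.
  have ud z : X z -> nrm (w^-1 * z) <= P^-1.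
    by move=> Xz; rewrite normcM normcV nw ler_piMr ?X1// invr_ge0 ltW.
  have Pi : P^-1 <= 2^-1 by rewrite lef_pV2 ?posrE.
  have gu : approximable X k (fun z => (1 - w^-1 * z)^-1) (1 - P^-1 * k)^-1.
    apply: (approximable_geom k0 _ _ ud au).
      apply/andP; split; first by rewrite mulr_ge0// invr_ge0 ltW.
      rewrite mulrC ltr_pdivrMr// mul1r; apply: le_lt_trans k1 _; lra.
    by rewrite invr_ge0 (ltW P0)/=; lra.
  have gb z : X z -> nrm (1 - w^-1 * z)^-1 <= (1 - P^-1)^-1.
    move=> Xz; have p1 : 0 < 1 - P^-1 by lra.
    have p2 : 1 - P^-1 <= nrm (1 - w^-1 * z).
      by apply: le_trans (normc_lerB _ _); rewrite normc1 lerD2l lerN2 ud.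
    by rewrite normcV lef_pV2 ?posrE//; exact: lt_le_trans p2.
  have cb : approximable X k (fun=> w^-1) P^-1.
    have := @approximable_poly X k w^-1%:P; rewrite l1normC normcV nw.
    by apply: approximable_eq => z _; rewrite hornerC.
  have cw z : X z -> nrm w^-1 <= P^-1 by rewrite normcV nw.
  have := approximableM k0 cw gb cb gu.
  rewrite -invfM mulrBr mulr1 mulrA divff ?gt_eqF// mul1r.
  apply: approximable_eq => z Xz; rewrite -invfM; congr (_^-1).
  by rewrite mulrBr mulr1 mulrA divff// mul1r.
have [M hM] : exists M : nat, 2 / d < M.+1%:R.
  exists (Num.truncn (2 / d)); exact: truncnS_gt.
pose h : R := 2 / M.+1%:R.
have M0 : 0 < M.+1%:R :> R by rewrite ltr0n.
have h0 : 0 < h by rewrite divr_gt0.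
have hd' : h < d by rewrite /h ltr_pdivrMr// mulrC -ltr_pdivrMr.
have key j : (j <= M.+1)%N ->
    approximable X k (fun z => ((P - j%:R * h)%:C%C * e - z)^-1) (P - j%:R * h - k)^-1.
  elim: j => [_|j IH jM]; first by rewrite mul0r subr0.
  have {}IH := IH (ltnW jM).
  have jh : (j.+1)%:R * h <= 2.
    by rewrite /h mulrA ler_pdivrMr// mulrC ler_pM2l// ler_nat.
  set r := P - j%:R * h in IH *.
  have rE : P - j.+1%:R * h = r - h by rewrite /r -natr1; ring.
  have rr : r1 <= r - h by rewrite -rE /P; lra.
  have pk : 0 < r - h - k by rewrite subr_gt0; exact: lt_le_trans rr.
  have pk' : 0 < r - k by lra.
  have nd : nrm (r%:C%C * e - (r - h)%:C%C * e) = h.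
    by rewrite -mulrBl -rmorphB/= subKr nr// ltW.
  have hB : h * (r - k)^-1 < 1 by rewrite ltr_pdivrMr// mul1r; lra.
  have := @approximable_pole_step X k (r%:C%C * e) ((r - h)%:C%C * e) (r - k)^-1 d.
  rewrite nd rE => /(_ k0 d0 _ _ hd' hB IH) H.
  have -> : (r - h - k)^-1 = (r - k)^-1 / (1 - h * (r - k)^-1).
    rewrite -invfM mulrBr mulr1 mulrCA divff ?mulr1 ?gt_eqF//; congr (_^-1); ring.
  apply: H; first by rewrite invr_ge0 ltW.
  by move=> z Xz; apply: hd => //; lra.
have := key M.+1 (leqnn _).
have -> : P - M.+1%:R * h = r1 by rewrite /h /P mulrCA divff ?gt_eqF// mulr1 addrK.
by [].
Qed.

End PolePushing.

(** * Runge approximation in polar coordinates *)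

Section PolarRunge.
Import complex ComplexField.Normc.
Context {R : realType}.
Local Notation C := R[i].
Local Notation nrm := (@normc R).

Definition polar (r y : R) : C := Complex (r * cos y) (r * sin y).

Lemma polarX r y n : polar r y ^+ n = polar (r ^+ n) (n%:R * y).
Proof.
elim: n => [|n IH].
  by rewrite !expr0 mul0r /polar sin0 cos0 mulr0 mulr1.
rewrite exprS IH /polar; apply/eqP; rewrite eq_complex; apply/andP.
rewrite -(natr1 n) mulrDl mul1r sinD cosD exprS /=; split; apply/eqP; ring.
Qed.

Lemma normc_polar r y : 0 <= r -> nrm (polar r y) = r.
Proof.
move=> r0; rewrite /polar /= !exprMn -mulrDr cos2Dsin2 mulr1 sqrtr_sqr ger0_norm//.
Qed.

Lemma normc_polarB (rho r y0 y : R) :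
  nrm (rho%:C%C * polar 1 y0 - polar r y) ^+ 2 = rho ^+ 2 + r ^+ 2 - 2 * rho * r * cos (y - y0).
Proof.
have -> : rho%:C%C * polar 1 y0 - polar r y =
   Complex (rho * cos y0 - r * cos y) (rho * sin y0 - r * sin y).
  apply/eqP; rewrite eq_complex /=; apply/andP; split; apply/eqP; ring.
rewrite /= sqr_sqrtr ?addr_ge0 ?sqr_ge0// cosB.
have e1 := cos2Dsin2 y; have e2 := cos2Dsin2 y0.
transitivity (rho ^+ 2 * (cos y0 ^+ 2 + sin y0 ^+ 2) + r ^+ 2 * (cos y ^+ 2 + sin y ^+ 2)
  - 2 * rho * r * (cos y * cos y0 + sin y * sin y0)); first by ring.
by rewrite e1 e2; ring.
Qed.

(** When the cosine equals c, the squared distance minus (1 - c) rho^2 is c (rho - r)^2 + (1 - c)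
    r^2; a smaller cosine only increases it. *)
Lemma polar_dist (rho r y0 y c : R) : 0 <= rho -> 0 <= r -> 0 <= c < 1 -> cos (y - y0) <= c ->
  Num.sqrt (1 - c) * rho <= nrm (rho%:C%C * polar 1 y0 - polar r y).
Proof.
move=> h0 r0 /andP[c0 c1] hc.
rewrite -(ler_pXn2r (n := 2))// ?nnegrE ?normc_ge0 ?mulr_ge0 ?sqrtr_ge0//.
rewrite normc_polarB exprMn sqr_sqrtr ?subr_ge0 ?(ltW c1)//.
have h1 : rho * r * cos (y - y0) <= rho * r * c by rewrite ler_wpM2l// mulr_ge0.
have h2 : 0 <= c * (rho - r) ^+ 2 by rewrite mulr_ge0 ?sqr_ge0.
have h3 : 0 <= (1 - c) * r ^+ 2 by rewrite mulr_ge0 ?sqr_ge0// subr_ge0 ltW.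
nra.
Qed.

(** Sines arise from values at a point and at its conjugate, so the conjugate points must keep away
    from the ray as well. The angle y + y0 lies between y0 and pi + y0; beyond pi it is reflected to
    2 pi - (y + y0), which exceeds pi - y0. *)
Lemma cosD_le_normcos (y0 y : R) : 0 < y0 < pi -> 0 < y < pi -> cos (- y - y0) <= `|cos y0|.
Proof.
move=> /andP[a1 a2] /andP[b1 b2]; rewrite -opprD cosN.
have [h|h] := leP (y + y0) pi.
  apply: le_trans (ler_norm _); rewrite leNgt; apply/negP.
  by rewrite ltr_cos ?in_itv/=; lra.
have -> : cos (y + y0) = cos (pi *+ 2 - (y + y0)).
  by rewrite [pi *+ 2 - _]addrC cosD2pi cosN.
have -> : `|cos y0| = `|cos (pi - y0)| by rewrite addrC cosDpi cosN normrN.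
apply: le_trans (ler_norm _); rewrite leNgt; apply/negP.
by rewrite ltr_cos ?in_itv/=; lra.
Qed.

Lemma cos_far_le (e y0 y : R) : 0 < y0 < pi -> 0 < y < pi -> 0 < e -> e <= `|y - y0| ->
  cos (y - y0) <= cos (Num.min e 1).
Proof.
move=> hy0 hy e0 he.
have -> : cos (y - y0) = cos `|y - y0|.
  by case: (leP 0 (y - y0)) => h; [rewrite ger0_norm|rewrite ltr0_norm// cosN].
have m1 : Num.min e 1 <= e by rewrite ge_min lexx.
have m2 : 0 < Num.min e 1 by rewrite lt_min e0 ltr01.
have m3 : `|y - y0| < pi by rewrite ltr_norml; lra.
by rewrite leNgt; apply/negP; rewrite ltr_cos ?in_itv/=; lra.
Qed.

(** Taking the difference at conjugate points isolates the sines even when the coefficients are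
    complex, as those produced by pole pushing are. Real coefficients are extracted only
    afterwards. *)
Lemma horner_polar_im (p : {poly C}) r y n : (size p <= n)%N ->
  p.[polar r y] - p.[polar r (- y)] =
  (2 * 'i%C) * \sum_(i < n) p`_i * (r ^+ i * sin (i%:R * y))%:C%C.
Proof.
move=> hn; rewrite !(horner_coef_wide _ hn) -sumrB mulr_sumr; apply: eq_bigr => i _.
rewrite -mulrBr mulrCA; congr (_ * _); rewrite !polarX mulrN /polar cosN sinN.
by apply/eqP; rewrite eq_complex /=; apply/andP; split; apply/eqP; ring.
Qed.

Lemma sum_Re n (c : nat -> C) (a : nat -> R) :
  complex.Re (\sum_(i < n) c i * (a i)%:C%C) = \sum_(i < n) complex.Re (c i) * a i.
Proof.
elim: n => [|n IH]; first by rewrite !big_ord0.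
rewrite !big_ord_recr /= -IH; case: (\sum_(i < n) _) => u v /=.
by case: (c n) => s t /=; ring.
Qed.

Lemma sum_Im n (c : nat -> C) (a : nat -> R) :
  complex.Im (\sum_(i < n) c i * (a i)%:C%C) = \sum_(i < n) complex.Im (c i) * a i.
Proof.
elim: n => [|n IH]; first by rewrite !big_ord0.
rewrite !big_ord_recr /= -IH; case: (\sum_(i < n) _) => u v /=.
by case: (c n) => s t /=; ring.
Qed.

Lemma normc_ge_absRe z : `|complex.Re z| <= nrm z.
Proof. by case: z => a b /=; rewrite -sqrtr_sqr ler_sqrt ?addr_ge0 ?sqr_ge0// lerDl sqr_ge0. Qed.

Lemma normc_ge_absIm z : `|complex.Im z| <= nrm z.
Proof. by case: z => a b /=; rewrite -sqrtr_sqr ler_sqrt ?addr_ge0 ?sqr_ge0// lerDr sqr_ge0. Qed.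

Lemma normc_le_ReIm z : nrm z <= `|complex.Re z| + `|complex.Im z|.
Proof.
case: z => a b /=; rewrite -(ger0_norm (addr_ge0 (normr_ge0 a) (normr_ge0 b))) -sqrtr_sqr.
rewrite ler_wsqrtr// sqrrD !real_normK ?num_real//.
rewrite addrAC lerDl mulrn_wge0// mulr_ge0//.
Qed.

Lemma normc_2i : nrm (2 * 'i%C) = 2.
Proof.
rewrite normcM.
have -> : nrm 2 = 2.
  by rewrite (_ : 2 = (2 : R)%:C%C) /= ?expr0n/= ?addr0 ?sqrtr_sqr ?ger0_norm// rmorph_nat.
by rewrite /= expr0n expr1n add0r sqrtr1 mulr1.
Qed.

(* The poles [1 / (w - z)] can be pushed from infinity down the ray
   [arg w = y0], up to the point of modulus [expR (- S)]. *)
Lemma runge_sine (y0 e S S' J : R) (n0 : nat) (M : R) :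
  0 < y0 < pi -> 0 < e -> 0 < S -> S < S' -> S < J ->
  exists n (a : nat -> R),
  [/\ forall i, (i < n0)%N -> a i = 0,
      forall r y, 0 <= r <= 1 -> 0 < y < pi -> r <= expR (- S') \/ e <= `|y - y0| ->
        `|\sum_(i < n) a i * (r ^+ i * sin (i%:R * y))| <= 1,
      \sum_(i < n) `|a i| * expR (- J) ^+ i <= 1 &
      M <= `|\sum_(i < n) a i * (expR (- S) ^+ i * sin (i%:R * y0))|].
Proof.
move=> hy0 e0 S0 SS' SJ.
set k := expR (- J); set r0 := expR (- S); set r' := expR (- S').
have kr0 : k < r0 by rewrite ltr_expR; lra.
have r'r0 : r' < r0 by rewrite ltr_expR; lra.
have k0 : 0 < k by exact: expR_gt0.
have r00 : 0 < r0 by exact: expR_gt0.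
have r01 : r0 < 1 by rewrite expR_lt1 oppr_lt0.
(* The region to be controlled, closed under conjugation. [X] adds the target point and its
   conjugate, because [p] has to follow the pole function at both. *)
pose K z := exists r y, [/\ 0 <= r <= 1, 0 < y < pi, r <= r' \/ e <= `|y - y0| &
  z = polar r y \/ z = polar r (- y)].
pose X : set C := fun z => [\/ K z, z = polar r0 y0 | z = polar r0 (- y0)].
pose u := polar 1 y0.
pose c1 : R := `|cos (Num.min e 1)|; pose c2 : R := `|cos y0|.
have cosne (c : R) : 0 < c < pi -> 0 <= `|cos c| < 1.
  move=> hc; have s0 := exprn_gt0 2 (sin_gt0_pi hc); have e1 := cos2Dsin2 c.
  rewrite normr_ge0/= -(ltr_pXn2r (n := 2))// ?nnegrE// expr1n real_normK ?num_real//; lra.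
have pi1 : 1 < pi :> R by have := pi_ge2 R; lra.
have hc1 : 0 <= c1 < 1.
  apply: cosne; have m1 : Num.min e 1 <= 1 :> R by rewrite ge_min lexx orbT.
  have m2 : 0 < Num.min e 1 by rewrite lt_min e0 ltr01.
  lra.
have hc2 : 0 <= c2 < 1 by exact: cosne.
pose d1 := Num.sqrt (1 - c1) * r0; pose d2 := Num.sqrt (1 - c2) * r0.
have d10 : 0 < d1 by rewrite mulr_gt0// sqrtr_gt0 subr_gt0; case/andP: hc1.
have d20 : 0 < d2 by rewrite mulr_gt0// sqrtr_gt0 subr_gt0; case/andP: hc2.
pose d0 := Num.min (Num.min d1 d2) (r0 - r').
have d00 : 0 < d0 by rewrite !lt_min d10 d20 subr_gt0.
have d01 : d0 <= d1 by rewrite !ge_min lexx.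
have d02 : d0 <= d2 by rewrite !ge_min lexx orbT.
have d03 : d0 <= r0 - r' by rewrite !ge_min lexx !orbT.
have nu : nrm u = 1 by rewrite normc_polar.
have nru (r : R) : 0 <= r -> nrm (r%:C%C * u) = r.
  by move=> hr; rewrite normcM nu mulr1 /= expr0n/= addr0 sqrtr_sqr ger0_norm.
have conjd r y rho : 0 <= r -> 0 < y < pi -> r0 <= rho ->
    d0 <= nrm (rho%:C%C * u - polar r (- y)).
  move=> hr hy hrho; apply: le_trans (polar_dist _ hr hc2 (cosD_le_normcos hy0 hy)).
    by apply: le_trans d02 _; rewrite ler_wpM2l ?sqrtr_ge0.
  exact: le_trans (ltW r00) hrho.
have Kd z rho : K z -> r0 <= rho -> d0 <= nrm (rho%:C%C * u - z).
  move=> [r [y [/andP[hr r1] hy hcond hz]]] hrho.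
  case: hz => ->; last exact: conjd.
  have rho0 : 0 <= rho by exact: le_trans (ltW r00) hrho.
  case: hcond => h.
    apply: le_trans (normc_lerB _ _); rewrite nru// normc_polar//; lra.
  apply: le_trans (polar_dist rho0 hr hc1 _).
    by apply: le_trans d01 _; rewrite ler_wpM2l ?sqrtr_ge0.
  exact: le_trans (cos_far_le hy0 hy e0 h) (ler_norm _).
have X1 z : X z -> nrm z <= 1.
  case=> [[r [y [/andP[hr r1] _ _ [->|->]]]]|->|->]; rewrite normc_polar// ltW//.
(* [L] bounds the values away from the target (approximation error 1, pole at distance at least
   [d0]) as well as the weighted coefficients. It is fixed before the gap [eta] between pole and
   target, so that gap may shrink at no cost. *)
pose L := 1 + d0^-1 + (r0 - k)^-1.
have L0 : 0 < L by rewrite !addr_gt0// invr_gt0// subr_gt0.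
pose M' := `|M| + 1.
have M'0 : 0 < M' by rewrite ltr_wpDl.
(* The pole stands 1 / t beyond the target. The division by [r0 ^+ n0] prepares for multiplication
   by X^n0, which removes low degrees; the final 1 pays for the approximation error and the extra
   [L] for the value at the conjugate point. *)
pose t := (4 * M' * L + L) / r0 ^+ n0 + 1.
have t0 : 0 < t by rewrite ltr_pwDr// divr_ge0 ?exprn_ge0 ?(ltW r00)// addr_ge0 ?mulr_ge0 ?ltW.
pose eta := t^-1.
have eta0 : 0 < eta by rewrite invr_gt0.
pose r1 := r0 + eta.
have [p hp lp] : exists2 p : {poly C}, (forall z, X z -> nrm (p.[z] - (r1%:C%C * u - z)^-1) <= 1) &
    l1norm k p <= (r1 - k)^-1.
  have k01 : 0 <= k <= 1 by rewrite (ltW k0) ltW//; exact: lt_trans r01.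
  apply: (@approximable_pole_ray _ X k u r1 (Num.min d0 eta) k01 nu _ _ X1) => //.
  - by rewrite /r1; lra.
  - by rewrite lt_min d00.
  move=> rho z hrho Xz; have hrr : r0 <= rho by apply: le_trans hrho; rewrite /r1; lra.
  rewrite ge_min; case: Xz => [Kz|->|->].
  - by rewrite Kd.
  - apply/orP; right; apply: le_trans (normc_lerB _ _).
    rewrite nru; last exact: le_trans (ltW r00) hrr.
    by rewrite normc_polar ?(ltW r00)//; move: hrho; rewrite /r1; lra.
  - by rewrite conjd// ltW.
have r1r0 : r0 <= r1 by rewrite /r1; lra.
have lpL : l1norm k p <= L.
  apply: le_trans lp _; apply: (@le_trans _ _ (r0 - k)^-1).
    by rewrite lef_pV2 ?posrE; lra.
  by rewrite lerDr addr_ge0// invr_ge0 ltW.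
have pK z : X z -> d0 <= nrm (r1%:C%C * u - z) -> nrm p.[z] <= L.
  move=> Xz hz; rewrite -(subrK (r1%:C%C * u - z)^-1 p.[z]).
  apply: le_trans (normc_triangle _ _) _; apply: (@le_trans _ _ (1 + d0^-1)).
    apply: lerD; first exact: hp.
    rewrite normcV lef_pV2 ?posrE//; exact: lt_le_trans hz.
  by rewrite lerDl invr_ge0 subr_ge0 ltW.
have pz0 : t - 1 <= nrm p.[polar r0 y0].
  have Xz : X (polar r0 y0) by apply: Or32.
  have h := hp _ Xz.
  have e1 : r1%:C%C * u - polar r0 y0 = eta%:C%C * u.
    have -> : polar r0 y0 = r0%:C%C * u.
      by apply/eqP; rewrite eq_complex /=; apply/andP; split; apply/eqP; ring.
    by rewrite -mulrBl -rmorphB/= addrC addKr.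
  rewrite e1 normcB_sym in h.
  have := normc_lerB (eta%:C%C * u)^-1 ((eta%:C%C * u)^-1 - p.[polar r0 y0]).
  rewrite subKr normcV nru ?(ltW eta0)// invrK; lra.
pose q := 'X^n0 * p.
have qz z : nrm q.[z] = nrm z ^+ n0 * nrm p.[z] by rewrite hornerM hornerXn normcM normcX.
have qK z : X z -> d0 <= nrm (r1%:C%C * u - z) -> nrm q.[z] <= L.
  move=> Xz hz; rewrite qz; apply: le_trans (pK z Xz hz).
  by rewrite ler_piMl ?normc_ge0// exprn_ile1 ?normc_ge0// X1.
have lq : l1norm k q <= L.
  rewrite l1normMXn; apply: le_trans lpL; apply: ler_piMl; first by apply: l1norm_ge0; exact: ltW.
  by apply: exprn_ile1; rewrite ltW//; exact: lt_trans r01.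
pose n := size q.
pose F r y := \sum_(i < n) q`_i * (r ^+ i * sin (i%:R * y))%:C%C.
have FE r y : nrm (q.[polar r y] - q.[polar r (- y)]) = 2 * nrm (F r y).
  by rewrite (horner_polar_im _ _ (leqnn n)) normcM normc_2i.
have FK r y : 0 <= r <= 1 -> 0 < y < pi -> r <= r' \/ e <= `|y - y0| -> nrm (F r y) <= L.
  move=> hr hy hcond.
  have K1 : K (polar r y) by exists r, y; split => //; left.
  have K2 : K (polar r (- y)) by exists r, y; split => //; right.
  have h1 := qK _ (Or31 _ _ K1) (Kd _ _ K1 r1r0).
  have h2 := qK _ (Or31 _ _ K2) (Kd _ _ K2 r1r0).
  have := normc_triangle q.[polar r y] (- q.[polar r (- y)]).
  rewrite FE normc_opp; lra.
have F0 : 2 * M' * L <= nrm (F r0 y0).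
  have X2 : X (polar r0 (- y0)) by apply: Or33.
  have h2 := qK _ X2 (conjd r0 y0 r1 (ltW r00) hy0 r1r0).
  have h1 : 4 * M' * L + L <= nrm q.[polar r0 y0].
    rewrite qz normc_polar ?(ltW r00)//.
    apply: (@le_trans _ _ (r0 ^+ n0 * (t - 1))); last by rewrite ler_wpM2l// exprn_ge0// ltW.
    by rewrite /t addrK mulrCA divff ?mulr1// expf_neq0// gt_eqF.
  have := normc_lerB q.[polar r0 y0] q.[polar r0 (- y0)].
  rewrite FE; lra.
have qn0 i : (i < n0)%N -> q`_i = 0 by move=> hi; rewrite coefXnM hi.
(* The sum is complex; whichever of its real and imaginary parts is the larger at the target retains
   at least half the modulus, and supplies the real coefficients. *)
have [c [cle cbig]] : exists c : C -> R, (c = complex.Re (R:=R) \/ c = complex.Im (R:=R)) /\ M' * L <= `|c (F r0 y0)|.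
  have := le_trans F0 (normc_le_ReIm _).
  have [h|h] := leP (M' * L) `|complex.Re (F r0 y0)|; first by exists (complex.Re (R:=R)); split => //; left.
  exists (complex.Im (R:=R)); split; [by right|lra].
have cn z : `|c z| <= nrm z by case: cle => ->; [exact: normc_ge_absRe|exact: normc_ge_absIm].
have c0 : c 0 = 0 by case: cle => ->.
have cF r y : c (F r y) = \sum_(i < n) c q`_i * (r ^+ i * sin (i%:R * y)).
  case: cle => ->; [exact: (sum_Re n (fun i => q`_i) (fun i => r ^+ i * sin (i%:R * y)))|
    exact: (sum_Im n (fun i => q`_i) (fun i => r ^+ i * sin (i%:R * y)))].
have cL r y : \sum_(i < n) c q`_i / L * (r ^+ i * sin (i%:R * y)) = c (F r y) / L.
  by rewrite cF mulr_suml; apply: eq_bigr => i _; rewrite mulrAC.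
exists n, (fun i => c q`_i / L); split.
- by move=> i hi; rewrite qn0// c0 mul0r.
- move=> r y hr hy hcond; rewrite cL normrM normfV (gtr0_norm L0) ler_pdivrMr// mul1r.
  exact: le_trans (cn _) (FK r y hr hy hcond).
- rewrite (eq_bigr (fun i : 'I_n => `|c q`_i| * k ^+ i / L)); last first.
    by move=> i _; rewrite normrM normfV (gtr0_norm L0) mulrAC.
  rewrite -mulr_suml ler_pdivrMr// mul1r; apply: le_trans lq.
  by apply: ler_sum => i _; rewrite ler_wpM2r// exprn_ge0// ltW.
- rewrite cL normrM normfV (gtr0_norm L0) ler_pdivlMr//; apply: le_trans cbig.
  by rewrite ler_wpM2r ?(ltW L0)// /M'; have := ler_norm M; lra.
Qed.

End PolarRunge.

(** * Integration *)

Section AeIntegral.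
Context d (T : measurableType d) (R : realType) (mu : {measure set T -> \bar R}).
Implicit Types (D : set T).

Import HBNNSimple.

(* Unlike [ge0_ae_eq_integral], no measurability is assumed. *)
Lemma ge0_ae_le_integral D (f g : T -> \bar R) :
  (forall x, D x -> (0 <= f x)%E) -> (forall x, D x -> (0 <= g x)%E) ->
  {ae mu, forall x, D x -> f x = g x} ->
  (\int[mu]_(x in D) f x <= \int[mu]_(x in D) g x)%E.
Proof.
move=> f0 g0 [N [mN muN subN]]; rewrite (ge0_integralE _ f0) (ge0_integralE _ g0).
apply: ge_ereal_sup => _ [h /= hf <-].
have mNc : measurable (~` N) by exact: measurableC.
(* Cutting the simple function off the null set keeps its integral and places it below [g]
   everywhere. *)
have -> : sintegral mu h = sintegral mu (proj_nnsfun h mNc).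
  rewrite -!integralT_nnsfun; apply: ae_eq_integral => //.
  - exact/measurable_EFinP.
  - exact/measurable_EFinP.
  exists N; split => // x /= hx; apply: contrapT => nx; apply: hx => _.
  by rewrite /proj_nnsfun /= mindicE mem_set// mulr1.
apply: ereal_sup_ubound; exists (proj_nnsfun h mNc) => //= x.
rewrite /proj_nnsfun /= mindicE; case: (boolP (x \in ~` N)) => xN; last first.
  rewrite mulr0 /patch; case: ifP => // xD; apply: g0; exact: set_mem.
rewrite mulr1; apply: le_trans (hf x) _; rewrite /patch; case: ifP => // /set_mem xD.
rewrite le_eqVlt; apply/orP; left; apply/eqP.
move/set_mem : xN => nNx; apply: contrapT => nfg; apply: nNx; apply: subN => /= e.
exact/nfg/e.
Qed.

(** Needed for integrands in time such as [Vdot (F t) phi], which are known almost everywhere and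
    whose measurability is not among the available facts. *)
Lemma ae_eq_integral_nomeas D (f g : T -> \bar R) :
  {ae mu, forall x, D x -> f x = g x} ->
  (\int[mu]_(x in D) f x = \int[mu]_(x in D) g x)%E.
Proof.
move=> /ae_eq_funeposneg[fgp fgn]; rewrite integralE [RHS]integralE.
have H u v : ae_eq mu D u v -> (forall x, 0 <= u x)%E -> (forall x, 0 <= v x)%E ->
    (\int[mu]_(x in D) u x = \int[mu]_(x in D) v x)%E.
  move=> uv u0 v0; apply/eqP; rewrite eq_le !ge0_ae_le_integral//.
  by apply: filterS uv => x e Dx; rewrite e.
by rewrite (H _ _ fgp) ?(H _ _ fgn).
Qed.

Lemma ae_eq_Rintegral_nomeas D (f g : T -> R) :
  {ae mu, forall x, D x -> f x = g x} ->
  \int[mu]_(x in D) f x = \int[mu]_(x in D) g x.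
Proof.
move=> h; rewrite /Rintegral; congr fine; apply: ae_eq_integral_nomeas.
by apply: filterS h => x e Dx; rewrite e.
Qed.

End AeIntegral.

Lemma ge0_cvge0 (R : realType) (I : Type) (F : set_system I) (FF : Filter F) (u : I -> \bar R) :
  (forall i, 0 <= u i)%E -> (forall e : R, 0 < e -> \forall i \near F, (u i <= e%:E)%E) ->
  u @ F --> 0%E.
Proof.
move=> u0 h; apply/fine_cvgP; split.
  have := h 1 ltr01; apply: filterS => i hi.
  by rewrite ge0_fin_numE//; apply: le_lt_trans hi _; rewrite ltry.
apply/cvgrPdist_le => e e0; have := h e e0; apply: filterS => i hi /=.
rewrite sub0r normrN ger0_norm ?fine_ge0// -lee_fin fineK//.
by rewrite ge0_fin_numE//; apply: le_lt_trans hi _; rewrite ltry.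
Qed.

(** * L^2 convergence tested against bounded functions *)

Section BoundedMultipliers.
Context d (T : measurableType d) (R : realType) (mu : {measure set T -> \bar R}).
Context (D : set T) (mD : measurable D) (muD : (mu D < +oo)%E).
Implicit Types (f g h : T -> R).

Definition bounded_on g (M : R) := measurable_fun D g /\ forall x, D x -> `|g x| <= M.

Lemma bounded_onP g M : bounded_on g M -> [bounded g x | x in D].
Proof.
move=> [_ h]; exists M; split; first exact: num_real.
by move=> y My x Dx; exact: le_trans (h x Dx) (ltW My).
Qed.

Lemma bounded_integrable g M : bounded_on g M -> mu.-integrable D (EFin \o g).
Proof. by move=> h; apply: measurable_bounded_integrable => //; [case: h|exact: bounded_onP h]. Qed.

Lemma L2on_measurable f : L2on mu D f -> measurable_fun D f.
Proof.
rewrite /L2on inE => /andP[]; rewrite !inE/= => /(measurable_restrictT _ mD) mf _.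
exact: mf.
Qed.

Lemma L2on_Lnorm f : L2on mu D f -> ('N[mu]_2%:E[EFin \o (f \_ D)] < +oo)%E.
Proof. by rewrite /L2on inE => /andP[_]; rewrite inE. Qed.

Lemma bounded_L2on g M : bounded_on g M -> L2on mu D g.
Proof.
move=> [mg gM]; rewrite /L2on; apply/andP; split; rewrite inE/=.
  exact/(measurable_restrictT _ mD).
rewrite /finite_norm unlock.
apply: poweR_lty.
have M0 x : D x -> 0 <= M by move=> /gM; exact: le_trans.
apply: (@le_lt_trans _ _ (\int[mu]_(x in D) (M ^+ 2)%:E)%E).
  rewrite [leRHS]integral_mkcond; apply: ge0_le_integral => //.
  - by move=> x _; exact: poweR_ge0.
  - apply: (measurableT_comp (measurable_poweR _)) => //.
    apply: measurableT_comp => //; apply/measurable_EFinP.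
    exact/(measurable_restrictT _ mD).
  - by apply/(measurable_restrictT _ mD); exact: measurable_cst.
  move=> x _; rewrite /patch /=; case: ifP => [/set_mem Dx|_].
    rewrite lee_fin powR_mulrn// ler_pXn2r ?nnegrE//; first exact: gM.
    exact: M0 Dx.
  by rewrite normr0 powR0.
rewrite integral_cst//= lte_mul_pinfty// ?lee_fin ?sqr_ge0//.
Qed.

(** Cauchy-Schwarz against the constant 1; [K] is the norm of that constant on the set [D] of finite
    measure. *)
Lemma L1_le_L2dist : exists2 K : R, 0 <= K & forall f h,
  measurable_fun D f -> measurable_fun D h ->
  (\int[mu]_(x in D) `|f x - h x|%:E <= K%:E * L2dist mu D f h)%E.
Proof.
have m1 : bounded_on (cst 1) 1 by split => // x _; rewrite normr1.
have N1 := L2on_Lnorm (bounded_L2on m1).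
set c := 'N[mu]_2%:E[_]%E in N1.
have c0 : (0 <= c)%E by exact: Lnorm_ge0.
have cfin : c \is a fin_num by rewrite ge0_fin_numE.
exists (fine c); first exact: fine_ge0.
move=> f h mf mh; rewrite fineK// muleC.
have mfh : measurable_fun setT ((f \- h)%R \_ D).
  by apply/(measurable_restrictT _ mD); exact: measurable_funB.
have m1' : measurable_fun setT ((cst 1 : T -> R) \_ D).
  by apply/(measurable_restrictT _ mD).
apply: le_trans (hoelder mu mfh m1' (ltr0n _ 2) (ltr0n _ 2) _); last by lra.
rewrite Lnorm1 integral_mkcond; apply: ge0_le_integral => //.
- by move=> x _; rewrite /patch; case: ifP.
- apply/(measurable_restrictT _ mD)/measurable_EFinP.
  by apply: measurableT_comp => //; exact: measurable_funB.
- by apply: measurableT_comp => //; apply/measurable_EFinP; exact: measurable_funM.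
by move=> x _; rewrite /patch/=; case: ifP => // _; rewrite /= ?mulr1 ?mul0r ?normr0.
Qed.

Lemma L2on_integrable f : L2on mu D f -> mu.-integrable D (EFin \o f).
Proof.
move=> Lf; have mf := L2on_measurable Lf.
have [K K0 hK] := L1_le_L2dist.
apply/integrableP; split; first exact/measurable_EFinP.
have := hK f (cst 0) mf (@measurable_cst _ _ _ _ _ _).
under eq_integral do rewrite subr0.
move/le_lt_trans; apply.
rewrite lte_mul_pinfty// ?lee_fin// /L2dist.
have -> : (f \- cst 0)%R = f by apply/funext => x /=; rewrite subr0.
exact: L2on_Lnorm.
Qed.

Lemma integrable_bddM f g M : mu.-integrable D (EFin \o f) -> bounded_on g M ->
  mu.-integrable D (EFin \o (fun x => f x * g x)).
Proof.
move=> hf hg; have := integrableMr mD (proj1 hg) (bounded_onP hg) hf.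
by apply: eq_integrable => // x _; rewrite /= mulrC.
Qed.

Lemma le_Rintegral_bdd f g M : mu.-integrable D (EFin \o f) -> bounded_on g M ->
  `|\int[mu]_(x in D) (f x * g x)| <= M * \int[mu]_(x in D) `|f x|.
Proof.
move=> hf hg; have hfg := integrable_bddM hf hg.
apply: le_trans (le_normr_Rintegral mD hfg) _.
have hfn : mu.-integrable D (EFin \o (fun x => `|f x|)) by exact: integrable_norm hf.
rewrite -RintegralZl//; apply: le_Rintegral => //.
- exact: integrable_norm hfg.
- exact: (integrableZl mD M hfn).
by move=> x Dx; rewrite normrM mulrC ler_wpM2r//; case: hg => _; exact.
Qed.

Lemma RintegralM_dist : exists2 K : R, 0 <= K & forall f h g M, 0 <= M ->
  L2on mu D f -> L2on mu D h -> bounded_on g M ->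
  (`|\int[mu]_(x in D) (f x * g x) - \int[mu]_(x in D) (h x * g x)|%:E
    <= (M * K)%:E * L2dist mu D f h)%E.
Proof.
have [K K0 hK] := L1_le_L2dist; exists K => // f h g M M0 Lf Lh bg.
have If := L2on_integrable Lf; have Ih := L2on_integrable Lh.
have Ifh : mu.-integrable D (EFin \o (f \- h)%R).
  by have := integrableB mD If Ih; apply: eq_integrable.
rewrite -RintegralB//; [|exact: integrable_bddM bg|exact: integrable_bddM bg].
have -> : \int[mu]_(x in D) (f x * g x - h x * g x) = \int[mu]_(x in D) ((f \- h)%R x * g x).
  by apply: eq_Rintegral => x _; rewrite /= mulrBl.
rewrite EFinM -muleA; apply: (@le_trans _ _ (M%:E * \int[mu]_(x in D) `|f x - h x|%:E)%E).
  have -> : (\int[mu]_(x in D) `|f x - h x|%:E = (\int[mu]_(x in D) `|(f \- h)%R x|)%:E)%E.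
    rewrite /Rintegral fineK//; apply: integrable_fin_num => //.
    exact: integrable_norm Ifh.
  by rewrite -EFinM lee_fin; exact: le_Rintegral_bdd.
rewrite lee_wpmul2l ?lee_fin//; apply: hK; exact: L2on_measurable.
Qed.

Lemma cvg_RintegralM (I : Type) (F : set_system I) (FF : Filter F)
    (f_ : I -> T -> R) f g M :
  L2on mu D f -> bounded_on g M -> (\forall i \near F, L2on mu D (f_ i)) ->
  L2dist mu D (f_ i) f @[i --> F] --> 0%E ->
  \int[mu]_(x in D) (f_ i x * g x) @[i --> F] --> \int[mu]_(x in D) (f x * g x).
Proof.
move=> Lf [mg gM] hL cv; have [K K0 hK] := RintegralM_dist.
have bg : bounded_on g `|M| by split => // x Dx; exact: le_trans (gM x Dx) (ler_norm _).
apply/cvgrPdist_le => e e0.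
have c0 : 0 < `|M| * K + 1 by rewrite ltr_wpDl// mulr_ge0.
have : \forall i \near F, (L2dist mu D (f_ i) f <= (e / (`|M| * K + 1))%:E)%E.
  have : nbhs (0%E : \bar R) [set x : \bar R | (x <= (e / (`|M| * K + 1))%:E)%E].
    have : nbhs (0%E : \bar R) [set x : \bar R | (x < (e / (`|M| * K + 1))%:E)%E].
      apply: open_nbhs_nbhs; split; first exact: open_ereal_lt_ereal.
      by rewrite /= lte_fin divr_gt0.
    by apply: filterS => x /=; exact: ltW.
  by move=> /cv.
move=> hd; apply: filterS2 hL hd => i Li hd; rewrite -lee_fin distrC.
apply: le_trans (hK _ _ _ _ (normr_ge0 M) Li Lf bg) _.
apply: (@le_trans _ _ ((`|M| * K)%:E * (e / (`|M| * K + 1))%:E)%E).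
  by rewrite lee_wpmul2l ?lee_fin ?mulr_ge0.
by rewrite -EFinM lee_fin mulrCA ger_pMr// ler_pdivrMr// mul1r lerDl.
Qed.

Lemma L2dist_le f g (e : R) : 0 <= e -> measurable_fun D f -> measurable_fun D g ->
  (\int[mu]_(x in D) ((f x - g x) ^+ 2)%:E <= (e ^+ 2)%:E)%E -> (L2dist mu D f g <= e%:E)%E.
Proof.
move=> e0 mf mg h; rewrite /L2dist unlock.
have -> : e%:E = ((e ^+ 2)%:E `^ 2^-1)%E.
  by rewrite poweR_EFin -powR_mulrn// -powRrM divff// powRr1.
have hE : (\int[mu]_x `|((f \- g)%R \_ D) x|%:E `^ 2 = \int[mu]_(x in D) ((f x - g x) ^+ 2)%:E)%E.
  rewrite [RHS]integral_mkcond; apply: eq_integral => x _; rewrite /patch; case: ifP => _.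
    by rewrite poweR_EFin powR_mulrn//= real_normK ?num_real.
  by rewrite normr0 poweR0r.
have i0 : (0 <= \int[mu]_(x in D) ((f x - g x) ^+ 2)%:E)%E.
  by apply: integral_ge0 => x _; rewrite lee_fin sqr_ge0.
rewrite hE gt0_ler_poweR//; first by rewrite in_itv/= leey i0.
by rewrite in_itv/= leey andbT lee_fin sqr_ge0.
Qed.

Lemma bounded_cvg_L2 (f_ : nat -> T -> R) f M : (forall n, bounded_on (f_ n) M) ->
  measurable_fun D f -> (forall x, D x -> f_ n x @[n --> \oo] --> f x) ->
  L2dist mu D (f_ n) f @[n --> \oo] --> 0%E.
Proof.
move=> bf mf cf.
have fM x : D x -> `|f x| <= M.
  move=> Dx; have h : `|f_ n x| @[n --> \oo] --> `|f x| by apply: cvg_norm; exact: cf.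
  rewrite -(cvg_lim _ h)//; apply: limr_le; first by apply/cvg_ex; eexists; exact: h.
  by apply: nearW => n; case: (bf n) => _; exact.
have m2 n : measurable_fun D (fun x => (f_ n x - f x) ^+ 2).
  by apply: measurable_funX; apply: measurable_funB => //; case: (bf n).
have [|||||_ _] := @dominated_convergence _ T R mu D mD (fun n x => ((f_ n x - f x) ^+ 2)%:E)
  (cst 0%E) (cst ((2 * M) ^+ 2)%:E).
- by move=> n; exact/measurable_EFinP.
- exact: measurable_cst.
- apply/aeW => x Dx; apply: cvg_EFin; first exact: nearW.
  have h : f_ n x - f x @[n --> \oo] --> f x - f x by apply: cvgB; [exact: cf|exact: cvg_cst].
  have H : (f_ n x - f x) * (f_ n x - f x) @[n --> \oo] --> (f x - f x) * (f x - f x).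
    exact: cvgM.
  by move: H; rewrite subrr mulr0.
- apply: (@bounded_integrable (cst ((2 * M) ^+ 2)) `|(2 * M) ^+ 2|).
  by split.
- apply/aeW => x n Dx; rewrite /= lee_fin ger0_norm ?sqr_ge0//.
  have M0 : 0 <= M by exact: le_trans (fM x Dx).
  rewrite -[leLHS]real_normK ?num_real//; apply: lerXn2r; rewrite ?nnegrE ?mulr_ge0//.
  apply: le_trans (ler_normB _ _) _; rewrite mulr_natl mulr2n lerD ?fM//.
  by case: (bf n) => _; exact.
rewrite integral0 => H.
apply: ge0_cvge0 => [n|e e0]; first exact: Lnorm_ge0.
have : \forall n \near \oo, (\int[mu]_(x in D) ((f_ n x - f x) ^+ 2)%:E <= (e ^+ 2)%:E)%E.
  have /H : nbhs (0%E : \bar R) [set x : \bar R | (x < (e ^+ 2)%:E)%E].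
    apply: open_nbhs_nbhs; split; first exact: open_ereal_lt_ereal.
    by rewrite /= lte_fin exprn_gt0.
  by move=> h; near=> n; apply: ltW; near: n; exact: h.
move=> hnear; near=> n; apply: L2dist_le => //; [exact: ltW|by case: (bf n)|by near: n].
Unshelve. all: by end_near. Qed.

End BoundedMultipliers.

Section PlaneMeasurability.
Context {R : realType}.
Local Notation T2 := (measurableTypeR R * measurableTypeR R)%type.

(** The product sigma-algebra is generated by rectangles; an open set belongs to it as the countable
    union of the rational rectangles it contains. *)
Lemma open_measurable_plane (W : set (R * R)) : open W -> measurable (W : set T2).
Proof.
move=> oW.
pose rect (q : rat * rat * (rat * rat)) : set T2 :=
  `]ratr q.1.1, ratr q.1.2[%classic `*` `]ratr q.2.1, ratr q.2.2[%classic.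
pose F q : set T2 := if `[< rect q `<=` W >] then rect q else set0.
have -> : (W : set T2) = \bigcup_q F q.
  apply/seteqP; split=> [[x y] Wxy|z [q _]]; last first.
    by rewrite /F; case: asboolP => // h /h.
  have [[A B] /= [nA nB] AB] : nbhs (x, y) W by exact: open_nbhs_nbhs.
  have /nbhs_ballP[e /= e0 eA] := nA; have /nbhs_ballP[e' /= e'0 eB] := nB.
  have sub (r s : R) : 0 < s -> exists q1 q2 : rat, [/\ ratr q1 < r, r < ratr q2,
      r - s < ratr q1 & ratr q2 < r + s].
    move=> s0.
    have /rat_in_itvoo[q1 /itvP h1] : r - s < r by rewrite ltrBlDr ltrDl.
    have /rat_in_itvoo[q2 /itvP h2] : r < r + s by rewrite ltrDl.
    by exists q1, q2; rewrite !h1 !h2.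
  have [a1 [a2 [h1 h2 h3 h4]]] := sub x e e0.
  have [b1 [b2 [k1 k2 k3 k4]]] := sub y e' e'0.
  exists (a1, a2, (b1, b2)) => //; rewrite /F; case: asboolP => [_|].
    by split; rewrite /= in_itv /=; apply/andP.
  case=> -[u v] [/=]; rewrite !in_itv /= => /andP[u1 u2] /andP[v1 v2].
  apply: AB; split; [apply: eA|apply: eB]; rewrite /ball /= ltr_distl; apply/andP; split; lra.
apply: countable_bigcupT_measurable => // q; rewrite /F; case: ifP => _ //.
exact: measurableX.
Qed.

Lemma continuous_measurable_plane (f : R * R -> R) : continuous f ->
  measurable_fun setT (f : T2 -> measurableTypeR R).
Proof.
move=> cf; apply: (measurability _ (measurable_realfun.RGenOpens.measurableE R)).
move=> _ [_ [a [b ->] <-]]; rewrite setTI; apply: open_measurable_plane.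
by apply: open_comp; [move=> z _; exact: cf|exact: interval_open].
Qed.

End PlaneMeasurability.

(** * Test functions and the form domain *)

Section Plane.
Context {R : realType}.
Local Notation T2 := (measurableTypeR R * measurableTypeR R)%type.
Notation mu := (@lebesgue_measure R).
Implicit Types (A B : R -> R) (f : R * R -> R) (z : R * R).

Lemma OmegaE : Omega R = `]-1, 1[%classic `*` `]0, pi[%classic.
Proof. by apply/seteqP; split=> z; rewrite /Omega /= !in_itv/=. Qed.

Lemma measurable_Omega : measurable (Omega R : set T2).
Proof. by rewrite OmegaE; exact: measurableX. Qed.

Lemma leb2_Omega_lty : (leb2 R (Omega R) < +oo)%E.
Proof.
have h (a b : R) : (mu `]a, b[%classic < +oo)%E.
  by rewrite lebesgue_measure_itv; case: ifP => // _; rewrite /= -EFinB ltry.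
rewrite OmegaE /leb2 product_measure1E//; apply: lte_mul_pinfty; last exact: h.
  exact: measure_ge0.
by rewrite ge0_fin_numE; [exact: h|exact: measure_ge0].
Qed.

Let sliceX f z (h : R) :
  h^-1 *: (f (h *: ((1, 0) : R * R) + z) - f z) =
  h^-1 *: (f (h *: (1 : R) + z.1, z.2) - f (z.1, z.2)).
Proof.
case: z => x y; congr (_ *: (f _ - _)).
by rewrite -[LHS]/(h *: (1 : R) + x, h *: (0 : R) + y) scaler0 add0r.
Qed.

Let sliceY f z (h : R) :
  h^-1 *: (f (h *: ((0, 1) : R * R) + z) - f z) =
  h^-1 *: (f (z.1, h *: (1 : R) + z.2) - f (z.1, z.2)).
Proof.
case: z => x y; congr (_ *: (f _ - _)).
by rewrite -[LHS]/(h *: (0 : R) + x, h *: (1 : R) + y) scaler0 add0r.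
Qed.

Lemma derivable_sliceX f z :
  derivable f z ((1, 0) : R * R) = derivable (fun x => f (x, z.2)) z.1 1.
Proof. by rewrite /derivable; under eq_fun do rewrite sliceX. Qed.

Lemma derivable_sliceY f z :
  derivable f z ((0, 1) : R * R) = derivable (fun y => f (z.1, y)) z.2 1.
Proof. by rewrite /derivable; under eq_fun do rewrite sliceY. Qed.

Lemma dXE f z : dX f z = derive1 (fun x => f (x, z.2)) z.1.
Proof. by rewrite derive1E /dX /derive; under eq_fun do rewrite sliceX. Qed.

Lemma dYE f z : dY f z = derive1 (fun y => f (z.1, y)) z.2.
Proof. by rewrite derive1E /dY /derive; under eq_fun do rewrite sliceY. Qed.

Definition tens A B : R * R -> R := fun z => A z.1 * B z.2.

Lemma dX_tens A B : smooth A -> dX (tens A B) = tens (derive1 A) B.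
Proof.
move=> sA; apply/funext => z; rewrite dXE /tens /=; apply: is_derive1E.
have := is_derive1M (smooth_is_derive z.1 sA) (is_derive1_cst (B z.2) z.1).
by rewrite mulr0 addr0.
Qed.

Lemma dY_tens A B : smooth B -> dY (tens A B) = tens A (derive1 B).
Proof.
move=> sB; apply/funext => z; rewrite dYE /tens /=; apply: is_derive1E.
exact: is_derive1Z (smooth_is_derive z.2 sB).
Qed.

Lemma continuous_tens A B : continuous A -> continuous B -> continuous (tens A B).
Proof.
move=> cA cB z; apply: cvgM.
  by apply: (continuous_comp (f := fst) (g := A)); [exact: cvg_fst|exact: cA].
by apply: (continuous_comp (f := snd) (g := B)); [exact: cvg_snd|exact: cB].
Qed.

Lemma Ck_tens k A B : smooth A -> smooth B -> Ck k (tens A B).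
Proof.
elim: k A B => [|k IH] A B sA sB /=; split=> //.
- by apply: continuous_tens; exact: smooth_continuous.
- by apply: continuous_tens; exact: smooth_continuous.
split.
- move=> z; rewrite derivable_sliceX.
  apply: is_derive_derivable (is_derive1M (smooth_is_derive z.1 sA) (is_derive1_cst (B z.2) z.1)).
- move=> z; rewrite derivable_sliceY.
  exact: is_derive_derivable (is_derive1Z (A z.1) (smooth_is_derive z.2 sB)).
- by rewrite dX_tens//; apply: IH => //; exact: smooth_derive1.
- by rewrite dY_tens//; apply: IH => //; exact: smooth_derive1.
Qed.

Lemma test_Omega_tens A B (e : R) : smooth A -> smooth B -> 0 < e ->
  (forall x, A x != 0 -> -1 + e <= x <= 1 - e) ->
  (forall y, B y != 0 -> 0 + e <= y <= pi - e) -> test_Omega (tens A B).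
Proof.
move=> sA sB e0 hA hB; split; first by move=> k; exact: Ck_tens.
pose K := `[-1 + e, 1 - e]%classic `*` `[0 + e, pi - e]%classic.
have cK : compact K by apply: compact_setX; exact: segment_compact.
have KO : K `<=` Omega R.
  by move=> z [/=]; rewrite !in_itv /= => h1 h2; split => /=; lra.
have sub : [set z | tens A B z != 0] `<=` K.
  move=> z /=; rewrite mulf_eq0 negb_or => /andP[/hA h1 /hB h2].
  by split; rewrite /= in_itv.
have clK : closed K.
  by apply: compact_closed cK; exact: (@norm_hausdorff _ (R * R)%type).
have cl : closure [set z | tens A B z != 0] `<=` K.
  by rewrite (iffLR (closure_id K))//; exact: closure_subset.
split; last by move=> z /cl /KO.
by apply: subclosed_compact cK cl; exact: closed_closure.
Qed.

Lemma continuous_itv_bounded A (a b : R) : continuous A ->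
  exists2 M : R, 0 <= M & forall x, a <= x <= b -> `|A x| <= M.
Proof.
move=> cA; have [ab|ba] := leP a b; last by exists 0 => // x /andP[h1 h2]; lra.
have cN : {within `[a, b], continuous (fun x => `|A x|)}.
  by apply: continuous_subspaceT => x; apply: cvg_norm; exact: cA.
have [c _ hc] := EVT_max ab cN.
by exists `|A c| => // x hx; apply: hc; rewrite in_itv.
Qed.

Definition bddO f M := bounded_on (Omega R : set T2) (f : T2 -> measurableTypeR R) M.

Lemma bddO_tens A B : continuous A -> continuous B -> exists2 M, 0 <= M & bddO (tens A B) M.
Proof.
move=> cA cB; have [M1 M10 h1] := continuous_itv_bounded (-1) 1 cA.
have [M2 M20 h2] := continuous_itv_bounded 0 pi cB.
exists (M1 * M2); first exact: mulr_ge0.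
split; last first.
  move=> z [/andP[a1 a2] /andP[b1 b2]]; rewrite /tens normrM; apply: ler_pM => //.
    by apply: h1; rewrite !ltW.
  by apply: h2; rewrite !ltW.
apply: measurable_funTS; apply: continuous_measurable_plane; exact: continuous_tens.
Qed.

End Plane.

(** * Product functions in the form domain *)

Section GrushinElement.
Context {R : realType}.
Local Notation T2 := (measurableTypeR R * measurableTypeR R)%type.
Implicit Types (A B : R -> R).

(** Uniform bounds and pointwise convergence of the function and of its derivative suffice, since
    dominated convergence turns them into L^2 convergence. The dangerous term is A times the
    derivative of the cutoff: it stays bounded because A vanishes linearly at the ends. *)
Lemma smooth_compact_approx A (l r : R) : l < r -> smooth A -> A l = 0 -> A r = 0 ->
  exists Ak : nat -> R -> R, exists M : R,
  [/\ forall k, smooth (Ak k),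
      forall k, exists2 e, 0 < e & forall x, Ak k x != 0 -> l + e <= x <= r - e,
      forall k x, l <= x <= r -> `|Ak k x| <= M /\ `|derive1 (Ak k) x| <= M &
      forall x, l < x < r -> \forall k \near \oo,
        Ak k x = A x /\ derive1 (Ak k) x = derive1 A x].
Proof.
move=> lr sA Al Ar.
have [c [K [sc c01 csupp _ [cK cnear]]]] := smooth_cutoffs lr.
have sA' := smooth_derive1 sA.
have [L L0 hL] := continuous_itv_bounded l r (smooth_continuous sA').
have [M M0 hM] := continuous_itv_bounded l r (smooth_continuous sA).
have w0 : 0 < r - l by rewrite subr_gt0.
(* The mean value bounds from the two ends, weighted by the distance to the opposite end and added;
   this matches the weight in the cutoff estimate. *)
have hA x : l <= x <= r -> `|A x| * (r - l) <= 2 * L * ((x - l) * (r - x)).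
  move=> /andP[lx xr].
  have h1 : `|A x| <= L * (x - l).
    have := mvt_le lx (fun t => smooth_is_derive t sA) (B := L).
    rewrite Al subr0; apply => t /andP[t1 t2]; apply: hL; rewrite t1/=; exact: le_trans xr.
  have h2 : `|A x| <= L * (r - x).
    have := mvt_le xr (fun t => smooth_is_derive t sA) (B := L).
    rewrite Ar sub0r normrN; apply => t /andP[t1 t2]; apply: hL; rewrite t2 andbT; exact: le_trans t1.
  have h3 : 0 <= x - l by rewrite subr_ge0.
  have h4 : 0 <= r - x by rewrite subr_ge0.
  have := ler_wpM2r h4 h1; have := ler_wpM2r h3 h2; lra.
have K0 : 0 <= K.
  have := cK 0%N l; rewrite lexx ltW// subrr mul0r mulr0; exact.
have dAk k x : derive1 (fun x => A x * c k x) x = derive1 A x * c k x + A x * derive1 (c k) x.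
  apply: is_derive1E; apply: is_derive1M; exact: smooth_is_derive.
exists (fun k x => A x * c k x), (M + L + 2 * L * K / (r - l)); split.
- by move=> k; exact: smoothM.
- move=> k; have [e e0 he] := csupp k; exists e => // x.
  by rewrite mulf_eq0 negb_or => /andP[_ /he].
- move=> k x hx; have /andP[ck0 ck1] := c01 k x; split.
    rewrite normrM (ger0_norm ck0); apply: (@le_trans _ _ M).
      by apply: (@le_trans _ _ (`|A x|)); [rewrite ler_piMr|exact: hM].
    by rewrite -addrA lerDl addr_ge0// divr_ge0 ?mulr_ge0// ltW.
  rewrite dAk; apply: le_trans (ler_normD _ _) _; apply: lerD.
    rewrite normrM (ger0_norm ck0); apply: (@le_trans _ _ L).
      by apply: (@le_trans _ _ (`|derive1 A x|)); [rewrite ler_piMr|exact: hL].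
    by rewrite lerDr.
  rewrite normrM ler_pdivlMr// mulrAC.
  apply: (@le_trans _ _ (2 * L * ((x - l) * (r - x)) * `|derive1 (c k) x|)).
    by rewrite ler_wpM2r// hA.
  rewrite -mulrA [X in _ * X]mulrC; apply: ler_wpM2l; first by rewrite mulr_ge0.
  exact: cK.
- move=> x /andP[lx xr].
  pose d := Num.min (x - l) (r - x).
  have d0 : 0 < d by rewrite lt_min !subr_gt0 lx.
  have := cnear _ d0; apply: filterS => k hk.
  have [|h1 h2] := hk x.
    have : d <= x - l by rewrite ge_min lexx.
    have : d <= r - x by rewrite ge_min lexx orbT.
    lra.
  by rewrite dAk h1 h2 !mulr1 mulr0 addr0.
Qed.

Lemma tens_bound A B (M1 M2 : R) : continuous A -> continuous B ->
  (forall x, -1 <= x <= 1 -> `|A x| <= M1) -> (forall y, 0 <= y <= pi -> `|B y| <= M2) ->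
  bddO (tens A B) (M1 * M2).
Proof.
move=> cA cB h1 h2; split; last first.
  move=> z [/andP[a1 a2] /andP[b1 b2]]; rewrite /tens normrM; apply: ler_pM => //.
    by apply: h1; rewrite !ltW.
  by apply: h2; rewrite !ltW.
by apply: measurable_funTS; apply: continuous_measurable_plane; exact: continuous_tens.
Qed.

Lemma tens_cvg (Ak Bk : nat -> R -> R) A B (M1 M2 : R) :
  (forall k, continuous (Ak k)) -> (forall k, continuous (Bk k)) -> continuous A -> continuous B ->
  (forall k x, -1 <= x <= 1 -> `|Ak k x| <= M1) ->
  (forall k y, 0 <= y <= pi -> `|Bk k y| <= M2) ->
  (forall x, -1 < x < 1 -> \forall k \near \oo, Ak k x = A x) ->
  (forall y, 0 < y < pi -> \forall k \near \oo, Bk k y = B y) ->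
  L2dist (leb2 R) (Omega R) (tens (Ak n) (Bk n)) (tens A B) @[n --> \oo] --> 0%E.
Proof.
move=> cAk cBk cA cB h1 h2 n1 n2.
apply: (@bounded_cvg_L2 _ T2 R (leb2 R) (Omega R) measurable_Omega leb2_Omega_lty _ _ (M1 * M2)).
- by move=> n; exact: (tens_bound (cAk n) (cBk n) (h1 n) (h2 n)).
- by apply: measurable_funTS; apply: continuous_measurable_plane; exact: continuous_tens.
move=> z [/n1 a1 /n2 a2]; apply: cvg_near_cst; apply: filterS2 a1 a2 => k e1 e2.
by rewrite /tens e1 e2.
Qed.

Lemma bddO_L2on f (M : R) : bddO f M -> L2on (leb2 R) (Omega R) f.
Proof. exact: (bounded_L2on measurable_Omega leb2_Omega_lty). Qed.

Lemma L2on_tens A B : continuous A -> continuous B -> L2on (leb2 R) (Omega R) (tens A B).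
Proof. by move=> cA cB; have [M _ h] := bddO_tens cA cB; exact: bddO_L2on h. Qed.

(** Makes Phi(x) sin(n y) an admissible test element although its support reaches the boundary. *)
Lemma grushinV_tens A B : smooth A -> smooth B -> A (-1) = 0 -> A 1 = 0 -> B 0 = 0 -> B pi = 0 ->
  exists v : grushinV R, [/\ Vfun v = tens A B, Vdx v = tens (derive1 A) B &
    Vxdy v = tens (fun x => x * A x) (derive1 B)].
Proof.
move=> sA sB Al Ar Bl Br.
have lt11 : (-1 : R) < 1 by lra.
have [Ak [M1 [sAk supA bA nA]]] := smooth_compact_approx lt11 sA Al Ar.
have [Bk [M2 [sBk supB bB nB]]] := smooth_compact_approx (pi_gt0 R) sB Bl Br.
have sxA A' : smooth A' -> smooth (fun x : R => x * A' x) by move=> h; exact: smoothM smooth_id h.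
have c := @smooth_continuous R.
have happ : exists phi : nat -> R * R -> R,
    [/\ forall n, test_Omega (phi n),
        L2dist (leb2 R) (Omega R) (phi n) (tens A B) @[n --> \oo] --> 0%E,
        L2dist (leb2 R) (Omega R) (dX (phi n)) (tens (derive1 A) B) @[n --> \oo] --> 0%E &
        L2dist (leb2 R) (Omega R) (fun z => z.1 * dY (phi n) z) (tens (fun x => x * A x) (derive1 B))
          @[n --> \oo] --> 0%E].
  exists (fun k => tens (Ak k) (Bk k)); split.
  - move=> k; have [e e0 he] := supA k; have [e' e'0 he'] := supB k.
    apply: (@test_Omega_tens _ _ _ (Num.min e e')) => //.
    + by rewrite lt_min e0.
    + move=> x /he; have : Num.min e e' <= e by rewrite ge_min lexx.
      lra.
    + move=> x /he'; have : Num.min e e' <= e' by rewrite ge_min lexx orbT.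
      lra.
  - apply: (@tens_cvg _ _ _ _ M1 M2); try by [move=> *; exact: c|exact: c].
    + by move=> k x hx; have [] := bA k x hx.
    + by move=> k x hx; have [] := bB k x hx.
    + by move=> x /nA; apply: filterS => k [].
    + by move=> x /nB; apply: filterS => k [].
  - have -> : (fun n => L2dist (leb2 R) (Omega R) (dX (tens (Ak n) (Bk n))) (tens (derive1 A) B)) =
       (fun n => L2dist (leb2 R) (Omega R) (tens (derive1 (Ak n)) (Bk n)) (tens (derive1 A) B)).
      by apply/funext => n; rewrite dX_tens.
    apply: (@tens_cvg _ _ _ _ M1 M2); try by [move=> *; exact: c|exact: c|
      move=> *; apply: c; exact: smooth_derive1|apply: c; exact: smooth_derive1].
    + by move=> k x hx; have [] := bA k x hx.
    + by move=> k x hx; have [] := bB k x hx.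
    + by move=> x /nA; apply: filterS => k [].
    + by move=> x /nB; apply: filterS => k [].
  - have -> : (fun n => L2dist (leb2 R) (Omega R) (fun z => z.1 * dY (tens (Ak n) (Bk n)) z)
         (tens (fun x => x * A x) (derive1 B))) =
       (fun n => L2dist (leb2 R) (Omega R) (tens (fun x => x * Ak n x) (derive1 (Bk n)))
         (tens (fun x => x * A x) (derive1 B))).
      apply/funext => n; rewrite dY_tens//; congr L2dist; apply/funext => z.
      by rewrite /tens mulrA.
    apply: (@tens_cvg _ _ _ _ M1 M2).
    + by move=> k; apply: c; exact: sxA.
    + by move=> k; apply: c; exact: smooth_derive1.
    + by apply: c; exact: sxA.
    + by apply: c; exact: smooth_derive1.
    + move=> k x hx; rewrite normrM; have [+ _] := bA k x hx; apply: le_trans.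
      by rewrite ler_piMl// ler_norml.
    + by move=> k x hx; have [] := bB k x hx.
    + by move=> x /nA; apply: filterS => k [->].
    + by move=> x /nB; apply: filterS => k [].
have LV : L2on (leb2 R) (Omega R) (tens A B) by apply: L2on_tens; exact: c.
have LX : L2on (leb2 R) (Omega R) (tens (derive1 A) B).
  by apply: L2on_tens; apply: c => //; exact: smooth_derive1.
have LY : L2on (leb2 R) (Omega R) (tens (fun x => x * A x) (derive1 B)).
  by apply: L2on_tens; apply: c; [exact: sxA|exact: smooth_derive1].
by exists (GrushinV LV LX LY happ).
Qed.

End GrushinElement.

(** * Integration by parts in the form domain *)

Section IntegrationByParts.
Context {R : realType}.
Local Notation T2 := (measurableTypeR R * measurableTypeR R)%type.
Notation mu := (@lebesgue_measure R).
Implicit Types (A B h g : R -> R) (phi f : R * R -> R).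

Lemma FTC_itv h g (l r : R) : l < r -> (forall x : R, is_derive x 1 h (g x)) -> continuous g ->
  (\int[mu]_(x in `[l, r]) (g x)%:E = (h r - h l)%:E)%E.
Proof.
move=> lr dh cg.
have ch : continuous h by move=> x; exact: is_derive1_continuous (dh x).
rewrite (@continuous_FTC2 _ g h l r lr) ?EFinB//.
- by apply: continuous_subspaceT => x; exact: cg.
- split.
  + by move=> x _; exact: is_derive_derivable (dh x).
  + by apply: cvg_at_right_filter; exact: ch.
  + by apply: cvg_at_left_filter; exact: ch.
- by move=> x _; exact: is_derive1E (dh x).
Qed.

Lemma line_integral0 h g (l r : R) : l < r -> (forall x : R, is_derive x 1 h (g x)) ->
  continuous g -> h l = 0 -> h r = 0 -> (forall x, ~~ (l < x < r) -> g x = 0) ->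
  (\int[mu]_x (g x)%:E = 0)%E.
Proof.
move=> lr dh cg hl hr g0.
have e := FTC_itv lr dh cg; rewrite hl hr subr0 in e; rewrite -[RHS]e.
rewrite [RHS]integral_mkcond; apply: eq_integral => x _; rewrite /patch.
case: ifPn => // xn; rewrite g0//; apply: contra xn => /andP[h1 h2].
by rewrite inE/= in_itv/= !ltW.
Qed.

Lemma test_Omega_out phi : test_Omega phi -> forall z, ~ Omega R z -> \forall w \near z, phi w = 0.
Proof.
move=> [_ [_ sub]] z nz.
have oC : open (~` closure [set x | phi x != 0]) by apply: closed_openC; exact: closed_closure.
have : nbhs z (~` closure [set x | phi x != 0]) by apply: open_nbhs_nbhs; split => // /sub.
apply: filterS => w nw; apply: contrapT => hw; apply: nw; apply: subset_closure.
by apply/eqP.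
Qed.

Lemma test_Omega_C phi : test_Omega phi ->
  [/\ continuous phi, continuous (dX phi), continuous (dY phi),
   forall z : R * R, is_derive z.1 1 (fun x => phi (x, z.2)) (dX phi z) &
   forall z : R * R, is_derive z.2 1 (fun y => phi (z.1, y)) (dY phi z)].
Proof.
move=> [/(_ 1%N) /= [cp [dx dy [cx _] [cy _]]] _]; split => // z.
  by rewrite dXE; apply: derivable_is_derive1; rewrite -derivable_sliceX.
by rewrite dYE; apply: derivable_is_derive1; rewrite -derivable_sliceY.
Qed.

Lemma test_Omega_out0 phi : test_Omega phi -> forall z, ~ Omega R z ->
  [/\ phi z = 0, dX phi z = 0 & dY phi z = 0].
Proof.
move=> tp z nz; have h := test_Omega_out tp nz; split; first exact: nbhs_singleton h.
  rewrite /dX (near_eq_derive _ (g := cst 0)) ?derive_cst//.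
by rewrite /dY (near_eq_derive _ (g := cst 0)) ?derive_cst.
Qed.

Lemma continuous_Omega_bdd f : continuous f -> (forall z, ~ Omega R z -> f z = 0) ->
  exists2 M, 0 <= M & bddO f M.
Proof.
move=> cf f0.
pose K := `[(-1 : R), 1]%classic `*` `[(0 : R), pi]%classic.
have cK : compact K by apply: compact_setX; exact: segment_compact.
have K0 : K !=set0 by exists (0, 0); split; rewrite /= in_itv/= ?lexx ?pi_ge0 ?lerN10 ?ler01.
have cN : {within K, continuous (fun z => `|f z|)}.
  by apply: continuous_subspaceT => z; apply: cvg_norm; exact: cf.
have [c _ hc] := compact_EVT_max K0 cK cN.
exists `|f c| => //; split.
  by apply: measurable_funTS; exact: continuous_measurable_plane.
move=> z [/andP[a1 a2] /andP[b1 b2]]; apply: hc.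
by rewrite inE; split; rewrite /= in_itv/= !ltW.
Qed.

Lemma integrable_Omega f : continuous f -> (forall z, ~ Omega R z -> f z = 0) ->
  (leb2 R).-integrable setT (EFin \o f : T2 -> \bar R).
Proof.
move=> cf f0; have [M _ bM] := continuous_Omega_bdd cf f0.
have := bounded_integrable measurable_Omega leb2_Omega_lty bM.
rewrite integrable_mkcond//; last exact: measurable_Omega.
apply: eq_integrable => // z _; rewrite /patch; case: ifPn => // /negP nz /=.
by rewrite f0// => h; apply: nz; rewrite inE.
Qed.

(** Fubini in either order: horizontal slices serve the derivative in x, vertical slices the one in
    y. The extension by 0 outside the domain is continuous, so whole lines can be used. *)
Lemma Rintegral_Omega_slice f : continuous f -> (forall z, ~ Omega R z -> f z = 0) ->
  (forall x, (\int[mu]_y (f (x, y))%:E = 0)%E) \/ (forall y, (\int[mu]_x (f (x, y))%:E = 0)%E) ->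
  \int[leb2 R]_(z in Omega R) f z = 0.
Proof.
move=> cf f0 hsl; have ii := integrable_Omega cf f0.
have -> : \int[leb2 R]_(z in Omega R) f z = \int[leb2 R]_z f z.
  rewrite Rintegral_mkcond; apply: eq_Rintegral => z _; rewrite /patch; case: ifPn => // /negP nz.
  by rewrite f0// => h; apply: nz; rewrite inE.
rewrite /Rintegral; case: hsl => hsl.
  have := @integral12_prod_meas1 _ _ _ _ R mu mu (EFin \o f) ii.
  rewrite /leb2 => <-; rewrite integral0_eq// => x _; exact: hsl.
have := @integral21_prod_meas1 _ _ _ _ R mu mu (EFin \o f) ii.
rewrite /leb2 => <-; rewrite integral0_eq// => x _; exact: hsl.
Qed.

Lemma continuous_sliceX f (y : R) : continuous f -> continuous (fun x => f (x, y)).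
Proof.
move=> cf x; apply: (continuous_comp (f := fun x => (x, y)) (g := f)); last exact: cf.
move=> W [[P Q] /= [nP nQ] PQ]; apply: filterS nP => t Pt; apply: PQ; split => //.
exact: nbhs_singleton nQ.
Qed.

Lemma continuous_sliceY f (x : R) : continuous f -> continuous (fun y => f (x, y)).
Proof.
move=> cf y; apply: (continuous_comp (f := fun y => (x, y)) (g := f)); last exact: cf.
move=> W [[P Q] /= [nP nQ] PQ]; apply: filterS nQ => t Qt; apply: PQ; split => //.
exact: nbhs_singleton nP.
Qed.

Lemma ibpX phi A B : test_Omega phi -> smooth A -> smooth B ->
  \int[leb2 R]_(z in Omega R) (dX phi z * tens A B z + phi z * tens (derive1 A) B z) = 0.
Proof.
move=> tp sA sB; have [cp cx cy dx dy] := test_Omega_C tp.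
have out := test_Omega_out0 tp.
have cA := smooth_continuous sA; have cB := smooth_continuous sB.
have cA' := smooth_continuous (smooth_derive1 sA).
have cG : continuous (fun z => dX phi z * tens A B z + phi z * tens (derive1 A) B z).
  by move=> z; apply: cvgD; apply: cvgM; [exact: cx|exact: continuous_tens|exact: cp|exact: continuous_tens].
have oG z : ~ Omega R z -> dX phi z * tens A B z + phi z * tens (derive1 A) B z = 0.
  by move=> /out[-> -> _]; rewrite !mul0r addr0.
apply: Rintegral_Omega_slice => //; right => y.
apply: (@line_integral0 (fun x => phi (x, y) * A x * B y)
  (fun x => dX phi (x, y) * tens A B (x, y) + phi (x, y) * tens (derive1 A) B (x, y)) (-1) 1).
- lra.
- move=> x; have h := is_derive1M (is_derive1M (dx (x, y)) (smooth_is_derive x sA)) (is_derive1_cst (B y) x).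
  by apply: is_derive_eq h _; rewrite /tens /=; ring.
- exact: (@continuous_sliceX _ y cG).
- by have [|-> _ _] := out (-1, y); [case => /=; lra|rewrite !mul0r].
- by have [|-> _ _] := out (1, y); [case => /=; lra|rewrite !mul0r].
- by move=> x hx; apply: (oG (x, y)); case => /= h; rewrite h in hx.
Qed.

Lemma ibpY phi A B : test_Omega phi -> smooth A -> smooth B ->
  \int[leb2 R]_(z in Omega R) (dY phi z * tens A B z + phi z * tens A (derive1 B) z) = 0.
Proof.
move=> tp sA sB; have [cp cx cy dx dy] := test_Omega_C tp.
have out := test_Omega_out0 tp.
have cA := smooth_continuous sA; have cB := smooth_continuous sB.
have cB' := smooth_continuous (smooth_derive1 sB).
have cG : continuous (fun z => dY phi z * tens A B z + phi z * tens A (derive1 B) z).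
  by move=> z; apply: cvgD; apply: cvgM; [exact: cy|exact: continuous_tens|exact: cp|exact: continuous_tens].
have oG z : ~ Omega R z -> dY phi z * tens A B z + phi z * tens A (derive1 B) z = 0.
  by move=> /out[-> _ ->]; rewrite !mul0r addr0.
apply: Rintegral_Omega_slice => //; left => x.
apply: (@line_integral0 (fun y => phi (x, y) * B y * A x)
  (fun y => dY phi (x, y) * tens A B (x, y) + phi (x, y) * tens A (derive1 B) (x, y)) 0 pi).
- exact: pi_gt0.
- move=> y; have h := is_derive1M (is_derive1M (dy (x, y)) (smooth_is_derive y sB)) (is_derive1_cst (A x) y).
  by apply: is_derive_eq h _; rewrite /tens /=; ring.
- exact: (@continuous_sliceY _ x cG).
- by have [|-> _ _] := out (x, 0); [case => _ /=; rewrite ltxx|rewrite !mul0r].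
- by have [|-> _ _] := out (x, pi); [case => _ /=; rewrite ltxx andbF|rewrite !mul0r].
- by move=> y hy; apply: (oG (x, y)); case => /= _ h; rewrite h in hy.
Qed.

Lemma L2dot_tensD f A B A' B' : L2on (leb2 R) (Omega R) f -> continuous A -> continuous B ->
  continuous A' -> continuous B' ->
  L2dot f (fun z => tens A B z + tens A' B' z) = L2dot f (tens A B) + L2dot f (tens A' B').
Proof.
move=> Lf cA cB cA' cB'.
have [M1 _ h1] := bddO_tens cA cB; have [M2 _ h2] := bddO_tens cA' cB'.
have If := L2on_integrable measurable_Omega leb2_Omega_lty Lf.
rewrite /L2dot -RintegralD//.
- by apply: eq_Rintegral => z _; rewrite mulrDr.
- exact: measurable_Omega.
- exact: (integrable_bddM measurable_Omega If h1).
- exact: (integrable_bddM measurable_Omega If h2).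
Qed.

(** For compactly supported approximations of [v] this is integration by parts. Each pairing is with
    a fixed bounded product function, hence continuous for the L^2 convergence that defines the form
    domain, and the identity survives the limit. *)
Lemma Vdot_tens (v w : grushinV R) A B : smooth A -> smooth B ->
  Vdx w = tens (derive1 A) B -> Vxdy w = tens (fun x => x * A x) (derive1 B) ->
  Vdot v w = L2dot (Vfun v) (fun z => tens (fun x => - derive1 (derive1 A) x) B z +
     tens (fun x => - (x ^+ 2 * A x)) (derive1 (derive1 B)) z).
Proof.
move=> sA sB ew1 ew2.
have [phi [tphi c0 c1 c2]] := V_approx v.
have sA' := smooth_derive1 sA; have sB' := smooth_derive1 sB.
have sA'' := smooth_derive1 sA'; have sB'' := smooth_derive1 sB'.
have sxA : smooth (fun x => x * A x) := smoothM smooth_id sA.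
have sxxA : smooth (fun x => x ^+ 2 * A x) := smoothM (smoothM smooth_id smooth_id) sA.
have c := @smooth_continuous R.
have mO := @measurable_Omega R; have fO := @leb2_Omega_lty R.
have Ltest n : [/\ L2on (leb2 R) (Omega R) (phi n), L2on (leb2 R) (Omega R) (dX (phi n)) &
     L2on (leb2 R) (Omega R) (fun z => z.1 * dY (phi n) z)].
  have [cp cx cy _ _] := test_Omega_C (tphi n); have out := test_Omega_out0 (tphi n).
  split.
  - have [|M _ h] := continuous_Omega_bdd cp; first by move=> z /out[].
    exact: bddO_L2on h.
  - have [|M _ h] := continuous_Omega_bdd cx; first by move=> z /out[].
    exact: bddO_L2on h.
  - have [||M _ h] := @continuous_Omega_bdd (fun z => z.1 * dY (phi n) z).
    + by move=> z; apply: cvgM; [exact: cvg_fst|exact: cy].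
    + by move=> z /out[_ _ ->]; rewrite mulr0.
    exact: bddO_L2on h.
have lim_ (F : nat -> R * R -> R) f P Q : (forall n, L2on (leb2 R) (Omega R) (F n)) ->
    L2on (leb2 R) (Omega R) f -> continuous P -> continuous Q ->
    L2dist (leb2 R) (Omega R) (F n) f @[n --> \oo] --> 0%E ->
    L2dot (F n) (tens P Q) @[n --> \oo] --> L2dot f (tens P Q).
  move=> LF Lf cP cQ cv; have [M _ hM] := bddO_tens cP cQ.
  by apply: (cvg_RintegralM mO fO _ Lf hM _ cv); exact: nearW.
have key1 n : L2dot (dX (phi n)) (tens (derive1 A) B) =
    L2dot (phi n) (tens (fun x => - derive1 (derive1 A) x) B).
  have := ibpX (tphi n) sA' sB; have [Lp Lx _] := Ltest n.
  have [M1 _ h1] := bddO_tens (c _ sA') (c _ sB).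
  have [M2 _ h2] := bddO_tens (c _ sA'') (c _ sB).
  have i1 := integrable_bddM mO (L2on_integrable mO fO Lx) h1.
  have i2 := integrable_bddM mO (L2on_integrable mO fO Lp) h2.
  rewrite (RintegralD mO i1 i2) => /eqP; rewrite addr_eq0 => /eqP e.
  rewrite /L2dot e -mulN1r -RintegralZl//; apply: eq_Rintegral => z _; rewrite /tens; ring.
have key2 n : L2dot (fun z => z.1 * dY (phi n) z) (tens (fun x => x * A x) (derive1 B)) =
    L2dot (phi n) (tens (fun x => - (x ^+ 2 * A x)) (derive1 (derive1 B))).
  have := ibpY (tphi n) sxxA sB'; have [Lp _ Ly] := Ltest n.
  have [M1 _ h1] := bddO_tens (c _ sxA) (c _ sB').
  have [M2 _ h2] := bddO_tens (c _ sxxA) (c _ sB'').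
  have i1' := integrable_bddM mO (L2on_integrable mO fO Ly) h1.
  have eqf : (fun z => z.1 * dY (phi n) z * tens (fun x => x * A x) (derive1 B) z) =
     (fun z => dY (phi n) z * tens (fun x => x ^+ 2 * A x) (derive1 B) z).
    by apply/funext => z; rewrite /tens; ring.
  have i1 := i1'; rewrite eqf in i1.
  have i2 := integrable_bddM mO (L2on_integrable mO fO Lp) h2.
  rewrite (RintegralD mO i1 i2) => /eqP; rewrite addr_eq0 => /eqP e.
  rewrite /L2dot eqf e -mulN1r -RintegralZl//; apply: eq_Rintegral => z _; rewrite /tens; ring.
rewrite /Vdot ew1 ew2 L2dot_tensD; [|exact: Vfun_L2|exact: c (smoothN sA'')|exact: c|exact: c (smoothN sxxA)|exact: c].
have l1 := lim_ _ _ _ _ (fun n => let: And3 _ h _ := Ltest n in h) (Vdx_L2 v) (c _ sA') (c _ sB) c1.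
have l2 := lim_ _ _ _ _ (fun n => let: And3 _ _ h := Ltest n in h) (Vxdy_L2 v) (c _ sxA) (c _ sB') c2.
have l3 := lim_ _ _ _ _ (fun n => let: And3 h _ _ := Ltest n in h) (Vfun_L2 v) (c _ (smoothN sA'')) (c _ sB) c0.
have l4 := lim_ _ _ _ _ (fun n => let: And3 h _ _ := Ltest n in h) (Vfun_L2 v) (c _ (smoothN sxxA)) (c _ sB'') c0.
have k1 := funext key1; have k2 := funext key2.
rewrite k1 in l1; rewrite k2 in l2.
have e1 := cvg_unique (@Rhausdorff R) l1 l3; have e2 := cvg_unique (@Rhausdorff R) l2 l4.
have pf (u : nat -> R) : ProperFilter (u n @[n --> \oo]) by exact: fmap_proper_filter.
exact: (f_equal2 +%R (e1 (pf _)) (e2 (pf _))).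
Qed.

End IntegrationByParts.

(** * Moments of the solution *)

Section CutoffLimits.
Context {R : realType}.
Notation mu := (@lebesgue_measure R).
Implicit Types (h w g : R -> R).

Lemma within_integrable h (a b : R) : {within `[a, b], continuous h} ->
  mu.-integrable `[a, b] (EFin \o h).
Proof. by move=> ch; apply: continuous_compact_integrable => //; exact: segment_compact. Qed.

Lemma withinM h w (a b : R) : {within `[a, b], continuous h} -> {within `[a, b], continuous w} ->
  {within `[a, b], continuous (fun x => h x * w x)}.
Proof. by move=> ch cw x; apply: cvgM; [exact: ch|exact: cw]. Qed.

Lemma mean_Rintegral w h (a b L e : R) : a <= b -> 0 <= e ->
  {within `[a, b], continuous w} -> {within `[a, b], continuous h} ->
  \int[mu]_(x in `[a, b]) w x = 1 -> (forall x, a <= x <= b -> 0 <= w x) ->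
  (forall x, a <= x <= b -> w x != 0 -> `|h x - L| <= e) ->
  `|\int[mu]_(x in `[a, b]) (w x * h x) - L| <= e.
Proof.
move=> ab e0 cw ch w1 w0 hL.
have iw := within_integrable cw.
have mi : measurable (`[a, b]%classic : set (measurableTypeR R)) by [].
have iwh := within_integrable (withinM cw ch).
have iLw : mu.-integrable `[a, b] (EFin \o (fun x => w x * L)).
  by apply: within_integrable; apply: withinM cw _; exact: cst_continuous.
have -> : \int[mu]_(x in `[a, b]) (w x * h x) - L = \int[mu]_(x in `[a, b]) (w x * h x - w x * L).
  by rewrite (RintegralB _ iwh iLw)// RintegralZr// w1 mul1r.
have id : mu.-integrable `[a, b] (EFin \o (fun x => w x * h x - w x * L)).
  by have := integrableB mi iwh iLw; apply: eq_integrable.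
apply: le_trans (le_normr_Rintegral _ id) _ => //.
have iew : mu.-integrable `[a, b] (EFin \o (fun x => e * w x)).
  by have := integrableZl mi e iw; apply: eq_integrable.
have -> : e = \int[mu]_(x in `[a, b]) (e * w x) by rewrite (RintegralZl _ _ iw)// w1 mulr1.
apply: le_Rintegral => //; first exact: integrable_norm id.
move=> x /=; rewrite in_itv /= => hx; rewrite -mulrBr normrM (ger0_norm (w0 x hx)) mulrC.
have [->|wn] := eqVneq (w x) 0; first by rewrite !mulr0.
by rewrite ler_wpM2r ?w0// hL.
Qed.

Lemma Rintegral_FTC h g (a b : R) : a < b -> (forall x : R, is_derive x 1 h (g x)) -> continuous g ->
  \int[mu]_(x in `[a, b]) g x = h b - h a.
Proof. by move=> ab dh cg; rewrite /Rintegral (FTC_itv ab dh cg). Qed.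

Lemma within_sub h (a b a' b' : R) : a <= a' -> b' <= b ->
  {within `[a, b], continuous h} -> {within `[a', b'], continuous h}.
Proof.
move=> aa bb; apply: continuous_subspaceW => x /=; rewrite !in_itv /= => /andP[h1 h2].
by rewrite (le_trans aa h1) (le_trans h2 bb).
Qed.

(** On each half of the interval the derivative of the cutoff has constant sign and total mass 1 in
    absolute value, and it concentrates at the endpoint. This is how endpoint values are read off a
    formulation that only knows test functions compactly supported in time. *)
Lemma cutoff_deriv_limit (l r : R) (c : nat -> R -> R) h : l < r ->
  (forall k, smooth (c k)) ->
  (forall k, exists2 e, 0 < e & forall x, c k x != 0 -> l + e <= x <= r - e) ->
  (forall k, [/\ c k ((l + r) / 2) = 1,
         forall x, x <= (l + r) / 2 -> 0 <= derive1 (c k) x &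
         forall x, (l + r) / 2 <= x -> derive1 (c k) x <= 0]) ->
  (forall d, 0 < d -> \forall k \near \oo, forall x, l + d <= x <= r - d ->
         c k x = 1 /\ derive1 (c k) x = 0) ->
  {within `[l, r], continuous h} ->
  \int[mu]_(x in `]l, r[) (derive1 (c k) x * h x) @[k --> \oo] --> h l - h r.
Proof.
move=> lr sc csupp cmid cnear ch.
pose m := (l + r) / 2.
have lm : l < m by rewrite /m; lra.
have mr : m < r by rewrite /m; lra.
have sc' k := smooth_derive1 (sc k).
have cc' k (a b : R) : {within `[a, b], continuous (derive1 (c k))}.
  by apply: continuous_subspaceT => x; exact: smooth_continuous.
have ckl k : c k l = 0.
  have [e e0 he] := csupp k; apply/eqP; apply: contraT => /he; lra.
have ckr k : c k r = 0.
  have [e e0 he] := csupp k; apply/eqP; apply: contraT => /he; lra.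
have ckm k : c k m = 1 by have [] := cmid k.
have split_ k : \int[mu]_(x in `]l, r[) (derive1 (c k) x * h x) =
   \int[mu]_(x in `[l, m]) (derive1 (c k) x * h x) - \int[mu]_(x in `[m, r]) (- derive1 (c k) x * h x).
  have ik : mu.-integrable `[l, r] (EFin \o (fun x => derive1 (c k) x * h x)).
    exact: within_integrable (withinM (cc' k l r) ch).
  have s1 : `]l, r[ `<=` (`[l, r] : set R) by exact: subset_itv_oo_cc.
  have s2 : `]l, r] `<=` (`[l, r] : set R) by exact: subset_itv_oc_cc.
  have s3 : `[m, r] `<=` (`[l, r] : set R) by apply: subset_itvr; rewrite bnd_simp ltW.
  have s4 : `]m, r] `<=` (`[l, r] : set R) by apply: subset_itvr; rewrite bnd_simp ltW.
  rewrite Rintegral_itv_bndo_bndc; last exact: integrableS ik.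
  rewrite Rintegral_itv_obnd_cbnd; last exact: integrableS ik.
  have := @Rintegral_itvB R (fun x => derive1 (c k) x * h x) (BLeft l) (BRight r) m ik.
  rewrite !bnd_simp => /(_ (ltW lm) (ltW mr)).
  rewrite Rintegral_itv_obnd_cbnd; last exact: integrableS ik.
  move=> e.
  have -> : \int[mu]_(x in `[m, r]) (- derive1 (c k) x * h x) =
       - \int[mu]_(x in `[m, r]) (derive1 (c k) x * h x).
    rewrite -mulN1r -RintegralZl//; last exact: integrableS ik.
    by apply: eq_Rintegral => x _; rewrite mulN1r mulNr.
  by rewrite opprK -e addrC subrK.
have wl k : \int[mu]_(x in `[l, m]) derive1 (c k) x = 1.
  rewrite (Rintegral_FTC lm (fun x => smooth_is_derive x (sc k)) (smooth_continuous (sc' k))).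
  by rewrite ckl ckm subr0.
have wr k : \int[mu]_(x in `[m, r]) (- derive1 (c k) x) = 1.
  have dN (x : R) : is_derive x 1 (fun x => - c k x) (- derive1 (c k) x).
    by apply: is_derive1N; exact: smooth_is_derive.
  rewrite (Rintegral_FTC mr dN (smooth_continuous (smoothN (sc' k)))).
  by rewrite ckr ckm opprK oppr0 add0r.
rewrite (funext split_); apply: cvgB.
  apply/cvgrPdist_le => e e0.
  have : h x @[x --> within `[l, r] (nbhs l)] --> h l.
    by move/subspace_continuousP : ch; apply; rewrite /= in_itv/= lexx ltW.
  move=> /cvgrPdist_le/(_ _ e0); rewrite near_withinE => /nbhs_ballP[d /= d0 hd].
  have d1 : 0 < Num.min (d / 2) (m - l) by rewrite lt_min divr_gt0// subr_gt0.
  have := cnear _ d1; apply: filterS => k hk; rewrite distrC.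
  apply: mean_Rintegral => //; [exact: ltW|exact: ltW|exact: within_sub (ltW mr) ch| |].
    by move=> x /andP[_ xm]; have [_ h1 _] := cmid k; exact: h1.
  move=> x /andP[lx xm] wx; rewrite distrC; apply: hd; last by rewrite /= in_itv/= lx (le_trans xm (ltW mr)).
  rewrite /ball /= distrC ger0_norm ?subr_ge0// ltNge; apply/negP => dx.
  move/eqP : wx; apply; have [|//] := hk x.
  have g1 : Num.min (d / 2) (m - l) <= d / 2 by rewrite ge_min lexx.
  have g2 : Num.min (d / 2) (m - l) <= m - l by rewrite ge_min lexx orbT.
  rewrite /m in g2 xm *; apply/andP; split; lra.
apply/cvgrPdist_le => e e0.
have : h x @[x --> within `[l, r] (nbhs r)] --> h r.
  by move/subspace_continuousP : ch; apply; rewrite /= in_itv/= lexx ltW.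
move=> /cvgrPdist_le/(_ _ e0); rewrite near_withinE => /nbhs_ballP[d /= d0 hd].
have d1 : 0 < Num.min (d / 2) (r - m) by rewrite lt_min divr_gt0// subr_gt0.
have := cnear _ d1; apply: filterS => k hk; rewrite distrC.
apply: mean_Rintegral => //; [exact: ltW|exact: ltW| |exact: within_sub (ltW lm) _ ch| |].
- by apply: continuous_subspaceT => x; exact: (smooth_continuous (smoothN (sc' k))).
- by move=> x /andP[xm _]; have [_ _ h1] := cmid k; rewrite oppr_ge0; exact: h1.
move=> x /andP[xm xr] wx; rewrite distrC; apply: hd; last by rewrite /= in_itv/= xr (le_trans (ltW lm) xm).
rewrite /ball /= ger0_norm ?subr_ge0// ltNge; apply/negP => dx.
move/eqP : wx; apply; have [|_ ->] := hk x; last by rewrite oppr0.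
have g1 : Num.min (d / 2) (r - m) <= d / 2 by rewrite ge_min lexx.
have g2 : Num.min (d / 2) (r - m) <= r - m by rewrite ge_min lexx orbT.
rewrite /m in g2 xm *; apply/andP; split; lra.
Qed.

Lemma cutoff_limit (l r : R) (c : nat -> R -> R) g :
  (forall k, continuous (c k)) -> (forall k x, 0 <= c k x <= 1) ->
  (forall d, 0 < d -> \forall k \near \oo, forall x, l + d <= x <= r - d -> c k x = 1) ->
  mu.-integrable `]l, r[ (EFin \o g) ->
  \int[mu]_(x in `]l, r[) (c k x * g x) @[k --> \oo] --> \int[mu]_(x in `]l, r[) g x.
Proof.
move=> cc c01 cnear ig.
have mg : measurable_fun `]l, r[ g by apply/measurable_EFinP; exact: measurable_int ig.
have ng := integrable_norm ig.
have mi : measurable (`]l, r[%classic : set (measurableTypeR R)) by [].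
have [|||||_ _] := @dominated_convergence _ _ R mu `]l, r[%classic mi
  (fun k x => (c k x * g x)%:E) (EFin \o g) (EFin \o (fun x => `|g x|)).
- move=> k; apply/measurable_EFinP; apply: measurable_funM => //.
  by apply: measurable_funTS; exact: continuous_measurable_fun.
- exact/measurable_EFinP.
- apply/aeW => x /=; rewrite in_itv/= => /andP[lx xr].
  apply: cvg_near_cst.
  pose d := Num.min (x - l) (r - x).
  have d0 : 0 < d by rewrite lt_min !subr_gt0 lx.
  have := cnear _ d0; apply: filterS => k hk; rewrite hk ?mul1r//.
  have : d <= x - l by rewrite ge_min lexx.
  have : d <= r - x by rewrite ge_min lexx orbT.
  lra.
- exact: ng.
- apply/aeW => x k _; rewrite /= lee_fin normrM; have /andP[h1 h2] := c01 k x.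
  by rewrite ger0_norm// ler_piMl.
move=> H; apply: (fine_cvg _) => //.
rewrite /Rintegral fineK//; exact: integrable_fin_num.
Qed.

End CutoffLimits.

(** * Fubini on the space-time cylinder *)

Section TimeFubini.
Context {R : realType}.
Local Notation T1 := (measurableTypeR R).
Local Notation T2 := (measurableTypeR R * measurableTypeR R)%type.
Notation mu := (@lebesgue_measure R).
Implicit Types (T : R) (P : R * (R * R) -> R).

Definition cylinder T : set (T1 * T2) := [set p | 0 < p.1 < T /\ Omega R p.2].

Lemma cylinderE T : cylinder T = (`]0, T[%classic : set T1) `*` (Omega R : set T2).
Proof. by apply/seteqP; split=> p; rewrite /cylinder /= in_itv/=. Qed.

Lemma measurable_cylinder T : measurable (cylinder T).
Proof. by rewrite cylinderE; apply: measurableX => //; exact: measurable_Omega. Qed.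

Lemma itv_lty (a b : R) : (mu `]a, b[%classic < +oo)%E.
Proof. by rewrite lebesgue_measure_itv; case: ifP => // _; rewrite /= -EFinB ltry. Qed.

Lemma cylinder_lty T : (leb3 R (cylinder T) < +oo)%E.
Proof.
rewrite cylinderE /leb3 product_measure1E//; last exact: measurable_Omega.
apply: lte_mul_pinfty; last exact: leb2_Omega_lty; first exact: measure_ge0.
by rewrite ge0_fin_numE; [exact: itv_lty|exact: measure_ge0].
Qed.

(** Slices are integrable for almost every time only. At the other times [Rintegral] still has a
    real value by convention, which affects neither integrability in time nor the integral. *)
Lemma time_fubini T P : (leb3 R).-integrable (cylinder T) (EFin \o P : T1 * T2 -> \bar R) ->
  [/\ mu.-integrable `]0, T[ (EFin \o (fun t => \int[leb2 R]_(z in Omega R) P (t, z))),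
      \int[mu]_(t in `]0, T[) (\int[leb2 R]_(z in Omega R) P (t, z)) =
        \int[leb3 R]_(p in cylinder T) P p &
      {ae mu, forall t, 0 < t < T ->
        (leb2 R).-integrable (Omega R) (fun z : T2 => (P (t, z))%:E)}].
Proof.
move=> iP.
pose Q : T1 * T2 -> \bar R := fun p => ((P \_ (cylinder T)) p)%:E.
have iQ : (leb3 R).-integrable setT Q.
  move: iP; rewrite integrable_mkcond; last exact: measurable_cylinder.
  by apply: eq_integrable => // p _; rewrite /Q /patch; case: ifP.
have iQ' : (mu \x leb2 R)%E.-integrable setT Q by exact: iQ.
have mO := @measurable_Omega R.
have FE t : 0 < t < T -> fubini_F (leb2 R) Q t = (\int[leb2 R]_(z in Omega R) (P (t, z))%:E)%E.
  move=> ht; rewrite /fubini_F [RHS]integral_mkcond; apply: eq_integral => z _.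
  rewrite /Q /patch; have -> : ((t, z) \in cylinder T) = (z \in (Omega R : set T2)).
    by apply/idP/idP => /set_mem h'; apply/mem_set; [case: h'|split].
  by case: ifP.
have iF := integrable_fubini_F iQ'.
have iF0 : mu.-integrable `]0, T[ (fubini_F (leb2 R) Q).
  by apply: integrableS iF.
have mi : measurable (`]0, T[%classic : set (measurableTypeR R)) by [].
have aeF := integrable_ae mi iF0.
have SE t : 0 < t < T -> \int[leb2 R]_(z in Omega R) P (t, z) = fine (fubini_F (leb2 R) Q t).
  by move=> /FE ->.
have mfine : measurable_fun (`]0, T[%classic : set (measurableTypeR R)) (fun t => fine (fubini_F (leb2 R) Q t)).
  by apply: (measurableT_comp (f := fine)) => //; exact: measurable_int iF0.
have iS : mu.-integrable `]0, T[ (EFin \o (fun t => fine (fubini_F (leb2 R) Q t))).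
  apply: le_integrable iF0 => //; first exact/measurable_EFinP.
  by move=> t _ /=; case: (fubini_F _ _ _) => [r| |] //=; rewrite ?lexx ?normr0 ?leey.
split.
- by move: iS; apply: eq_integrable => // t /set_mem /=; rewrite in_itv/= => ht; rewrite SE.
- have -> : \int[mu]_(t in `]0, T[) (\int[leb2 R]_(z in Omega R) P (t, z)) =
      \int[mu]_(t in `]0, T[) (fine (fubini_F (leb2 R) Q t)).
    by apply: eq_Rintegral => t /set_mem /=; rewrite in_itv/= => ht; rewrite SE.
  rewrite /Rintegral; congr fine.
  have -> : (\int[mu]_(t in `]0%R, T[) (fine (fubini_F (leb2 R) Q t))%:E =
      \int[mu]_(t in `]0%R, T[) fubini_F (leb2 R) Q t)%E.
    apply: ae_eq_integral_nomeas; apply: filterS aeF => t h tT.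
    by rewrite fineK//; exact: h.
  have -> : (\int[leb3 R]_(p in cylinder T) (P p)%:E = \int[leb3 R]_p Q p)%E.
    by rewrite integral_mkcond; apply: eq_integral => p _; rewrite /Q /patch; case: ifP.
  have := integral12_prod_meas1 iQ'; rewrite -[X in _ = X]/(\int[leb3 R]_p Q p)%E => <-.
  rewrite integral_mkcond; apply: eq_integral => t _; rewrite /patch; case: ifPn => // ht.
  rewrite /fubini_F integral0_eq// => z _; rewrite /Q /patch ifF//.
  apply/negP; rewrite inE => -[/= h _]; move/negP : ht; apply.
  by rewrite inE /= in_itv.
have := ae_integrable1 iQ'; apply: filterS => t h tT.
have := h; move=> {}h.
rewrite integrable_mkcond//; move: h; apply: eq_integrable => // z _.
rewrite /Q /patch; have -> : ((t, z) \in cylinder T) = (z \in (Omega R : set T2)).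
  by apply/idP/idP => /set_mem h'; apply/mem_set; [case: h'|split].
by case: ifP.
Qed.

End TimeFubini.

(** * The moment identity *)

Section MomentIdentity.
Context {R : realType}.
Local Notation T1 := (measurableTypeR R).
Local Notation T2 := (measurableTypeR R * measurableTypeR R)%type.
Notation mu := (@lebesgue_measure R).
Implicit Types (T : R) (A B : R -> R) (omega : set (R * R)).

Lemma cylinder_bounded T omega A B (E : R -> R) : measurable (omega : set T2) ->
  continuous A -> continuous B -> continuous E ->
  exists M, bounded_on (cylinder T)
    (fun p : T1 * T2 => \1_omega p.2 * (E p.1 * tens A B p.2) : measurableTypeR R) M.
Proof.
move=> mw cA cB cE.
have [M1 M10 h1] := continuous_itv_bounded 0 T cE.
have [M2 M20 [_ h2]] := bddO_tens cA cB.
exists (M1 * M2); split.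
  apply: measurable_funTS; apply: measurable_funM.
    have mi : measurable_fun setT (\1_omega : T2 -> R) by exact: measurable_indic.
    exact: (measurableT_comp mi measurable_snd).
  apply: measurable_funM.
    exact: (measurableT_comp (continuous_measurable_fun cE) measurable_fst).
  exact: (measurableT_comp (continuous_measurable_plane (continuous_tens cA cB)) measurable_snd).
move=> [t z] [/= /andP[t0 tT] zO]; rewrite !normrM.
apply: (@le_trans _ _ (1 * (M1 * M2))); last by rewrite mul1r.
apply: ler_pM => //.
  by rewrite indicE; case: (_ \in _); rewrite ?normr1 ?normr0 ?ler01.
apply: ler_pM => //; first by apply: h1; rewrite !ltW.
by rewrite -normrM; exact: h2.
Qed.

Lemma L2dot_within T (f : R -> R * R -> R) A B : C_0T_L2 T f -> continuous A -> continuous B ->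
  {within `[0, T], continuous (fun t => L2dot (f t) (tens A B))}.
Proof.
move=> [Lf cf] cA cB; apply/subspace_continuousP => s hs.
have hs' : 0 <= s <= T by move: hs; rewrite /= in_itv.
have [M _ bM] := bddO_tens cA cB.
apply: (cvg_RintegralM measurable_Omega leb2_Omega_lty _ (Lf s hs') bM).
  apply: filterS (withinT _ _) => t; rewrite /= in_itv /=; exact: Lf.
exact: cf.
Qed.

Lemma L2dot_ae (f g : R * R -> R) (h : R * R -> R) :
  ae_eq (leb2 R) (Omega R) f g -> L2dot f h = L2dot g h.
Proof.
move=> fg; apply: ae_eq_Rintegral_nomeas; apply: filterS fg => z e zO.
by rewrite e.
Qed.

Lemma test_time_cutoff T (c E : R -> R) (e : R) : smooth c -> smooth E -> 0 < e ->
  (forall x, c x != 0 -> 0 + e <= x <= T - e) -> test_time T (fun t => E t * c t).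
Proof.
move=> sc sE e0 hc; split; first by move=> n t; apply: smooth_derive1n; exact: smoothM.
have sub : [set t | E t * c t != 0] `<=` `[e, T - e].
  move=> t /=; rewrite mulf_eq0 negb_or => /andP[_ /hc].
  by rewrite add0r in_itv.
have cl : closure [set t | E t * c t != 0] `<=` `[e, T - e].
  have cI : closed (`[e, T - e]%classic : set R) by exact: interval_closed.
  by rewrite (iffLR (closure_id _) cI); exact: closure_subset.
split.
  by apply: subclosed_compact (@segment_compact _ e (T - e)) cl; exact: closed_closure.
by move=> t /cl; rewrite /= !in_itv /= => /andP[h1 h2]; apply/andP; split; lra.
Qed.

(** On the mode sin(n y) the Grushin operator acts in x as -d^2/dx^2 + (n x)^2; this is the defect
    of [Phi] as an eigenfunction with eigenvalue [m]. *)
Definition residual (Phi : R -> R) (n : nat) (m : R) (x : R) : R :=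
  - derive1 (derive1 Phi) x + (n%:R * x) ^+ 2 * Phi x - m * Phi x.

Lemma smooth_residual Phi n m : smooth Phi -> smooth (residual Phi n m).
Proof.
move=> sP; apply: smoothD; [apply: smoothD|apply: smoothN].
- by apply: smoothN; apply: smooth_derive1; exact: smooth_derive1.
- have sn : smooth (fun x : R => n%:R * x) by apply: smoothM; [exact: smooth_cst|exact: smooth_id].
  by apply: smoothM => //; exact: (smoothM sn sn).
- by apply: smoothM => //; exact: smooth_cst.
Qed.

Definition sinn (n : nat) (y : R) : R := sin (n%:R * y).

Lemma is_derive_sinn n (y : R) : is_derive y 1 (sinn n) (n%:R * cos (n%:R * y)).
Proof.
have h := is_derive1Z n%:R (is_derive1_id y).
have := is_derive1_comp h (is_derive_sin (n%:R * y)).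
by rewrite mulr1 mulrC.
Qed.

Lemma smooth_sinn n : smooth (sinn n).
Proof.
apply: (smooth_comp (f := fun y : R => n%:R * y)); last exact: smooth_sin.
by apply: smoothM; [exact: smooth_cst|exact: smooth_id].
Qed.

Lemma derive2_sinn n (y : R) : derive1 (derive1 (sinn n)) y = - (n%:R ^+ 2 * sinn n y).
Proof.
have -> : derive1 (sinn n) = fun y => n%:R * cos (n%:R * y).
  by apply/funext => t; exact: is_derive1E (is_derive_sinn n t).
apply: is_derive1E.
have h := is_derive1Z n%:R (is_derive1_id y).
have h2 := is_derive1Z n%:R (is_derive1_comp h (is_derive_cos (n%:R * y))).
by apply: is_derive_eq h2 _; rewrite /sinn; ring.
Qed.

Lemma sinn_pi n : sinn n (pi : R) = 0.
Proof.
rewrite /sinn; elim: n => [|n IH]; first by rewrite mul0r sin0.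
by rewrite -natr1 mulrDl mul1r sinDpi IH oppr0.
Qed.

(** Let mt, rt and S be the pairings of f(t) with the test function, of f(t) with the residual, and
    of the control with the test function. Weakly, mt' + m mt + rt = S. Integrating (e^(m t) mt)'
    over (0, T), where mt vanishes at T, and multiplying by e^(-m T) gives the identity. *)
Lemma moment_identity omega T f0 u f Phi n m :
  measurable (omega : set T2) -> 0 < T -> L2on (leb3 R) (cylinder T) u ->
  weak_solution omega T f0 u f -> ae_eq (leb2 R) (Omega R) (f T) (cst 0) ->
  smooth Phi -> Phi (-1) = 0 -> Phi 1 = 0 ->
  expR (- (m * T)) * L2dot f0 (tens Phi (sinn n)) =
  \int[mu]_(t in `]0, T[) (expR (- (m * (T - t))) * L2dot (f t) (tens (residual Phi n m) (sinn n)))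
  - \int[leb3 R]_(p in cylinder T)
      (u p * (\1_omega p.2 * (expR (- (m * (T - p.1))) * tens Phi (sinn n) p.2))).
Proof.
move=> mw T0 Lu [Cf f0ae [F [_ aeF weq]]] fTae sP Pl Pr.
have sB := smooth_sinn n.
have B0 : sinn n 0 = 0 by rewrite /sinn mulr0 sin0.
have [phi [e1 e2 e3]] := grushinV_tens sP sB Pl Pr B0 (sinn_pi n).
set G := tens Phi (sinn n) in e1 *; set Q := tens (residual Phi n m) (sinn n).
have cP := smooth_continuous sP; have cB := smooth_continuous sB.
have sQ := smooth_residual n m sP; have cQ := smooth_continuous sQ.
have sP2 := smooth_derive1 (smooth_derive1 sP).
have Lft t : 0 < t < T -> L2on (leb2 R) (Omega R) (f t).
  by move=> /andP[h1 h2]; case: Cf => + _; apply; rewrite !ltW.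
pose mt t := L2dot (f t) G; pose rt t := L2dot (f t) Q.
pose S t := L2dot (fun z => \1_omega z * u (t, z)) G.
have cm : {within `[0, T], continuous mt} by exact: L2dot_within.
have cr : {within `[0, T], continuous rt} by exact: L2dot_within.
have mO := @measurable_Omega R; have fO := @leb2_Omega_lty R.
have vdot : {ae mu, forall t, 0 < t < T -> Vdot (F t) phi = m * mt t + rt t}.
  apply: (@filterS _ _ (ae_filter_ringOfSetsType mu) _ _ _ aeF) => t ht tT; have {}ht := ht tT.
  rewrite (Vdot_tens _ sP sB e2 e3) (L2dot_ae _ ht).
  have [M _ bG] := bddO_tens cP cB; have [M' _ bQ] := bddO_tens cQ cB.
  have If := L2on_integrable mO fO (Lft t tT).
  have iG := integrable_bddM mO If bG; have iQ := integrable_bddM mO If bQ.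
  have imG : (leb2 R).-integrable (Omega R : set T2) (EFin \o (fun z => m * (f t z * G z))).
    by have := integrableZl mO m iG; apply: eq_integrable.
  rewrite /mt /rt /L2dot -(RintegralZl _ mO iG) -(RintegralD mO imG iQ).
  apply: eq_Rintegral => z _; rewrite /G /Q /tens /residual derive2_sinn; ring.
have [c [K [sc c01 csupp cmid [_ cnear]]]] := smooth_cutoffs T0.
pose E t : R := expR (m * t).
have dE (t : R) : is_derive t 1 E (m * E t).
  have h := is_derive1Z m (is_derive1_id t).
  have := is_derive1_comp h (is_derive_expR (m * t)).
  by rewrite mulr1 mulrC.
have sE : smooth E.
  apply: (smooth_comp (f := fun y : R => m * y)); last exact: smooth_expR.
  by apply: smoothM; [exact: smooth_cst|exact: smooth_id].
have cE : {within `[0, T], continuous E}.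
  by apply: continuous_subspaceT => t; exact: smooth_continuous.
have cc k : {within `[0, T], continuous (c k)}.
  by apply: continuous_subspaceT => t; exact: (smooth_continuous (sc k)).
have cdc k : {within `[0, T], continuous (derive1 (c k))}.
  by apply: continuous_subspaceT => t; exact: (smooth_continuous (smooth_derive1 (sc k))).
have oi h : {within `[0, T], continuous h} -> mu.-integrable `]0, T[ (EFin \o h).
  by move=> /within_integrable; apply: integrableS => //; exact: subset_itv_oo_cc.
have mi : measurable (`]0, T[%classic : set (measurableTypeR R)) by [].
have cEr := withinM cE cr; have cEm := withinM cE cm.
have Iu : (leb3 R).-integrable (cylinder T) (EFin \o u : T1 * T2 -> \bar R).
  exact: L2on_integrable (measurable_cylinder T) (cylinder_lty T) _ Lu.
have [M1 b1] := cylinder_bounded T mw cP cB (@cst_continuous _ _ (1 : R)).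
have [iS1 _ ae1] := time_fubini (integrable_bddM (measurable_cylinder T) Iu b1).
have SE t : \int[leb2 R]_(z in Omega R) (u (t, z) * (\1_omega z * (cst 1 t * tens Phi (sinn n) z))) = S t.
  by apply: eq_Rintegral => z _; rewrite /= -/G mul1r; ring.
have iS : mu.-integrable `]0, T[ (EFin \o S).
  by move: iS1; apply: eq_integrable => // t _; rewrite /= SE.
have mE : measurable_fun (`]0, T[%classic : set (measurableTypeR R)) E.
  by apply: measurable_funTS; apply: continuous_measurable_fun; exact: smooth_continuous.
have bE : [bounded E x | x in `]0, T[%classic].
  have [M _ hM] := continuous_itv_bounded 0 T (smooth_continuous sE).
  exists M; split; first exact: num_real.
  by move=> y My t /=; rewrite in_itv/= => /andP[h1 h2]; apply: le_trans (hM t _) (ltW My); rewrite !ltW.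
have iES : mu.-integrable `]0, T[ (EFin \o (fun t => E t * S t)).
  by have := integrableMr mi mE bE iS; apply: eq_integrable.
(* The time test function is e^(m t) times a cutoff: the term m e^(m t) of its derivative cancels
   the part m mt of the form, and only the derivative of the cutoff remains. *)
have eqk k : \int[mu]_(t in `]0, T[) (c k t * (E t * rt t)) -
    \int[mu]_(t in `]0, T[) (derive1 (c k) t * (E t * mt t)) =
    \int[mu]_(t in `]0, T[) (c k t * (E t * S t)).
  have [e e0 he] := csupp k.
  have := weq phi _ (test_time_cutoff (sc k) sE e0 he); rewrite e1.
  have dth (t : R) : derive1 (fun t => E t * c k t) t = m * E t * c k t + E t * derive1 (c k) t.
    by apply: is_derive1E; apply: is_derive1M; exact: smooth_is_derive.
  have -> : \int[mu]_(t in `]0, T[) (E t * c k t * Vdot (F t) phi) =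
      \int[mu]_(t in `]0, T[) (c k t * (E t * rt t) + m * (c k t * (E t * mt t))).
    apply: ae_eq_Rintegral_nomeas; apply: (@filterS _ _ (ae_filter_ringOfSetsType mu) _ _ _ vdot) => t h.
    by rewrite /= in_itv/= => /h ->; ring.
  have -> : \int[mu]_(t in `]0, T[) (derive1 (fun t => E t * c k t) t * L2dot (f t) G) =
      \int[mu]_(t in `]0, T[) (m * (c k t * (E t * mt t)) + derive1 (c k) t * (E t * mt t)).
    by apply: eq_Rintegral => t _; rewrite dth /mt; ring.
  have i1 := oi _ (withinM (cc k) cEr).
  have i2 := oi _ (withinM (@cst_continuous _ _ m : {within `[0, T], continuous (fun=> m)}) (withinM (cc k) cEm)).
  have i3 := oi _ (withinM (cdc k) cEm).
  rewrite (RintegralD mi i1 i2) (RintegralD mi i2 i3) => e4.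
  have -> : \int[mu]_(t in `]0, T[) (c k t * (E t * S t)) =
     \int[mu]_(t in `]0, T[) (E t * c k t * L2dot (fun z => \1_omega z * u (t, z)) G).
    by apply: eq_Rintegral => t _; rewrite /S; ring.
  have ar (x1 x2 x3 : R) : x1 - x3 = - (x2 + x3) + (x1 + x2) by ring.
  by rewrite -e4; exact: ar.
have hn d : 0 < d -> \forall k \near \oo, forall x, 0 + d <= x <= T - d -> c k x = 1.
  by move=> d0; apply: filterS (cnear d d0) => k h x hx; case: (h x hx).
have hc k : continuous (c k) by exact: smooth_continuous (sc k).
have L1 := cutoff_limit hc c01 hn (oi _ cEr).
have L2 := cutoff_limit hc c01 hn iES.
have L3 := cutoff_deriv_limit T0 sc csupp cmid cnear cEm.
have L4 := cvgB L1 L3.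
have pf (v : nat -> R) : ProperFilter (v n @[n --> \oo]) by exact: fmap_proper_filter.
have key : \int[mu]_(t in `]0, T[) (E t * rt t) - (E 0 * mt 0 - E T * mt T) =
    \int[mu]_(t in `]0, T[) (E t * S t).
  apply: (cvg_unique (@Rhausdorff R) _ L2).
  by rewrite -(funext eqk); exact: L4.
have m0 : mt 0 = L2dot f0 G by exact: L2dot_ae.
have mT : mt T = 0.
  rewrite /mt (L2dot_ae _ fTae) /L2dot.
  under eq_Rintegral do rewrite /= mul0r.
  by rewrite Rintegral_cst// mul0r.
have E0 : E 0 = 1 by rewrite /E mulr0 expR0.
rewrite E0 mul1r mT mulr0 subr0 m0 in key.
have EE t : expR (- (m * (T - t))) = expR (- (m * T)) * E t.
  by rewrite -expRD; congr expR; ring.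
have -> : L2dot f0 G = \int[mu]_(t in `]0, T[) (E t * rt t) - \int[mu]_(t in `]0, T[) (E t * S t).
  by rewrite -key; ring.
have iEr := oi _ cEr.
rewrite mulrBr -(RintegralZl _ mi iEr) -(RintegralZl _ mi iES); congr (_ - _).
  by apply: eq_Rintegral => t _; rewrite EE mulrA.
pose E' t : R := expR (- (m * (T - t))).
have cE' : continuous E'.
  have h : smooth E' by have := smoothM (smooth_cst (expR (- (m * T)))) sE; rewrite /E' (funext EE).
  exact: smooth_continuous.
have [M2 b2] := cylinder_bounded T mw cP cB cE'.
have [_ <- _] := time_fubini (integrable_bddM (measurable_cylinder T) Iu b2).
apply: ae_eq_Rintegral_nomeas; apply: (@filterS _ _ (ae_filter_ringOfSetsType mu) _ _ _ ae1) => t h.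
rewrite /= in_itv/= => tT; have {}h := h tT.
rewrite mulrA -EE -SE -(RintegralZl _ mO h).
by apply: eq_Rintegral => z _; rewrite /= -/G /E' /cst; ring.
Qed.

End MomentIdentity.

(** * Integrals of products and orthogonality of sines *)

Section PlaneIntegrals.
Context {R : realType}.
Local Notation T1 := (measurableTypeR R).
Local Notation T2 := (measurableTypeR R * measurableTypeR R)%type.
Notation mu := (@lebesgue_measure R).
Implicit Types (T : R) (A B : R -> R).

Lemma tens_integrable A B (M1 M2 : R) :
  measurable_fun setT (A : T1 -> T1) -> measurable_fun setT (B : T1 -> T1) ->
  (forall x, -1 < x < 1 -> `|A x| <= M1) -> (forall y, 0 < y < pi -> `|B y| <= M2) ->
  bddO (tens A B) (M1 * M2).
Proof.
move=> mA mB hA hB; split.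
  apply: measurable_funTS; apply: measurable_funM.
    exact: (measurableT_comp mA measurable_fst).
  exact: (measurableT_comp mB measurable_snd).
by move=> z [h1 h2]; rewrite /tens normrM; apply: ler_pM => //; [exact: hA|exact: hB].
Qed.

Lemma Rintegral_tens A B (M1 M2 : R) :
  measurable_fun setT (A : T1 -> T1) -> measurable_fun setT (B : T1 -> T1) ->
  (forall x, -1 < x < 1 -> `|A x| <= M1) -> (forall y, 0 < y < pi -> `|B y| <= M2) ->
  \int[leb2 R]_(z in Omega R) tens A B z =
    (\int[mu]_(x in `]-1, 1[) A x) * (\int[mu]_(y in `]0, pi[) B y).
Proof.
move=> mA mB hA hB.
have mO := @measurable_Omega R; have fO := @leb2_Omega_lty R.
have iP := bounded_integrable mO fO (tens_integrable mA mB hA hB).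
pose Q : T2 -> \bar R := fun p => ((tens A B \_ (Omega R)) p)%:E.
have iQ : (leb2 R).-integrable setT Q.
  move: iP; rewrite integrable_mkcond//.
  by apply: eq_integrable => // p _; rewrite /Q /patch; case: ifP.
have iQ' : (mu \x mu)%E.-integrable setT Q by exact: iQ.
have mi a b : measurable (`]a, b[%classic : set (measurableTypeR R)) by [].
have iA : mu.-integrable `]-1, 1[ (EFin \o A).
  apply: (@bounded_integrable _ _ _ _ _ (mi _ _) (itv_lty _ _) _ M1); split.
    exact: measurable_funTS.
  by move=> x /=; rewrite in_itv/=; exact: hA.
have iB : mu.-integrable `]0, pi[ (EFin \o B).
  apply: (@bounded_integrable _ _ _ _ _ (mi _ _) (itv_lty _ _) _ M2); split.
    exact: measurable_funTS.
  by move=> x /=; rewrite in_itv/=; exact: hB.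
set b := \int[mu]_(y in `]0, pi[) B y.
have FE x : -1 < x < 1 -> fubini_F mu Q x = (A x * b)%:E.
  move=> hx; rewrite /fubini_F /b -(RintegralZl _ (mi _ _) iB) /Rintegral fineK; last first.
    apply: integrable_fin_num => //.
    by have := integrableZl (mi _ _) (A x) iB; apply: eq_integrable.
  rewrite [RHS]integral_mkcond; apply: eq_integral => y _.
  rewrite /Q /patch; have -> : ((x, y) \in (Omega R : set T2)) = (y \in (`]0, pi[%classic : set T1)).
    by apply/idP/idP => /set_mem h; apply/mem_set; [case: h => _ /= h|split => //]; rewrite ?in_itv// in_itv in h.
  by case: ifP.
rewrite -(RintegralZr _ (mi _ _) iA) /Rintegral; congr fine.
have -> : (\int[leb2 R]_(p in Omega R) (tens A B p)%:E = \int[leb2 R]_p Q p)%E.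
  by rewrite integral_mkcond; apply: eq_integral => p _; rewrite /Q /patch; case: ifP.
have := integral12_prod_meas1 iQ'; rewrite -[X in _ = X]/(\int[leb2 R]_p Q p)%E => <-.
rewrite [RHS]integral_mkcond; apply: eq_integral => x _; rewrite /patch; case: ifPn => hx.
  by rewrite FE//; move: hx; rewrite inE/= in_itv.
rewrite /fubini_F integral0_eq// => y _; rewrite /Q /patch ifF//.
apply/negP; rewrite inE => -[/= h _]; move/negP : hx; apply.
by rewrite inE /= in_itv.
Qed.

(** Explicit primitives are differentiated back. For n distinct from m the primitive is the
    Wronskian of the two sines divided by n^2 - m^2, which vanishes at 0 and pi. *)
Lemma sinn_orthogonal (n m : nat) : (0 < m)%N ->
  \int[mu]_(y in `]0, pi[) (sinn n y * sinn m y) = if n == m then pi / 2 else 0.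
Proof.
move=> m0.
have cs k : continuous (@sinn R k) by exact: (smooth_continuous (smooth_sinn k)).
have cc : continuous (fun y : R => sinn n y * sinn m y) by move=> y; apply: cvgM; exact: cs.
have ii : mu.-integrable `[0, pi] (EFin \o (fun y => sinn n y * sinn m y)).
  by exact: continuous_integrable_itv.
rewrite Rintegral_itv_bndo_bndc; last first.
  by apply: integrableS ii => //; exact: subset_itv_oo_cc.
rewrite Rintegral_itv_obnd_cbnd; last first.
  by apply: integrableS ii => //; exact: subset_itv_oc_cc.
have ds k (y : R) := is_derive_sinn k y.
have dc k (y : R) : is_derive y 1 (fun y => cos (k%:R * y)) (- (k%:R * sinn k y)).
  have h := is_derive1Z k%:R (is_derive1_id y).
  by apply: is_derive_eq (is_derive1_comp h (is_derive_cos (k%:R * y))) _; rewrite /sinn; ring.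
have s0 k : sinn k 0 = 0 :> R by rewrite /sinn mulr0 sin0.
case: eqP => [->|/eqP nm].
  have m0' : m%:R != 0 :> R by rewrite pnatr_eq0 -lt0n.
  have h (y : R) : is_derive y 1 (fun y => 2^-1 * y + - ((2 * m%:R)^-1 * (sinn m y * cos (m%:R * y))))
      (sinn m y * sinn m y).
    have h1 := is_derive1Z (2^-1 : R) (is_derive1_id y).
    have h2 := is_derive1Z (2 * m%:R)^-1 (is_derive1M (ds m y) (dc m y)).
    apply: is_derive_eq (is_derive1D h1 (is_derive1N h2)) _.
    have e : cos (m%:R * y) ^+ 2 = 1 - sinn m y ^+ 2 
      by apply: (addIr (sinn m y ^+ 2)); rewrite subrK; exact: cos2Dsin2.
    transitivity (2^-1 - 2^-1 * (cos (m%:R * y) ^+ 2 - sinn m y ^+ 2)); first by field.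
    by rewrite e; field.
  rewrite (Rintegral_FTC (pi_gt0 R) h); last by move=> y; apply: cvgM; exact: cs.
  by rewrite !s0 sinn_pi; field.
have nm0 : n%:R ^+ 2 - m%:R ^+ 2 != 0 :> R.
  by rewrite subr_eq0 -!natrX eqr_nat eqn_exp2r.
have h (y : R) : is_derive y 1 (fun y => (n%:R ^+ 2 - m%:R ^+ 2)^-1 *
    (m%:R * (sinn n y * cos (m%:R * y)) + - (n%:R * (sinn m y * cos (n%:R * y)))))
      (sinn n y * sinn m y).
  have h1 := is_derive1Z (m%:R : R) (is_derive1M (ds n y) (dc m y)).
  have h2 := is_derive1Z (n%:R : R) (is_derive1M (ds m y) (dc n y)).
  apply: is_derive_eq (is_derive1Z _ (is_derive1D h1 (is_derive1N h2))) _.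
  by field.
rewrite (Rintegral_FTC (pi_gt0 R) h cc).
by rewrite !s0 !sinn_pi !mul0r !mulr0 oppr0 addr0 mulr0 subrr.
Qed.

(** By compactness of [0, T] this yields one constant bounding the L^1 norms of f(t) at all times,
    against which the residual terms are estimated. *)
Lemma L1norm_within T (f : R -> R * R -> R) : C_0T_L2 T f ->
  {within `[0, T], continuous (fun t => \int[leb2 R]_(z in Omega R) `|f t z|)}.
Proof.
move=> [Lf cf]; apply/subspace_continuousP => s hs.
have hs' : 0 <= s <= T by move: hs; rewrite /= in_itv.
have mO := @measurable_Omega R; have fO := @leb2_Omega_lty R.
have [K K0 hK] := L1_le_L2dist mO fO.
apply/cvgrPdist_le => e e0.
have c0 : 0 < K + 1 by rewrite ltr_wpDl.
have : \forall t \near within `[0, T] (nbhs s), (L2dist (leb2 R) (Omega R) (f t) (f s) <= (e / (K + 1))%:E)%E.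
  have : nbhs (0%E : \bar R) [set x : \bar R | (x <= (e / (K + 1))%:E)%E].
    have : nbhs (0%E : \bar R) [set x : \bar R | (x < (e / (K + 1))%:E)%E].
      apply: open_nbhs_nbhs; split; first exact: open_ereal_lt_ereal.
      by rewrite /= lte_fin divr_gt0.
    by apply: filterS => x /=; exact: ltW.
  by move=> /(cf s hs').
have hL : \forall t \near within `[0, T] (nbhs s), L2on (leb2 R) (Omega R) (f t).
  by apply: filterS (withinT _ _) => t; rewrite /= in_itv /=; exact: Lf.
move=> hd; apply: filterS2 hL hd => t Lt hd; rewrite distrC.
have It := L2on_integrable mO fO Lt; have Is := L2on_integrable mO fO (Lf s hs').
have Itn := integrable_norm It; have Isn := integrable_norm Is.
rewrite -(RintegralB mO Itn Isn).
have Id : (leb2 R).-integrable (Omega R : set T2) (EFin \o (fun z => `|f t z| - `|f s z|)).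
  by have := integrableB mO Itn Isn; apply: eq_integrable.
have Id2 : (leb2 R).-integrable (Omega R : set T2) (EFin \o (fun z => f t z - f s z)).
  by have := integrableB mO It Is; apply: eq_integrable.
apply: le_trans (le_normr_Rintegral mO Id) _.
apply: (@le_trans _ _ (\int[leb2 R]_(z in Omega R) `|f t z - f s z|)).
  apply: le_Rintegral => //; [exact: integrable_norm Id|exact: integrable_norm Id2|].
  by move=> z _; exact: ler_dist_dist.
rewrite -lee_fin /Rintegral fineK; last first.
  by apply: integrable_fin_num => //; exact: integrable_norm Id2.
apply: le_trans (hK _ _ (L2on_measurable mO Lt) (L2on_measurable mO (Lf s hs'))) _.
apply: (@le_trans _ _ (K%:E * (e / (K + 1))%:E)%E).
  by rewrite lee_wpmul2l ?lee_fin.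
by rewrite -EFinM lee_fin mulrCA ger_pMr// ler_pdivrMr// mul1r lerDl.
Qed.

End PlaneIntegrals.

(** * Construction of the initial datum *)

Section InitialData.
Context {R : realType}.
Local Notation T1 := (measurableTypeR R).
Local Notation T2 := (measurableTypeR R * measurableTypeR R)%type.
Notation mu := (@lebesgue_measure R).
Context (b : nat -> R) (K q : R) (q0 : 0 <= q) (q1 : q < 1) (K0 : 0 <= K)
  (hb : forall n, `|b n| <= K * q ^+ n).

Let psum (N : nat) (y : R) := \sum_(0 <= n < N) b n * sinn n y.

Let tail N := K * q ^+ N / (1 - q).

Lemma sinn_le1 n (y : R) : `|sinn n y| <= 1.
Proof. by rewrite ler_norml sin_geN1 sin_le1. Qed.

(** The factor 1 - q^d records the exact finite geometric sum and makes the bound inductive in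
    [d]. *)
Let psum_tail N d y : `|psum (N + d) y - psum N y| <= tail N * (1 - q ^+ d).
Proof.
have p0 : 0 < 1 - q by rewrite subr_gt0.
elim: d => [|d IH]; first by rewrite addn0 !subrr normr0 mulr0.
rewrite addnS /psum big_nat_recr//= -/(psum (N + d) y) -/(psum N y) addrAC.
apply: le_trans (ler_normD _ _) _.
have h : `|b (N + d)%N * sinn (N + d) y| <= K * (q ^+ N * q ^+ d).
  rewrite normrM -exprD -[leRHS]mulr1; apply: ler_pM => //; exact: sinn_le1.
apply: le_trans (lerD IH h) _; rewrite le_eqVlt; apply/orP; left; apply/eqP.
rewrite /tail exprS; field; exact: lt0r_neq0.
Qed.

Let tail_cvg : tail N @[N --> \oo] --> (0 : R).
Proof.
have cq : q ^+ N @[N --> \oo] --> (0 : R) by apply: cvg_expr; rewrite ger0_norm.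
have h1 : K * q ^+ N @[N --> \oo] --> K * 0 by apply: cvgM => //; exact: cvg_cst.
have h2 : K * q ^+ N / (1 - q) @[N --> \oo] --> K * 0 / (1 - q).
  by apply: cvgM => //; exact: cvg_cst.
by move: h2; rewrite mulr0 mul0r.
Qed.

Let psum_tail' N M y : (N <= M)%N -> `|psum M y - psum N y| <= tail N.
Proof.
move=> NM; rewrite -(subnKC NM); apply: le_trans (psum_tail _ _ _) _.
rewrite ler_piMr//; first by rewrite /tail divr_ge0 ?mulr_ge0 ?exprn_ge0// subr_ge0 ltW.
by rewrite lerBlDr lerDl exprn_ge0.
Qed.

Let psum_cvg y : cvgn (fun N => psum N y).
Proof.
apply: (@normed_cvg R R (fun n => b n * sinn n y)).
apply: (@series_le_cvg R _ (geometric K q)) => //.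
- by move=> n; exact: normr_ge0.
- by move=> n; rewrite /geometric/= mulr_ge0// exprn_ge0.
- move=> n; rewrite /= normrM -[leRHS]mulr1; apply: ler_pM => //; exact: sinn_le1.
- by apply: is_cvg_geometric_series; rewrite ger0_norm.
Qed.

Let h y := limn (fun N => psum N y).

Let h_tail N y : `|h y - psum N y| <= tail N.
Proof.
have cv : psum M y @[M --> \oo] --> h y by exact: psum_cvg.
have cv2 : `|psum M y - psum N y| @[M --> \oo] --> `|h y - psum N y|.
  by apply: cvg_norm; apply: cvgB => //; exact: cvg_cst.
rewrite -(cvg_lim _ cv2)//; apply: limr_le; first by apply/cvg_ex; eexists; exact: cv2.
by exists N => // M /= NM; exact: psum_tail'.
Qed.

Let psum_continuous N : continuous (psum N).
Proof.
have hs : smooth (fun y => \sum_(n <- index_iota 0 N) b n * sinn n y).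
  by apply: smooth_sum => n; apply: smoothM; [exact: smooth_cst|exact: smooth_sinn].
exact: (smooth_continuous hs).
Qed.

Let mh : measurable_fun setT (h : T1 -> T1).
Proof.
apply: (@measurable_fun_cvg _ _ _ setT (fun N => psum N)) => [N|y _].
  by apply: continuous_measurable_fun; exact: psum_continuous.
exact: psum_cvg.
Qed.

Let h_bound y : `|h y| <= tail 0.
Proof. by have := h_tail 0 y; rewrite /psum big_nil subr0. Qed.

(** Orthogonality gives the value for every partial sum containing the index [m]; the uniform tail
    bound carries it to the limit. *)
Let int_h m : (0 < m)%N -> \int[mu]_(y in `]0, pi[) (h y * sinn m y) = b m * (pi / 2).
Proof.
move=> m0; pose I := `]0 : R, pi[%classic : set T1.
have mI : measurable I by exact: measurable_itv.
have fI : (mu I < +oo)%E by exact: itv_lty.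
have cs k : continuous (@sinn R k) by exact: (smooth_continuous (smooth_sinn k)).
have ms k : measurable_fun I (@sinn R k).
  by apply: measurable_funTS; apply: continuous_measurable_fun.
have ih : mu.-integrable I (EFin \o h).
  by apply: (bounded_integrable mI fI (M := tail 0)); split; [exact: measurable_funTS|move=> y _; exact: h_bound].
have bs : bounded_on I (@sinn R m) 1 by split => // y _; exact: sinn_le1.
have ihs := integrable_bddM mI ih bs.
have ip N : mu.-integrable I (EFin \o psum N).
  have : mu.-integrable `[0, pi] (EFin \o psum N) by apply: continuous_integrable_itv; exact: psum_continuous.
  by apply: integrableS => //; exact: subset_itv_oo_cc.
have ips N := integrable_bddM mI (ip N) bs.
have isn k : mu.-integrable I (EFin \o @sinn R k).
  have : mu.-integrable `[0, pi] (EFin \o @sinn R k) by exact: continuous_integrable_itv.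
  by apply: integrableS => //; exact: subset_itv_oo_cc.
have pE N : (m < N)%N -> \int[mu]_(y in I) (psum N y * sinn m y) = b m * (pi / 2).
  have pE' M : \int[mu]_(y in I) (psum M y * sinn m y) =
      \sum_(0 <= n < M) b n * (if n == m then pi / 2 else 0).
    elim: M => [|M IH].
      rewrite big_nil /psum; under eq_Rintegral do rewrite big_nil mul0r.
      by rewrite Rintegral_cst// mul0r.
    rewrite big_nat_recr//= -IH.
    have i2 := integrable_bddM mI (isn M) bs.
    have i3 : mu.-integrable I (EFin \o (fun y => b M * (sinn M y * sinn m y))).
      by have := integrableZl mI (b M) i2; apply: eq_integrable.
    rewrite -(sinn_orthogonal M m0) -(RintegralZl _ mI i2) -(RintegralD mI (ips M) i3).
    by apply: eq_Rintegral => y _; rewrite /psum big_nat_recr//=; ring.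
  move=> mN; rewrite pE' (bigD1_seq m)//= ?iota_uniq ?mem_index_iota// eqxx big1 ?addr0// => n /negbTE ->.
  by rewrite mulr0.
apply/eqP; rewrite -subr_eq0 -normr_le0.
have key N : (m < N)%N -> `|\int[mu]_(y in I) (h y * sinn m y) - b m * (pi / 2)| <= tail N * fine (mu I).
  move=> mN; rewrite -(pE N mN) -(RintegralB mI ihs (ips N)).
  have t0 : 0 <= tail N by exact: le_trans (normr_ge0 _) (h_tail N 0).
  have bd : bounded_on I (fun y => h y * sinn m y - psum N y * sinn m y) (tail N).
    split.
      by apply: measurable_funB; apply: measurable_funM => //; apply: measurable_funTS => //;
        apply: continuous_measurable_fun; exact: psum_continuous.
    move=> y _; rewrite -mulrBl normrM -[leRHS]mulr1; apply: ler_pM => //; exact: sinn_le1.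
  have i4 := bounded_integrable mI fI bd.
  apply: le_trans (le_normr_Rintegral mI i4) _.
  rewrite -(Rintegral_cst mu mI); apply: le_Rintegral => //.
  - exact: integrable_norm i4.
  - by apply: (bounded_integrable mI fI (M := tail N)); split => // y _; rewrite ger0_norm.
  - by move=> y Iy; case: bd => _; exact.
have cv : tail N * fine (mu I) @[N --> \oo] --> 0 * fine (mu I).
  by apply: cvgM; [exact: tail_cvg|exact: cvg_cst].
rewrite mul0r in cv; set X := `|_|; rewrite -[leRHS](cvg_lim _ cv)//; apply: limr_ge.
  by apply/cvg_ex; eexists; exact: cv.
by exists m.+1 => // N /= mN; exact: key.
Qed.

(* The datum has prescribed moments against [Phi(x) sin(n y)], and is localized
   in [|x| <= eta], where the sign of [Phi] is known. *)
Lemma initial_datum (eta : R) : exists f0 : R * R -> R,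
  L2on (leb2 R) (Omega R) f0 /\ forall m (Phi : R -> R), (0 < m)%N -> continuous Phi ->
    L2dot f0 (tens Phi (sinn m)) =
      (\int[mu]_(x in `]-1, 1[) (\1_(`[- eta, eta]%classic) x * Phi x)) * (b m * (pi / 2)).
Proof.
pose chi : R -> R := \1_(`[- eta, eta]%classic).
have mchi : measurable_fun setT (chi : T1 -> T1) by apply: measurable_indic.
have chi1 x : `|chi x| <= 1.
  by rewrite /chi indicE; case: (_ \in _); rewrite ?normr1 ?normr0 ?ler01.
have bd : bddO (tens chi h) (1 * tail 0).
  exact: tens_integrable.
exists (tens chi h); split; first exact: bddO_L2on bd.
move=> m Phi m0 cPhi; rewrite -int_h//.
have [M M0 hM] := continuous_itv_bounded (-1) 1 cPhi.
rewrite -(@Rintegral_tens R (fun x => chi x * Phi x) (fun y => h y * sinn m y) (1 * M) (tail 0 * 1)).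
- by apply: eq_Rintegral => z _; rewrite /tens; ring.
- by apply: measurable_funM => //; exact: continuous_measurable_fun.
- apply: measurable_funM => //; apply: continuous_measurable_fun.
  exact: (smooth_continuous (smooth_sinn m)).
- move=> x /andP[x1 x2]; rewrite normrM; apply: ler_pM => //; apply: hM.
  by rewrite !ltW.
- by move=> y _; rewrite normrM; apply: ler_pM => //; exact: sinn_le1.
Qed.

End InitialData.

(** * From approximate eigenfunctions to non-controllability *)

Section Obstruction.
Context {R : realType}.
Local Notation T1 := (measurableTypeR R).
Local Notation T2 := (measurableTypeR R * measurableTypeR R)%type.
Notation mu := (@lebesgue_measure R).

Lemma Rintegral_sum_ord d (X : measurableType d) (nu : {measure set X -> \bar R}) (D : set X)
    (mD : measurable D) n (F : nat -> X -> R) :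
  (forall i, nu.-integrable D (EFin \o F i)) ->
  nu.-integrable D (EFin \o (fun x => \sum_(i < n) F i x)) /\
  \int[nu]_(x in D) (\sum_(i < n) F i x) = \sum_(i < n) \int[nu]_(x in D) F i x.
Proof.
move=> iF; elim: n => [|n [IH1 IH2]].
  split; last by rewrite big_ord0; under eq_Rintegral do rewrite big_ord0; rewrite Rintegral_cst// mul0r.
  have := integrable0 nu D; apply: eq_integrable => // x _; by rewrite /= big_ord0.
have E : (fun x => \sum_(i < n.+1) F i x) = (fun x => \sum_(i < n) F i x + F n x).
  by apply/funext => x; rewrite big_ord_recr.
rewrite E big_ord_recr/= -IH2 -(RintegralD mD IH1 (iF n)); split => //.
by have := integrableD mD IH1 (iF n); apply: eq_integrable.
Qed.

Lemma le_Rintegral_itv (g : R -> R) (T B : R) : 0 < T -> 0 <= B ->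
  {within `[0, T], continuous g} -> (forall t, 0 < t < T -> `|g t| <= B) ->
  `|\int[mu]_(t in `]0, T[) g t| <= T * B.
Proof.
move=> T0 B0 cg gB.
have mI : measurable (`]0, T[%classic : set T1) by exact: measurable_itv.
have ig : mu.-integrable `]0, T[ (EFin \o g).
  by have := within_integrable cg; apply: integrableS => //; exact: subset_itv_oo_cc.
apply: le_trans (le_normr_Rintegral mI ig) _.
apply: (@le_trans _ _ (\int[mu]_(t in `]0, T[) (B : R))).
  apply: le_Rintegral => //; first exact: integrable_norm ig.
    apply: (bounded_integrable mI (itv_lty _ _) (M := B)); split => // x _.
    by rewrite ger0_norm.
have e : fine (mu `]0, T[%classic) <= T.
  by rewrite lebesgue_measure_itv /= lte_fin T0 -EFinB subr0.
by rewrite (Rintegral_cst _ mI) mulrC; apply: ler_wpM2r => //; exact: e.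
Qed.

(** Isolates what both time ranges share. The residual bound ties the error to the norm sum |a_n|
    e^(-nJ); the lower bound on [Phi] near x = 0 allows the moments to be prescribed; the last
    hypothesis says that a sine polynomial controlled away from the target gives a bounded weight in
    front of the control, [s] being the time left before [T]. *)
Lemma not_null_controllable_family (omega : set (R * R)) (y0 e T S S' J C eta : R) (n0 : nat)
    (m : nat -> R) (Phi : nat -> R -> R) :
  measurable (omega : set T2) -> omega `<=` Omega R ->
  0 < y0 < pi -> 0 < e -> 0 < T -> T < S -> S < S' -> S < J -> 0 < C -> 0 < eta < 1 ->
  (0 < n0)%N ->
  (forall n, smooth (Phi n)) ->
  (forall n, (n0 <= n)%N -> Phi n (-1) = 0 /\ Phi n 1 = 0) ->
  (forall n, (n0 <= n)%N -> 0 <= m n <= n%:R + C) ->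
  (forall n (x : R), (n0 <= n)%N -> -1 <= x <= 1 -> `|residual (Phi n) n (m n) x| <= C * expR (- J) ^+ n) ->
  (forall n x, (n0 <= n)%N -> `|x| <= eta -> C^-1 * expR (- ((S - T) / 2)) ^+ n <= Phi n x) ->
  (forall N (a : nat -> R), (forall i, (i < n0)%N -> a i = 0) ->
     (forall r y : R, 0 <= r <= 1 -> 0 < y < pi -> r <= expR (- S') \/ e <= `|y - y0| ->
        `|\sum_(i < N) a i * (r ^+ i * sin (i%:R * y))| <= 1) ->
     \sum_(i < N) `|a i| * expR (- J) ^+ i <= 1 ->
     forall s x y : R, 0 <= s <= T -> omega (x, y) ->
       `|\sum_(i < N) a i * (expR (- (m i * s)) * (Phi i x * sin (i%:R * y)))| <= C) ->
  ~ null_controllable omega T.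
Proof.
move=> mw wO hy0 e0 T0 TS SS' SJ C0 /andP[eta0 eta1] n00 sPhi Phi1 hm hres hpos hobs NC.
have mO := @measurable_Omega R; have fO := @leb2_Omega_lty R.
have mI : measurable (`]-1, 1[%classic : set T1) by exact: measurable_itv.
(* The required coefficients are of order e^(-n (S - T)) = q^(2n) divided by [kap n], which is at
   least of order q^n: the datum still decays like q^n. *)
pose q := expR (- ((S - T) / 2)) : R.
have q0 : 0 < q by exact: expR_gt0.
have q1 : q < 1 by rewrite expR_lt1; lra.
have cPhi n : continuous (Phi n) := smooth_continuous (sPhi n).
pose chi : R -> R := \1_(`[- eta, eta]%classic).
pose kap n := \int[mu]_(x in `]-1, 1[) (chi x * Phi n x).
have mchi : measurable_fun (`]-1, 1[%classic : set T1) (chi : T1 -> T1).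
  by apply: measurable_funTS; apply: measurable_indic.
have chi1 x : `|chi x| <= 1.
  by rewrite /chi indicE; case: (_ \in _); rewrite ?normr1 ?normr0 ?ler01.
have bchi : bounded_on (`]-1, 1[%classic : set T1) chi 1 by split => // x _; exact: chi1.
have ichi := bounded_integrable mI (itv_lty _ _) bchi.
have int_chi : \int[mu]_(x in `]-1, 1[) chi x = 2 * eta.
  rewrite /Rintegral integral_indic//.
  have -> : `[- eta, eta]%classic `&` `]-1, 1[%classic = (`[- eta, eta]%classic : set R).
    apply/seteqP; split=> x; first by case.
    by move=> /= h; split => //; move: h; rewrite /= !in_itv/=; lra.
  have E : mu (`[- eta, eta]%classic : set R) = (2 * eta)%:E.
  by rewrite lebesgue_measure_itv /= lte_fin ifT -?EFinB /=; [congr (_%:E)|]; lra.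
  exact: (congr1 fine E).
have hkap n : (n0 <= n)%N -> C^-1 * q ^+ n * (2 * eta) <= kap n.
  move=> hn; rewrite -int_chi -(RintegralZl _ mI ichi).
  have [M _ hM] := continuous_itv_bounded (-1) 1 (cPhi n).
  have bP : bounded_on (`]-1, 1[%classic : set T1) (Phi n) M.
    split; first by apply: measurable_funTS; exact: continuous_measurable_fun.
    by move=> x /=; rewrite in_itv/= => /andP[h1 h2]; apply: hM; rewrite !ltW.
  apply: le_Rintegral => //.
  - by have := integrableZl mI (C^-1 * q ^+ n) ichi; apply: eq_integrable.
  - exact: (integrable_bddM mI ichi bP).
  move=> x _; rewrite mulrC /chi indicE; case: (boolP (x \in _)) => hx /=; last by rewrite !mul0r.
  rewrite !mul1r; apply: hpos => //; move: hx; rewrite inE/= in_itv/=.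
  by rewrite ler_norml.
have kap0 n : (n0 <= n)%N -> 0 < kap n.
  by move=> hn; apply: lt_le_trans (hkap n hn); rewrite !mulr_gt0// ?invr_gt0// exprn_gt0.
(* Solved from the requirement that e^(-m_n T) [kap n] [b n] pi / 2 be e^(-n S) sin(n y0). Indices
   below [n0], where [Phi] is not controlled, are dropped. *)
pose b n : R := if (n0 <= n)%N then
   expR (- (n%:R * S) + m n * T) * sin (n%:R * y0) / (kap n * (pi / 2)) else 0.
pose K := expR (C * T) * C / (eta * pi).
have pi0 := pi_gt0 R.
have K0 : 0 <= K by rewrite divr_ge0 ?mulr_ge0 ?expR_ge0// ltW.
have hb n : `|b n| <= K * q ^+ n.
  rewrite /b; case: ifPn => hn; last by rewrite normr0 mulr_ge0// exprn_ge0// ltW.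
  have kp : 0 < kap n * (pi / 2) by rewrite mulr_gt0 ?kap0// divr_gt0.
  rewrite normrM normfV (gtr0_norm kp) ler_pdivrMr// normrM (ger0_norm (expR_ge0 _)).
  apply: (@le_trans _ _ (expR (- (n%:R * S) + m n * T))).
    rewrite -[leRHS]mulr1; apply: ler_pM => //; exact: sinn_le1.
  apply: (@le_trans _ _ (K * q ^+ n * (C^-1 * q ^+ n * (2 * eta) * (pi / 2)))); last first.
    apply: ler_wpM2l; first by rewrite mulr_ge0// exprn_ge0// ltW.
    by apply: ler_wpM2r; [rewrite divr_ge0// ltW|exact: hkap].
  have -> : K * q ^+ n * (C^-1 * q ^+ n * (2 * eta) * (pi / 2)) = expR (C * T) * (q ^+ n * q ^+ n).
    have fld (c t p r E : R) : 0 < c -> 0 < t -> 0 < p ->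
        E * c / (t * p) * r * (c^-1 * r * (2 * t) * (p / 2)) = E * (r * r).
      by move=> *; field; rewrite !gt_eqF.
    exact: fld.
  rewrite -expRM_natl -!expRD ler_expR.
  have /andP[_ h] := hm n hn.
  have := ler_wpM2r (ltW T0) h; rewrite mulrDl => {}h.
  apply: le_trans (lerD (lexx _) h) _; rewrite le_eqVlt; apply/orP; left; apply/eqP.
  by field.
have [f0 [Lf0 hf0]] := initial_datum (ltW q0) q1 K0 hb eta.
(* Control and solution are frozen here, so the constants [Nu] and [Mf] do not depend on the
   polynomial chosen later. *)
have [u [Lu [f [W fT]]]] := NC f0 Lf0.
have Cf : C_0T_L2 T f by case: W.
have Iu : (leb3 R).-integrable (cylinder T) (EFin \o u : T1 * T2 -> \bar R).
  exact: L2on_integrable (measurable_cylinder T) (cylinder_lty T) _ Lu.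
pose Nu := \int[leb3 R]_(p in cylinder T) `|u p|.
have Nu0 : 0 <= Nu by apply: Rintegral_ge0 => p _.
have [t0 _ hMf] := EVT_max (ltW T0) (L1norm_within Cf).
set Mf := \int[leb2 R]_(z in Omega R) `|f t0 z| in hMf.
have Mf0 : 0 <= Mf by apply: Rintegral_ge0 => p _.
(* The prescribed size exceeds by 1 the sum of the bounds for the residual terms and for the control
   terms. *)
have [N [a [a0 aK aJ aM]]] := runge_sine n0 (T * (C * Mf) + C * Nu + 1) hy0 e0 (lt_trans T0 TS) SS' SJ.
pose I1 i := \int[mu]_(t in `]0, T[) (expR (- (m i * (T - t))) *
   L2dot (f t) (tens (residual (Phi i) i (m i)) (sinn i))).
pose g i (p : T1 * T2) : R := \1_omega p.2 * (expR (- (m i * (T - p.1))) * tens (Phi i) (sinn i) p.2).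
pose I2 i := \int[leb3 R]_(p in cylinder T) (u p * g i p).
have ident i : (n0 <= i)%N -> expR (- S) ^+ i * sin (i%:R * y0) = I1 i - I2 i.
  move=> hi; have [P1 P2] := Phi1 i hi.
  rewrite -(moment_identity i (m i) mw T0 Lu W fT (sPhi i) P1 P2).
  rewrite hf0//; last exact: leq_trans hi.
  rewrite -/chi -/(kap i) /b hi -expRM_natl.
  have -> : i%:R * - S = - (m i * T) + (- (i%:R * S) + m i * T) by ring.
  have fld (p q' r k w : R) : 0 < k -> 0 < w -> p * q' * r = p * (k * (q' * r / (k * (w / 2)) * (w / 2))).
    by move=> *; field; rewrite !gt_eqF.
  by rewrite expRD; apply: fld => //; exact: kap0.
have cE i : continuous (fun t : R => expR (- (m i * (T - t)))).
  move=> t; apply: (continuous_comp (f := fun t : R => - (m i * (T - t))) (g := @expR R)).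
    by apply: cvgN; apply: cvgM; [exact: cvg_cst|apply: cvgB; [exact: cvg_cst|exact: cvg_id]].
  exact: continuous_expR.
have bI1 i : (n0 <= i)%N -> `|I1 i| <= T * (C * expR (- J) ^+ i * Mf).
  move=> hi; have /andP[mi0 _] := hm i hi.
  have sr := smooth_residual i (m i) (sPhi i).
  apply: le_Rintegral_itv => //.
  - by rewrite !mulr_ge0 ?exprn_ge0 ?expR_ge0// ltW.
  - apply: withinM; first by apply: continuous_subspaceT => t; exact: cE.
    by apply: L2dot_within => //; [exact: (smooth_continuous sr)|exact: (smooth_continuous (smooth_sinn i))].
  move=> t /andP[tt0 tT]; rewrite normrM -[leRHS]mul1r; apply: ler_pM => //.
    by rewrite ger0_norm ?expR_ge0// expR_le1 oppr_le0 mulr_ge0// subr_ge0 ltW.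
  have Lft : L2on (leb2 R) (Omega R) (f t) by case: Cf => + _; apply; rewrite !ltW.
  have bd : bddO (tens (residual (Phi i) i (m i)) (sinn i)) (C * expR (- J) ^+ i * 1).
    apply: tens_bound; [exact: (smooth_continuous sr)|exact: (smooth_continuous (smooth_sinn i))| |].
      by move=> x hx; exact: hres.
    by move=> y _; exact: sinn_le1.
  rewrite mulr1 in bd.
  apply: le_trans (le_Rintegral_bdd mO (L2on_integrable mO fO Lft) bd) _.
  apply: ler_wpM2l; first by rewrite mulr_ge0 ?exprn_ge0 ?expR_ge0// ltW.
  by apply: hMf; rewrite in_itv/= !ltW.
have bg i : exists M, bounded_on (cylinder T) (g i) M.
  exact: cylinder_bounded mw (cPhi i) (smooth_continuous (smooth_sinn i)) (cE i).
have mcyl := measurable_cylinder T.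
have iug i : (leb3 R).-integrable (cylinder T) (EFin \o (fun p => u p * g i p) : T1 * T2 -> \bar R).
  by have [M bM] := bg i; exact: (integrable_bddM mcyl Iu bM).
have iaug i : (leb3 R).-integrable (cylinder T) (EFin \o (fun p => a i * (u p * g i p)) : T1 * T2 -> \bar R).
  by have := integrableZl mcyl (a i) (iug i); apply: eq_integrable.
have sumI2 : \sum_(i < N) a i * I2 i =
    \int[leb3 R]_(p in cylinder T) (u p * \sum_(i < N) a i * g i p).
  have [_ ] := Rintegral_sum_ord mcyl N iaug.
  under [X in _ = X -> _]eq_bigr => i _ do rewrite (RintegralZl _ mcyl (iug i)).
  move=> <-; apply: eq_Rintegral => p _; rewrite mulr_sumr; apply: eq_bigr => i _.
  by rewrite mulrCA.
have bG : bounded_on (cylinder T) (fun p => \sum_(i < N) a i * g i p) C.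
  split.
    apply: (measurable_sum _ (h := fun (i : 'I_N) p => a i * g i p)) => i.
    apply: measurable_funM; first exact: measurable_cst.
    by have [M []] := bg i.
  move=> [t [x y]] [/= /andP[tt0 tT] hO].
  rewrite /g /= indicE; case: (boolP ((x, y) \in omega)) => hw /=; last first.
    by rewrite big1 ?normr0 ?ltW// => i _; rewrite mul0r mulr0.
  have hst : 0 <= T - t <= T by lra.
  have := hobs N a a0 aK aJ _ x y hst (set_mem hw).
  by congr (`|_| <= _); apply: eq_bigr => i _; rewrite mul1r.
have bI2 : `|\sum_(i < N) a i * I2 i| <= C * Nu.
  by rewrite sumI2; exact: le_Rintegral_bdd.
have bS1 : `|\sum_(i < N) a i * I1 i| <= T * (C * Mf).
  apply: le_trans (ler_norm_sum _ _ _) _.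
  apply: (@le_trans _ _ (\sum_(i < N) (`|a i| * expR (- J) ^+ i) * (T * (C * Mf)))).
    apply: ler_sum => i _; rewrite normrM.
    have [hi|hi] := leqP n0 i; last by rewrite a0// normr0 !mul0r.
    rewrite -mulrA; apply: ler_wpM2l => //; apply: le_trans (bI1 i hi) _.
    by rewrite le_eqVlt; apply/orP; left; apply/eqP; ring.
  rewrite -mulr_suml; apply: ler_piMl => //.
  by rewrite !mulr_ge0// ltW.
have tot : \sum_(i < N) a i * (expR (- S) ^+ i * sin (i%:R * y0)) =
    \sum_(i < N) a i * I1 i - \sum_(i < N) a i * I2 i.
  rewrite -sumrB; apply: eq_bigr => i _; rewrite -mulrBr.
  have [hi|hi] := leqP n0 i; first by rewrite ident.
  by rewrite a0// !mul0r.
have := ler_normB (\sum_(i < N) a i * I1 i) (\sum_(i < N) a i * I2 i).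
rewrite -tot; lra.
Qed.

End Obstruction.

(** * The case T < 1/2 *)

Section Gaussian.
Context {R : realType}.
Local Notation T2 := (measurableTypeR R * measurableTypeR R)%type.

Definition gauss (c x : R) : R := expR (c * x ^+ 2).

Lemma is_derive_gauss (c x : R) : is_derive x 1 (gauss c) (2 * c * x * gauss c x).
Proof.
have hq : is_derive x 1 (fun t : R => c * t ^+ 2) (c * (1 * x + x * 1)).
  by apply: is_derive1Z; apply: is_derive1M; exact: is_derive1_id.
have := is_derive1_comp hq (is_derive_expR (c * x ^+ 2)).
by congr is_derive; rewrite /gauss; ring.
Qed.

Lemma smooth_gauss (c : R) : smooth (gauss c).
Proof.
apply: (smooth_comp (f := fun x : R => c * x ^+ 2)); last exact: smooth_expR.
by apply: smoothM; [exact: smooth_cst|apply: smoothM; exact: smooth_id].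
Qed.

Lemma sqr_le_expR (x : R) : 0 <= x -> x ^+ 2 <= 4 * expR x.
Proof.
move=> x0; have h : x / 2 <= expR (x / 2) by apply: le_trans (expR_ge1Dx _); rewrite lerDr.
have : (x / 2) ^+ 2 <= expR (x / 2) ^+ 2 by rewrite ler_sqr ?nnegrE ?expR_ge0// divr_ge0.
have -> : expR (x / 2) ^+ 2 = expR x by rewrite expr2 -expRD -splitr.
by rewrite expr_div_n; lra.
Qed.

(** Shrinking [a] to [a'] gives a compact segment that misses the closed set [closure omega]; by
    compactness a whole neighbourhood of uniform height misses [omega]. *)
Lemma tube (omega : set (R * R)) (y0 a a' : R) : 0 < a' < a ->
  [set z : R * R | `|z.1| < a /\ z.2 = y0] `&` closure omega = set0 ->
  exists2 e : R, 0 < e & forall x y, omega (x, y) -> `|y - y0| < e -> a' <= `|x|.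
Proof.
move=> /andP[a'0 a'a] dis.
have cK := @segment_compact R (- a') a'.
have nc := (compact_near_coveringP _).1 cK.
have /nc H : forall x, `[- a', a']%classic x ->
    \forall x' \near x & y \near nbhs y0, ~ omega (x', y).
  move=> x /=; rewrite in_itv/= => /andP[x1 x2].
  have : ~ closure omega (x, y0).
    move=> cl; suff : (set0 : set (R * R)) (x, y0) by [].
    rewrite -dis; split => //=; split => //; rewrite ltr_norml; lra.
  move=> ncl; apply: contrapT => nn; apply: ncl => B nB.
  apply: contrapT => /set0P/negP/negPn/eqP B0; apply: nn.
  apply: (filterS _ nB) => -[x' y] Bxy wxy.
  by suff : (omega `&` B) (x', y) by rewrite B0.
have /nbhs_ballP[e /= e0 he] := H.
exists e => // x y wxy hy; rewrite leNgt; apply/negP => hx.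
apply: (he y _ x) wxy; first by rewrite /ball/= distrC.
by rewrite /= in_itv/=; move: hx; rewrite ltr_norml => /andP[/ltW -> /ltW ->].
Qed.

(** The correction e^(-n/2) restores the boundary values of the Gaussian and is the only source of
    the residual, (n - n^2 x^2) e^(-n/2). *)
Lemma not_null_controllable_short_time (omega : set (R * R)) (y0 e T a : R) :
  measurable (omega : set T2) -> omega `<=` Omega R -> 0 < y0 < pi -> 0 < e -> 0 < T ->
  0 < a < 1 -> T < a ^+ 2 / 2 ->
  (forall x y, omega (x, y) -> `|y - y0| < e -> a <= `|x|) ->
  ~ null_controllable omega T.
Proof.
move=> mw wO hy0 e0 T0 /andP[a0 a1] Ta hw.
(* Near the height [y0] the control has |x| >= a and thus sees only moduli e^(-s - x^2/2) of at most
   e^(-S'). The same value serves as [J], being below 1/2. *)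
pose S' := a ^+ 2 / 2; pose S := (T + S') / 2.
have S'1 : S' < 1 / 2 by rewrite /S' ltr_pM2r ?invr_gt0// expr_lt1// ltW.
have TS' : T < S' := Ta.
have TS : T < S by rewrite /S; lra.
have SS' : S < S' by rewrite /S; lra.
(* Makes eta^2 <= S - T, so that e^(-n eta^2 / 2) meets the lower bound asked of [Phi]. *)
pose eta := Num.min (1 / 2) (S - T) : R.
have eta0 : 0 < eta by rewrite lt_min; lra.
have [eta1 etaS] : eta <= 1 / 2 /\ eta <= S - T by split; rewrite ge_min lexx ?orbT.
have eta2 : eta ^+ 2 <= S - T.
  by apply: le_trans etaS; rewrite expr2 ler_piMr// ?ltW//; lra.
have eta22 : eta ^+ 2 < 1 by rewrite expr_lt1// ?ltW//; lra.
(* The gap between the rates 1/2 and [J], which absorbs the factor n^2 of the residual. *)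
pose dl := 1 / 2 - S'; have dl0 : 0 < dl by rewrite /dl; lra.
pose ga := 1 - expR (- (1 - eta ^+ 2) / 2).
have ga0 : 0 < ga by rewrite subr_gt0 expR_lt1; lra.
(* The three terms serve the observed sum (two contributions of at most 1), the residual (by t^2 <=
   4 e^t at t = n dl) and the lower bound on [Phi]. *)
pose C := 2 + 8 / dl ^+ 2 + ga^-1.
have C8 : 0 < 8 / dl ^+ 2 by rewrite divr_gt0// exprn_gt0.
have gi0 : 0 < ga^-1 by rewrite invr_gt0.
have C0 : 0 < C by rewrite /C; lra.
pose Phi n (x : R) := gauss (- n%:R / 2) x - expR (- n%:R / 2).
apply: (not_null_controllable_family (S := S) (S' := S') (J := S') (C := C) (eta := eta)
  (n0 := 1) (m := fun n => n%:R) (Phi := Phi) mw wO hy0 e0) => //.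
- by rewrite eta0/=; lra.
- move=> n; apply: smoothD; first exact: smooth_gauss.
  exact: smooth_cst.
- by move=> n _; rewrite /Phi /gauss sqrrN expr1n mulr1 subrr.
- by move=> n _; rewrite ler0n lerDl ltW.
- move=> n x n1 /andP[x1 x2].
  have d1 (t : R) : is_derive t 1 (Phi n) (2 * (- n%:R / 2) * t * gauss (- n%:R / 2) t).
    rewrite -[X in is_derive _ _ _ X]subr0.
    exact: is_derive1D (is_derive_gauss _ _) (is_derive1N (is_derive1_cst _ _)).
  have e1 : derive1 (Phi n) = (fun t => 2 * (- n%:R / 2) * t * gauss (- n%:R / 2) t).
    by apply/funext => t; exact: is_derive1E (d1 t).
  have d2 : is_derive x 1 (derive1 (Phi n)) ((2 * (- n%:R / 2) * 1) * gauss (- n%:R / 2) x +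
     2 * (- n%:R / 2) * x * (2 * (- n%:R / 2) * x * gauss (- n%:R / 2) x)).
    rewrite e1; exact: is_derive1M (is_derive1Z _ (is_derive1_id x)) (is_derive_gauss _ x).
  rewrite /residual (is_derive1E d2).
  have -> : - (2 * (- n%:R / 2) * 1 * gauss (- n%:R / 2) x +
     2 * (- n%:R / 2) * x * (2 * (- n%:R / 2) * x * gauss (- n%:R / 2) x)) +
     (n%:R * x) ^+ 2 * Phi n x - n%:R * Phi n x = (n%:R - n%:R ^+ 2 * x ^+ 2) * expR (- n%:R / 2).
    by rewrite /Phi; field.
  have -> : C * expR (- S') ^+ n = C * expR (n%:R * dl) * expR (- n%:R / 2).
    by rewrite -mulrA -expRD -expRM_natl; congr (_ * expR _); rewrite /dl; field.
  rewrite normrM (ger0_norm (expR_ge0 _)); apply: ler_wpM2r; first exact: expR_ge0.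
  have n1' : 1 <= n%:R :> R by rewrite ler1n.
  have hn : n%:R <= n%:R ^+ 2 :> R by rewrite expr2 ler_peMl// ler0n.
  have hx : 0 <= x ^+ 2 <= 1 by rewrite sqr_ge0 /= -(real_normK (num_real x)) expr_le1// ler_norml x1.
  apply: (@le_trans _ _ (2 * n%:R ^+ 2)).
    by case/andP: hx => h1 h2; rewrite ler_norml; apply/andP; split; nra.
  apply: (@le_trans _ _ (8 / dl ^+ 2 * expR (n%:R * dl))); last first.
    by apply: ler_wpM2r; [exact: expR_ge0|rewrite /C; lra].
  have := sqr_le_expR (mulr_ge0 (ler0n R n) (ltW dl0)).
  rewrite exprMn => h; rewrite mulrAC ler_pdivlMr ?exprn_gt0//; lra.
- move=> n x n1 hx.
  have n1' : 1 <= n%:R :> R by rewrite ler1n.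
  have hx2 : x ^+ 2 <= eta ^+ 2 by rewrite -(real_normK (num_real x)) ler_sqr// nnegrE// ltW.
  apply: (@le_trans _ _ (ga * expR (- (n%:R * eta ^+ 2 / 2)))).
    apply: ler_pM; rewrite ?exprn_ge0 ?expR_ge0 ?invr_ge0 ?(ltW C0)//.
      by rewrite -[leRHS]invrK lef_pV2 ?posrE// /C; lra.
    by rewrite -expRM_natl ler_expR; nra.
  apply: (@le_trans _ _ (expR (- (n%:R * eta ^+ 2 / 2)) - expR (- n%:R / 2))); last first.
    by rewrite /Phi /gauss lerB// ler_expR; nra.
  rewrite mulrC mulrBr mulr1 -expRD lerB// ler_expR; nra.
move=> N b b0 hb lb s x y /andP[s0 sT] wxy.
have [/= /andP[x1 x2] /andP[y1 y2]] := wO _ wxy.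
(* The Gaussian part is the sine polynomial at modulus e^(-s - x^2/2); the boundary correction
   decays faster than e^(-nJ) and falls under the coefficient bound. *)
have -> : \sum_(i < N) b i * (expR (- (i%:R * s)) * (Phi i x * sin (i%:R * y))) =
  \sum_(i < N) b i * (expR (- s - x ^+ 2 / 2) ^+ i * sin (i%:R * y)) -
  \sum_(i < N) b i * (expR (- (i%:R * s)) * expR (- i%:R / 2) * sin (i%:R * y)).
  rewrite -sumrB; apply: eq_bigr => i _; rewrite /Phi /gauss -expRM_natl.
  have -> : i%:R * (- s - x ^+ 2 / 2) = - (i%:R * s) + - i%:R / 2 * x ^+ 2 by ring.
  by rewrite expRD; ring.
apply: (@le_trans _ _ (1 + 1)); last by rewrite /C; lra.
apply: le_trans (ler_normB _ _) _; apply: lerD.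
  apply: hb; last 1 first.
  - have [hy|hy] := leP e `|y - y0|; first by right.
    left; rewrite ler_expR; have ax := hw _ _ wxy hy.
    have : a ^+ 2 <= x ^+ 2 by rewrite -(real_normK (num_real x)) ler_sqr// nnegrE ltW.
    by rewrite /S'; lra.
  - by rewrite expR_ge0 /= expR_le1; have := sqr_ge0 x; lra.
  - by rewrite y1.
apply: le_trans (ler_norm_sum _ _ _) _; apply: le_trans lb.
apply: ler_sum => i _; rewrite normrM; apply: ler_wpM2l => //.
rewrite normrM -[leRHS]mulr1; apply: ler_pM => //; last exact: sinn_le1.
rewrite -expRD ger0_norm ?expR_ge0// -expRM_natl ler_expR.
have := ler0n R i; nra.
Qed.

End Gaussian.

(** * The case of a strip *)

Section Multiplier.
Context {R : realType} (n0 : nat).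
Implicit Types (g h b : nat -> R) (C B r : R) (k : nat).

(* [g] acts as a multiplier for the sup norm on [0, 1] of polynomials without terms of
   degree below [n0], up to an error O(exp (- k i)). *)
Definition mult k C g : Prop := forall n b B, (forall i, (i < n0)%N -> b i = 0) ->
  (forall r, 0 <= r <= 1 -> `|\sum_(i < n) b i * r ^+ i| <= B) ->
  \sum_(i < n) `|b i| * expR (- k%:R) ^+ i <= B ->
  forall r, 0 <= r <= 1 -> `|\sum_(i < n) b i * g i * r ^+ i| <= C * B.

Lemma expRNk_le1 k i : expR (- k%:R) ^+ i <= 1 :> R.
Proof. by rewrite exprn_ile1// ?expR_ge0// expR_le1 oppr_le0. Qed.

(** The single monomial r^i satisfies the hypotheses with B = 1; evaluate at r = 1. *)
Lemma mult_le k C g i : mult k C g -> (n0 <= i)%N -> `|g i| <= C.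
Proof.
move=> hg hi.
have one (X : nat -> R) : \sum_(j < i.+1) ((j : nat) == i)%:R * X j = X i.
  rewrite (bigD1 ord_max)//= eqxx mul1r big1 ?addr0// => j hj.
  by rewrite -(inj_eq val_inj)/= in hj; rewrite (negbTE hj) mul0r.
have := hg i.+1 (fun j => (j == i)%:R) 1.
have -> : \sum_(j < i.+1) `|((j : nat) == i)%:R| * expR (- k%:R) ^+ j = expR (- k%:R) ^+ i :> R.
  by rewrite -[RHS](one (fun j => expR (- k%:R) ^+ j)); apply: eq_bigr => j _; rewrite normr_nat.
move=> /(_ _ _ (expRNk_le1 _ _) 1); rewrite mulr1 => H.
have {H} : `|\sum_(j < i.+1) ((j : nat) == i)%:R * g j * 1 ^+ j| <= C.
  apply: H; rewrite ?lexx ?ler01//.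
    by move=> j hj; case: eqP => // ji; rewrite ji ltnNge hi in hj.
  by move=> r /andP[r0 r1]; rewrite (one (fun j => r ^+ j)) normrX exprn_ile1// ger0_norm.
by under eq_bigr do rewrite -mulrA; rewrite (one (fun j => g j * 1 ^+ j)) expr1n mulr1.
Qed.

(** The sequence b_i g_i again satisfies the hypotheses, with C B in place of B: the sup bound is
    the multiplier property of [g] and the coefficient bound uses |g_i| <= C. *)
Lemma multM k C C' g h : mult k C g -> mult k C' h -> mult k (C' * C) (fun i => g i * h i).
Proof.
move=> hg hh n b B b0 bB bL r hr; rewrite -mulrA.
have -> : \sum_(i < n) b i * (g i * h i) * r ^+ i = \sum_(i < n) b i * g i * h i * r ^+ i.
  by apply: eq_bigr => i _; rewrite mulrA.
apply: (hh n (fun i => b i * g i)) => //; first by move=> i /b0 ->; rewrite mul0r.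
  by move=> s hs; exact: hg.
apply: (@le_trans _ _ (C * \sum_(i < n) `|b i| * expR (- k%:R) ^+ i)).
  rewrite mulr_sumr; apply: ler_sum => i _; rewrite mulrA.
  apply: ler_wpM2r; first by rewrite exprn_ge0// expR_ge0.
  have [hi|hi] := leqP n0 i; last by rewrite b0// mul0r normr0 mulr0.
  by rewrite normrM mulrC; apply: ler_wpM2r => //; exact: mult_le hg hi.
apply: ler_wpM2l => //; exact: le_trans (normr_ge0 _) (mult_le hg (leqnn _)).
Qed.

Lemma multD k C C' g h : mult k C g -> mult k C' h -> mult k (C + C') (fun i => g i + h i).
Proof.
move=> hg hh n b B b0 bB bL r hr.
have -> : \sum_(i < n) b i * (g i + h i) * r ^+ i =
    \sum_(i < n) b i * g i * r ^+ i + \sum_(i < n) b i * h i * r ^+ i.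
  by rewrite -big_split; apply: eq_bigr => i _; rewrite mulrDr mulrDl.
by rewrite mulrDl; apply: le_trans (ler_normD _ _) _; apply: lerD; [exact: hg|exact: hh].
Qed.

Lemma eq_mult k C g h : (forall i, (n0 <= i)%N -> g i = h i) -> mult k C g -> mult k C h.
Proof.
move=> gh hg n b B b0 bB bL r hr; have := hg n b B b0 bB bL r hr.
congr (`|_| <= _); apply: eq_bigr => i _.
by have [hi|hi] := leqP n0 i; [rewrite gh|rewrite b0// !mul0r].
Qed.

Lemma mult_weaken k C C' g : C <= C' -> mult k C g -> mult k C' g.
Proof.
move=> CC' hg n b B b0 bB bL r hr; apply: le_trans (hg n b B b0 bB bL r hr) _.
by apply: ler_wpM2r => //; apply: le_trans (bB r hr).
Qed.

(** Multiplying by e^(-s i) replaces r by e^(-s) r, still a point of [0, 1]. *)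
Lemma mult_expR k (s : R) : 0 <= s -> mult k 1 (fun i => expR (- s) ^+ i).
Proof.
move=> s0 n b B b0 bB bL r /andP[r0 r1].
have := bB (expR (- s) * r); rewrite mul1r => H.
under eq_bigr do rewrite -mulrA -exprMn; apply: H.
by rewrite mulr_ge0 ?expR_ge0//= mulr_ile1 ?expR_ge0// expR_le1 oppr_le0.
Qed.

Lemma mult_cst k (c : R) : mult k `|c| (fun=> c).
Proof.
move=> n b B b0 bB bL r hr; under eq_bigr do rewrite mulrAC.
rewrite -mulr_suml normrM mulrC; apply: ler_wpM2l => //; exact: bB.
Qed.

Lemma mult_small k C g : (forall i, (n0 <= i)%N -> `|g i| <= C * expR (- k%:R) ^+ i) -> mult k C g.
Proof.
move=> hg n b B b0 bB bL r /andP[r0 r1].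
have C0 : 0 <= C.
  have := le_trans (normr_ge0 _) (hg _ (leqnn n0)).
  by rewrite pmulr_lge0// exprn_gt0// expR_gt0.
apply: le_trans (ler_norm_sum _ _ _) _.
apply: le_trans (ler_wpM2l C0 bL); rewrite mulr_sumr; apply: ler_sum => i _.
have [hi|hi] := leqP n0 i; last by rewrite b0// !mul0r normr0 mul0r mulr0.
rewrite !normrM mulrCA -mulrA; apply: ler_wpM2l => //.
rewrite -[leRHS]mulr1; apply: ler_pM => //; first exact: hg.
by rewrite normrX exprn_ile1// ger0_norm.
Qed.

(** The engine of the bootstrap: the coefficients b_i e^(-i) satisfy at order [k] the bound which
    b_i satisfies at order [k.+1]. *)
Lemma mult_gain k C g : mult k C g -> mult k.+1 C (fun i => expR (- 1) ^+ i * g i).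
Proof.
move=> hg n b B b0 bB bL r hr.
have -> : \sum_(i < n) b i * (expR (- 1) ^+ i * g i) * r ^+ i =
    \sum_(i < n) b i * expR (- 1) ^+ i * g i * r ^+ i.
  by apply: eq_bigr => i _; rewrite mulrA.
apply: (hg n (fun i => b i * expR (- 1) ^+ i)) => //; first by move=> i /b0 ->; rewrite mul0r.
  by move=> s hs; have := mult_expR ler01 b0 bB bL hs; rewrite mul1r.
apply: le_trans bL; apply: ler_sum => i _.
rewrite normrM (ger0_norm (exprn_ge0 _ (expR_ge0 _))) -mulrA -exprMn -expRD.
by rewrite -natr1 opprD addrC.
Qed.

Lemma multX k C g j : mult k C g -> mult k (C ^+ j) (fun i => g i ^+ j).
Proof.
move=> hg; elim: j => [|j IH].
  by have := @mult_cst k 1; rewrite normr1; apply: eq_mult => i _; rewrite expr0.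
rewrite exprSr; have := multM IH hg; rewrite mulrC; apply: eq_mult => i _.
by rewrite exprSr.
Qed.

Lemma mult_sum k n (C : nat -> R) (g : nat -> nat -> R) :
  (forall j, (j < n)%N -> mult k (C j) (g j)) ->
  mult k (\sum_(j < n) C j) (fun i => \sum_(j < n) g j i).
Proof.
elim: n => [_|n IH hg].
  rewrite big_ord0; have := @mult_cst k 0; rewrite normr0; apply: eq_mult => i _.
  by rewrite big_ord0.
rewrite big_ord_recr/=; have := multD (IH (fun j hj => hg j (ltnW hj))) (hg n (ltnSn n)).
by apply: eq_mult => i _; rewrite big_ord_recr.
Qed.

End Multiplier.

(** * Iterated inverses of the Hermite operator *)

Section Ladder.
Context {R : realType}.
Implicit Types (n j k : nat) (x u : R).

(* [ladder n j] is the even solution of [a_j'' - 2 n x a_j' = a_(j-1)], [a_j 0 = 0]. *)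
Fixpoint ladder n j : R -> R :=
  if j is i.+1 then
    prim (fun u => gauss n%:R u * prim (fun t => gauss (- n%:R) t * ladder n i t) u)
  else fun=> 1.

(** This is e^(-n x^2) times the derivative of [ladder n j.+1]: the integrating factor e^(-n x^2)
    reduces the second-order equation to two successive integrations. *)
Definition ladder_inner n j : R -> R := prim (fun t => gauss (- n%:R) t * ladder n j t).

Lemma ladderS n j : ladder n j.+1 = prim (fun u => gauss n%:R u * ladder_inner n j u).
Proof. by []. Qed.

Lemma smooth_ladder n j : smooth (ladder n j).
Proof.
elim: j => [|j IH]; first exact: smooth_cst.
apply: smooth_prim; apply: smoothM; first exact: smooth_gauss.
by apply: smooth_prim; apply: smoothM => //; exact: smooth_gauss.
Qed.

Lemma smooth_inner_integrand n j : smooth (fun t => gauss (- n%:R) t * ladder n j t).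
Proof. by apply: smoothM; [exact: smooth_gauss|exact: smooth_ladder]. Qed.

Lemma smooth_ladder_inner n j : smooth (ladder_inner n j).
Proof. by apply: smooth_prim; exact: smooth_inner_integrand. Qed.

Lemma smooth_outer_integrand n j : smooth (fun u => gauss n%:R u * ladder_inner n j u).
Proof. by apply: smoothM; [exact: smooth_gauss|exact: smooth_ladder_inner]. Qed.

Lemma is_derive_ladder_inner n j x :
  is_derive x 1 (ladder_inner n j) (gauss (- n%:R) x * ladder n j x).
Proof.
exact: (@is_derive_prim _ (fun t => gauss (- n%:R) t * ladder n j t) x
  (smooth_continuous (smooth_inner_integrand n j))).
Qed.

Lemma is_derive_ladderS n j x :
  is_derive x 1 (ladder n j.+1) (gauss n%:R x * ladder_inner n j x).
Proof.
exact: (@is_derive_prim _ (fun u => gauss n%:R u * ladder_inner n j u) x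
  (smooth_continuous (smooth_outer_integrand n j))).
Qed.

Lemma gaussN (c x : R) : gauss c (- x) = gauss c x.
Proof. by rewrite /gauss sqrrN. Qed.

Lemma gaussD (c d x : R) : gauss c x * gauss d x = gauss (c + d) x.
Proof. by rewrite /gauss -expRD mulrDl. Qed.

Lemma gauss0 x : gauss 0 x = 1.
Proof. by rewrite /gauss mul0r expR0. Qed.

Lemma gauss_gt0 (c x : R) : 0 < gauss c x.
Proof. exact: expR_gt0. Qed.

Lemma gaussMn (c x : R) n : gauss (n%:R * c) x = expR (c * x ^+ 2) ^+ n.
Proof. by rewrite /gauss -expRM_natl mulrA. Qed.

Lemma ladder_even n j x : ladder n j (- x) = ladder n j x.
Proof.
elim: j x => [//|j IH] x; rewrite ladderS; apply: prim_even.
  exact: (smooth_continuous (smooth_outer_integrand n j)).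
move=> u; rewrite gaussN -mulrN; congr (_ * _); rewrite /ladder_inner; apply: prim_odd.
  exact: (smooth_continuous (smooth_inner_integrand n j)).
by move=> t; rewrite gaussN IH.
Qed.

Lemma ladder_inner0 n j : ladder_inner n j 0 = 0.
Proof. exact: prim0 (smooth_continuous (smooth_inner_integrand n j)). Qed.

Lemma ladderS0 n j : ladder n j.+1 0 = 0.
Proof. exact: prim0 (smooth_continuous (smooth_outer_integrand n j)). Qed.

(* Each integration step is a mean value estimate for r^n-weighted sums, the factor
   exp (-n (x^2 - u^2)) only moving the evaluation point r inside [0, 1]. *)
Lemma mult_ladder n0 k j x : 0 <= x <= 1 ->
  mult n0 k 1 (fun n => gauss (- n%:R) x * ladder n j x).
Proof.
elim: j x => [|j IH] x /andP[x0 x1].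
  have := mult_expR (n0 := n0) (k := k) (sqr_ge0 x); apply: eq_mult => n _ /=.
  by rewrite mulr1 -mulrN1 gaussMn mulN1r.
have inner u : 0 <= u <= 1 -> mult n0 k 1 (fun n => ladder_inner n j u).
  move=> /andP[u0 u1] N b B b0 bB bL r hr.
  have B0 : 0 <= B := le_trans (normr_ge0 _) (bB r hr).
  pose F (t : R) := \sum_(i < N) (b i * r ^+ i) * ladder_inner i j t.
  have dF (t : R) : is_derive t 1 F
      (\sum_(i < N) (b i * r ^+ i) * (gauss (- i%:R) t * ladder i j t)).
    by apply: is_derive1_sum => i; apply: is_derive1Z; exact: is_derive_ladder_inner.
  have := mvt_le (B := B) u0 dF.
  have -> : F 0 = 0 by rewrite /F big1// => i _; rewrite ladder_inner0 mulr0.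
  rewrite !subr0 => H.
  have -> : \sum_(i < N) b i * ladder_inner i j u * r ^+ i = F u.
    by apply: eq_bigr => i _; rewrite mulrAC.
  apply: le_trans (H _) _; last by rewrite mul1r ler_piMr.
  move=> t /andP[t0 tu]; have := IH t _ N b B b0 bB bL r hr.
  rewrite mul1r t0 (le_trans tu u1) => /(_ isT); congr (`|_| <= _).
  by apply: eq_bigr => i _; rewrite mulrAC.
move=> N b B b0 bB bL r /andP[r0 r1].
have B0 : 0 <= B by apply: le_trans (normr_ge0 _) (bB r _); rewrite r0.
pose F (u : R) := \sum_(i < N) (b i * r ^+ i * gauss (- i%:R) x) * ladder i j.+1 u.
have dF (u : R) : is_derive u 1 F
    (\sum_(i < N) (b i * r ^+ i * gauss (- i%:R) x) * (gauss i%:R u * ladder_inner i j u)).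
  by apply: is_derive1_sum => i; apply: is_derive1Z; exact: is_derive_ladderS.
have := mvt_le (B := B) x0 dF.
have -> : F 0 = 0 by rewrite /F big1// => i _; rewrite ladderS0 mulr0.
rewrite !subr0 => H.
have -> : \sum_(i < N) b i * (gauss (- i%:R) x * ladder i j.+1 x) * r ^+ i = F x.
  by apply: eq_bigr => i _; ring.
apply: le_trans (H _) _; last by rewrite mul1r ler_piMr.
move=> u /andP[u0 ux].
have r'P : 0 <= expR (u ^+ 2 - x ^+ 2) * r <= 1.
  rewrite mulr_ge0 ?expR_ge0//= mulr_ile1 ?expR_ge0// expR_le1 subr_le0.
  by rewrite ler_sqr// nnegrE.
have u01 : 0 <= u <= 1 by rewrite u0 (le_trans ux).
have := inner u u01 N b B b0 bB bL _ r'P; rewrite mul1r; congr (`|_| <= _).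
apply: eq_bigr => i _; rewrite exprMn /gauss -expRM_natl mulrBr expRD mulNr; ring.
Qed.

(** The multiplier estimate restricted to a single index, with evenness reducing to |x|; it is
    uniform in [j]. *)
Lemma ladder_le n j x : -1 <= x <= 1 -> `|ladder n j x| <= gauss n%:R x.
Proof.
move=> hx.
have -> : ladder n j x = ladder n j `|x|.
  by case: ger0P => // _; rewrite ladder_even.
have x01 : 0 <= `|x| <= 1 by rewrite normr_ge0 ler_norml.
have := mult_le (@mult_ladder 0 0 j _ x01) (leq0n n).
rewrite normrM (gtr0_norm (gauss_gt0 _ _)) /gauss real_normK ?num_real// mulNr expRN.
by rewrite ler_pdivrMl ?expR_gt0// mulr1.
Qed.

(** Only part of each integral is kept. The inner one over [0, eta] gives eta e^(-n eta^2), the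
    outer one over [1 - eta, 1] gives eta e^(n (1 - eta)^2), and (1 - eta)^2 - eta^2 = 1 - 2 eta. *)
Lemma ladder1_ge n (eta : R) : 0 < eta -> eta <= 1 / 2 ->
  eta ^+ 2 * expR (n%:R * (1 - 2 * eta)) <= ladder n 1 1.
Proof.
move=> e0 e1.
pose m := expR (- (n%:R * eta ^+ 2)) : R.
have m0 : 0 < m by exact: expR_gt0.
have P_mono (u v : R) : u <= v -> ladder_inner n 0 u <= ladder_inner n 0 v.
  move=> uv; apply: (derive_ge0_le uv (fun x => is_derive_ladder_inner n 0 x)) => x _.
  by rewrite mulr1 ltW// gauss_gt0.
have P_eta : eta * m <= ladder_inner n 0 eta.
  have d (x : R) : is_derive x 1 (fun u => ladder_inner n 0 u + - m * u)
      (gauss (- n%:R) x * ladder n 0 x + - m * 1).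
    exact: is_derive1D (is_derive_ladder_inner n 0 x) (is_derive1Z _ (is_derive1_id x)).
  suff : ladder_inner n 0 0 + - m * 0 <= ladder_inner n 0 eta + - m * eta.
    by rewrite ladder_inner0; lra.
  apply: (derive_ge0_le (ltW e0) d) => x /andP[x0 xe]; rewrite /= !mulr1 subr_ge0 /m /gauss ler_expR mulNr lerN2.
  by apply: ler_wpM2l => //; rewrite ler_sqr// nnegrE ltW.
have P0 (u : R) : 0 <= u -> 0 <= ladder_inner n 0 u.
  by move=> u0; rewrite -(ladder_inner0 n 0); exact: P_mono.
pose c := expR (n%:R * (1 - eta) ^+ 2) * (eta * m).
have d (x : R) : is_derive x 1 (fun u => ladder n 1 u + - c * u)
    (gauss n%:R x * ladder_inner n 0 x + - c * 1).
  exact: is_derive1D (is_derive_ladderS n 0 x) (is_derive1Z _ (is_derive1_id x)).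
have e2 : 1 - eta <= 1 by lra.
have := derive_ge0_le e2 d.
have -> : eta ^+ 2 * expR (n%:R * (1 - 2 * eta)) = c * eta.
  have -> : n%:R * (1 - 2 * eta) = n%:R * (1 - eta) ^+ 2 - n%:R * eta ^+ 2 by ring.
  by rewrite /c /m expRD; ring.
have d' (x : R) : is_derive x 1 (ladder n 1) (gauss n%:R x * ladder_inner n 0 x).
  exact: is_derive_ladderS.
have e3 : 0 <= 1 - eta by lra.
have l0 : 0 <= ladder n 1 (1 - eta).
  rewrite -(ladderS0 n 0); apply: (derive_ge0_le e3 d') => x /andP[x0 _].
  by rewrite mulr_ge0 ?P0// ltW// gauss_gt0.
move=> H; suff : ladder n 1 (1 - eta) + - c * (1 - eta) <= ladder n 1 1 + - c * 1 by lra.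
apply: H => x /andP[x1 _]; rewrite mulr1 subr_ge0; apply: ler_pM.
- exact: expR_ge0.
- by rewrite mulr_ge0// ltW.
- rewrite /gauss ler_expR; apply: ler_wpM2l => //; rewrite ler_sqr// nnegrE; lra.
- by apply: le_trans P_eta _; apply: P_mono; lra.
Qed.

(** The rate 3/4 makes rho of order e^(-3n/4); both the terms j >= 2 at x = 1 and the terms j >= 1
    on |x| <= 1/2 are then of order at most e^(-n/2). *)
Lemma ladder1_ge8 n : 1 / 64 * expR (n%:R * (3 / 4)) <= ladder n 1 (1 : R).
Proof.
have h : (0 : R) < 1 / 8 by lra.
have h2 : (1 / 8 : R) <= 1 / 2 by lra.
have := ladder1_ge n h h2; rewrite (_ : 1 - 2 * (1 / 8) = 3 / 4); last lra.
by rewrite (_ : (1 / 8) ^+ 2 = 1 / 64); last lra.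
Qed.

Lemma ladder1_gt0 n : 0 < ladder n 1 (1 : R).
Proof. by apply: (lt_le_trans _ (ladder1_ge8 n)); rewrite mulr_gt0 ?expR_gt0//; lra. Qed.

End Ladder.

(** * Perturbed ground states and the shift of the eigenvalue *)

Section Wave.
Context {R : realType}.
Implicit Types (n j k D : nat) (x u rho : R).

Definition ladder1 n j x : R := if j is i.+1 then gauss n%:R x * ladder_inner n i x else 0.

Definition ladder2 n j x : R :=
  if j is i.+1 then 2 * n%:R * x * (gauss n%:R x * ladder_inner n i x) + ladder n i x else 0.

Lemma is_derive_ladder n j x : is_derive x 1 (ladder n j) (ladder1 n j x).
Proof. by case: j => [|j]; [exact: is_derive1_cst|exact: is_derive_ladderS]. Qed.

Lemma is_derive_ladder1 n j x : is_derive x 1 (ladder1 n j) (ladder2 n j x).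
Proof.
case: j => [|j]; first exact: is_derive1_cst.
have := is_derive1M (is_derive_gauss n%:R x) (is_derive_ladder_inner n j x).
by rewrite mulrA gaussD subrr gauss0 mul1r /= mulrA.
Qed.

(** Truncation of the power series in rho of the even solution of W'' - 2 n x W' + rho W = 0 with
    W(0) = 1. The full series times e^(-n x^2/2) solves the eigenvalue equation for n + rho
    exactly. *)
Definition wave n D rho x : R := \sum_(j < D.+1) (- rho) ^+ j * ladder n j x.

Lemma smooth_wave n D rho : smooth (wave n D rho).
Proof.
by apply: smooth_sum => j; apply: smoothM; [exact: smooth_cst|exact: smooth_ladder].
Qed.

Lemma wave_even n D rho x : wave n D rho (- x) = wave n D rho x.
Proof. by apply: eq_bigr => j _; rewrite ladder_even. Qed.

(* W'' - 2 n x W' telescopes because a_j'' - 2 n x a_j' = a_(j-1). *)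
Lemma residual_wave n D rho (K x : R) :
  residual (fun x => K * (gauss (- n%:R / 2) x * wave n D rho x)) n (n%:R + rho) x =
  K * (gauss (- n%:R / 2) x * ((- rho) ^+ D.+1 * ladder n D x)).
Proof.
pose c : R := - n%:R / 2.
pose W1 t : R := \sum_(j < D.+1) (- rho) ^+ j * ladder1 n j t.
pose W2 t : R := \sum_(j < D.+1) (- rho) ^+ j * ladder2 n j t.
have dW (t : R) : is_derive t 1 (wave n D rho) (W1 t).
  by apply: is_derive1_sum => j; apply: is_derive1Z; exact: is_derive_ladder.
have dW1 (t : R) : is_derive t 1 W1 (W2 t).
  by apply: is_derive1_sum => j; apply: is_derive1Z; exact: is_derive_ladder1.
have dl (t : R) : is_derive t 1 (fun t => 2 * c * t) (2 * c * 1).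
  exact: is_derive1Z (is_derive1_id t).
have d1 (t : R) := is_derive1Z K (is_derive1M (is_derive_gauss c t) (dW t)).
have e1 : derive1 (fun t => K * (gauss c t * wave n D rho t)) =
    (fun t => K * (2 * c * t * gauss c t * wave n D rho t + gauss c t * W1 t)).
  by apply/funext => t; exact: is_derive1E (d1 t).
have d2 := is_derive1Z K (is_derive1D
  (is_derive1M (is_derive1M (dl x) (is_derive_gauss c x)) (dW x))
  (is_derive1M (is_derive_gauss c x) (dW1 x))).
rewrite /residual -/c e1 (is_derive1E d2).
have tel : W2 x = 2 * n%:R * x * W1 x - rho * (wave n D rho x - (- rho) ^+ D * ladder n D x).
  rewrite /wave big_ord_recr/= addrK /W1 /W2 !big_ord_recl /= !mulr0 !add0r.
  rewrite !mulr_sumr -sumrB; apply: eq_bigr => j _.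
  by rewrite /bump /= add1n exprS; ring.
rewrite tel [(- rho) ^+ D.+1]exprS.
have -> : n%:R = - (2 * c) :> R by rewrite /c; field.
ring.
Qed.

Lemma ladder_power_le n j x rho : 0 <= rho -> rho <= 2 / ladder n 1 1 ->
  -1 <= x <= 1 ->
  `|(- rho) ^+ j * ladder n j x| <= 128 ^+ j * expR (n%:R * (x ^+ 2 - 3 / 4 * j%:R)).
Proof.
move=> r0 hr hx.
have := @ladder1_ge8 R n.
set E := expR (n%:R * (3 / 4)) => hE; have E0 : 0 < E by exact: expR_gt0.
have A0 := @ladder1_gt0 R n.
have rE : rho <= 128 * E^-1.
  apply: le_trans hr _; rewrite ler_pdivrMr// mulrAC ler_pdivlMr//; nra.
rewrite normrM normrX normrN (ger0_norm r0).
have -> : n%:R * (x ^+ 2 - 3 / 4 * j%:R) = n%:R * x ^+ 2 + j%:R * - (n%:R * (3 / 4)) by ring.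
rewrite expRD [expR (j%:R * _)]expRM_natl expRN -/E mulrCA -exprMn [leRHS]mulrC.
apply: ler_pM => //; first exact: exprn_ge0.
  by rewrite lerXn2r// nnegrE// mulr_ge0// invr_ge0 ltW.
exact: ladder_le.
Qed.

Lemma smooth_exprn k (f : R -> R) : smooth f -> smooth (fun x => f x ^+ k).
Proof.
move=> sf; elim: k => [|k IH]; first exact: smooth_cst.
have := smoothM sf IH; congr smooth; apply/funext => x; by rewrite exprS.
Qed.

(** Intermediate values in rho at x = 1: the value is 1 at rho = 0, and at rho = 2 / a_1(1) the
    first two terms give 1 - 2 while the others are exponentially small. On |x| <= 1/2 everything
    but the constant 1 is small, whence the lower bound. *)
Lemma exists_root D : (0 < D)%N -> exists n0, forall n, (n0 <= n)%N ->
  exists rho, [/\ 0 <= rho, rho <= 2 / ladder n 1 1, wave n D rho 1 = 0 &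
    forall x, `|x| <= 1 / 2 -> 1 / 2 <= wave n D rho x].
Proof.
case: D => // d _.
pose K : R := \sum_(j < d.+1) 128 ^+ j.+1.
have K0 : 0 <= K by apply: sumr_ge0 => j _; exact: exprn_ge0.
exists (Num.bound (4 * K)) => n hn.
have nK : 4 * K <= n%:R.
  have K4 : 0 <= 4 * K by rewrite mulr_ge0.
  by apply: ltW; apply: lt_le_trans (archi_boundP K4) _; rewrite ler_nat.
pose E := expR (n%:R / 2) : R; have E0 : 0 < E by exact: expR_gt0.
have KE : K / E <= 1 / 2.
  rewrite ler_pdivrMr//; have := expR_ge1Dx (n%:R / 2 : R); rewrite -/E; lra.
have A0 := @ladder1_gt0 R n.
have small rho x j : 0 <= rho -> rho <= 2 / ladder n 1 1 -> -1 <= x <= 1 ->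
    x ^+ 2 - 3 / 4 * j%:R <= - (1 / 2) ->
    `|(- rho) ^+ j * ladder n j x| <= 128 ^+ j / E.
  move=> r0 r1 hx hj; apply: le_trans (ladder_power_le j r0 r1 hx) _.
  apply: ler_wpM2l; first exact: exprn_ge0.
  rewrite /E -expRN ler_expR; have := ler0n R n; nra.
pose rmax : R := 2 / ladder n 1 1.
have rmax0 : 0 <= rmax by rewrite divr_ge0// ltW.
have cf : continuous (fun rho : R => wave n d.+1 rho 1).
  apply: smooth_continuous; apply: smooth_sum => j; apply: smoothM; last exact: smooth_cst.
  by apply: smooth_exprn; apply: smoothN; exact: smooth_id.
have f0 : wave n d.+1 0 1 = 1.
  rewrite /wave big_ord_recl big1; first by rewrite expr0 mul1r addr0.
  by move=> j _; rewrite oppr0 expr0n mul0r.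
have f1 : wave n d.+1 rmax 1 <= 0.
  rewrite /wave big_ord_recl big_ord_recl [X in X + _]mul1r [X in _ + (X + _)]mulNr.
  have -> : rmax ^+ 1 * ladder n 1 1 = 2 by rewrite expr1 /rmax divfK// gt_eqF.
  set s := \sum_(j < d) _.
  suff : `|s| <= K / E by rewrite ler_norml => /andP[_]; move: KE => /= ; lra.
  rewrite /K mulr_suml; apply: le_trans (ler_norm_sum _ _ _) _.
  rewrite [leRHS]big_ord_recl; rewrite -[leLHS]add0r; apply: lerD.
    by rewrite divr_ge0// ltW.
  apply: ler_sum => j _; apply: small => //; first by rewrite lexx; lra.
  have -> : (lift ord0 (lift ord0 j))%:R = j%:R + 2 :> R by rewrite -natrD addn2.
  by rewrite expr1n; have := ler0n R j; lra.
have [|rho hr f_rho] := IVT rmax0 (continuous_subspaceT cf) (v := 0).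
  by rewrite ge_min le_max f0 f1 ler01 orbT.
move: hr; rewrite in_itv/= => /andP[r0 r1]; exists rho; split => // x hx.
have x1 : -1 <= x <= 1 by move: hx; rewrite ler_norml; lra.
have x2 : x ^+ 2 <= 1 / 4.
  rewrite -(real_normK (num_real x)); have := normr_ge0 x; nra.
rewrite /wave big_ord_recl [X in X + _]mul1r.
set s := \sum_(j < _) _.
suff : `|s| <= K / E by rewrite ler_norml => /andP[+ _]; move: KE => /=; lra.
rewrite /K mulr_suml; apply: le_trans (ler_norm_sum _ _ _) _.
apply: ler_sum => j _; apply: small => //.
have -> : (lift ord0 j)%:R = j%:R + 1 :> R by rewrite natr1.
by have := ler0n R j; lra.
Qed.

End Wave.

(** * The root as a multiplier *)

Section Root.
Context {R : realType} (n0 d : nat) (rho : nat -> R).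
Context (rho_ge0 : forall n, (n0 <= n)%N -> 0 <= rho n).
Context (rho_le : forall n, (n0 <= n)%N -> rho n <= 2 / ladder n 1 1).
Context (rho_root : forall n, (n0 <= n)%N -> wave n d.+1 (rho n) 1 = 0).

(** [ratio] and [tau] are a_1(1) and rho_n scaled by e^(-n) and e^n. Their product a_1(1) rho_n is
    at most 2, and [ratio] is a multiplier, whereas [tau] alone is not known to be one. *)
Definition ratio n : R := gauss (- n%:R) 1 * ladder n 1 1.
Definition tau n : R := gauss n%:R 1 * rho n.

Lemma ratio_gt0 n : 0 < ratio n.
Proof. by rewrite mulr_gt0 ?gauss_gt0// ladder1_gt0. Qed.

Lemma gauss1 (c : R) : gauss c 1 = expR c.
Proof. by rewrite /gauss expr1n mulr1. Qed.

Lemma gaussNn n : gauss (- n%:R) 1 = expR (- 1) ^+ n :> R.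
Proof. by rewrite gauss1 -expRM_natl mulrN1. Qed.

Lemma mult_ratio k : mult n0 k 1 ratio.
Proof. by apply: mult_ladder; rewrite ler01 lexx. Qed.

Lemma ratio_le1 n : ratio n <= 1.
Proof.
have h : -1 <= (1 : R) <= 1 by rewrite lexx andbT; lra.
apply: le_trans (ler_norm _) _; rewrite normrM gtr0_norm ?gauss_gt0//.
apply: le_trans (ler_wpM2l (ltW (gauss_gt0 _ _)) (ladder_le n 1 h)) _.
by rewrite gaussD addNr gauss0.
Qed.

Lemma tauE n : rho n = expR (- 1) ^+ n * tau n.
Proof. by rewrite /tau -gaussNn mulrA gaussD addNr gauss0 mul1r. Qed.

Lemma ratio_tauE n : ratio n * tau n = ladder n 1 1 * rho n.
Proof. by rewrite /ratio /tau mulrACA gaussD addNr gauss0 mul1r. Qed.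

Lemma tau_ge0 n : (n0 <= n)%N -> 0 <= tau n.
Proof. by move=> hn; exact: mulr_ge0 (ltW (gauss_gt0 _ _)) (rho_ge0 hn). Qed.

Lemma ratio_tau_le n : (n0 <= n)%N -> ratio n * tau n <= 2.
Proof.
by move=> hn; rewrite ratio_tauE mulrC -ler_pdivlMr ?ladder1_gt0// rho_le.
Qed.

Definition good k (g : nat -> R) := exists C, mult n0 k C g.

Lemma goodM k g h : good k g -> good k h -> good k (fun n => g n * h n).
Proof. by move=> [C hC] [C' hC']; exists (C' * C); exact: multM. Qed.

Lemma goodX k g j : good k g -> good k (fun n => g n ^+ j).
Proof. by move=> [C hC]; exists (C ^+ j); exact: multX. Qed.

Lemma good_sum k m (g : nat -> nat -> R) : (forall j, (j < m)%N -> good k (g j)) ->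
  good k (fun n => \sum_(j < m) g j n).
Proof.
elim: m => [_|m IH hg].
  exists `|0 : R|; have := @mult_cst R n0 k 0; apply: eq_mult => i _; by rewrite big_ord0.
have [C hC] := IH (fun j hj => hg j (ltnW hj)); have [C' hC'] := hg m (ltnSn m).
by exists (C + C'); apply: eq_mult (multD hC hC') => i _; rewrite big_ord_recr.
Qed.

(** The terms of degree 0 and 1 are separated from the rest. In degree j + 2 the powers of rho_n
    contribute e^(-n (j + 2)), of which the rescaling of a_(j+2) consumes e^n: one factor e^(-n) is
    left in front of the whole sum. *)
Lemma root_eq n : (n0 <= n)%N -> ratio n * tau n =
  1 + expR (- 1) ^+ n * \sum_(j < d) (-1) ^+ j * (expR (- j%:R) ^+ n *
    (tau n ^+ j.+2 * (gauss (- n%:R) 1 * ladder n j.+2 1))).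
Proof.
move=> hn; have := rho_root hn.
rewrite /wave big_ord_recl big_ord_recl [X in X + _]mul1r => /eqP; rewrite addrCA addr_eq0 => /eqP e.
apply: oppr_inj; rewrite ratio_tauE.
have -> : - (ladder n 1 1 * rho n) = (- rho n) ^+ lift ord0 (@ord0 d) * ladder n (lift ord0 (@ord0 d)) 1.
  by rewrite /= expr1 mulNr mulrC.
rewrite e; congr (- (_ + _)); rewrite mulr_sumr; apply: eq_bigr => j _.
have -> : (lift ord0 (lift ord0 j) : nat) = j.+2 by [].
have -> : (- rho n) ^+ j.+2 = (-1) ^+ j * rho n ^+ j.+2.
  by rewrite [LHS]exprNn; congr (_ * _); rewrite -addn2 exprD sqrrN expr1n mulr1.
set L := gauss (- n%:R) 1 * ladder n j.+2 1.
have -> : ladder n j.+2 1 = gauss n%:R 1 * L by rewrite mulrA gaussD subrr gauss0 mul1r.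
have -> : rho n ^+ j.+2 = expR (- 1) ^+ n * (expR (- 1) ^+ n * expR (- j%:R) ^+ n) * tau n ^+ j.+2.
  have -> : expR (- j%:R) ^+ n = (expR (- 1) ^+ n) ^+ j :> R.
    by rewrite -mulrN1 expRM_natl exprAC.
  by rewrite tauE exprMn !exprS.
have : gauss n%:R 1 * expR (- 1) ^+ n = 1 :> R by rewrite -gaussNn gaussD subrr gauss0.
set g := gauss n%:R 1; set E := expR (- 1) ^+ n => gE.
rewrite [RHS](_ : _ = (g * E) * (E * ((-1) ^+ j * (expR (- j%:R) ^+ n * (tau n ^+ j.+2 * L))))).
  by ring.
by rewrite gE mul1r.
Qed.

(** Bootstrap on the order k. Boundedness of ratio * tau is the case k = 0. If ratio^N tau is a
    multiplier at order k, the sum in the root equation, multiplied by a power of [ratio], is built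
    from multipliers, and the factor e^(-n) in front raises the order by one. Powers of [ratio]
    accumulate because they cannot be divided out. *)
Lemma good_tau k : exists N, good k (fun n => ratio n ^+ N * tau n).
Proof.
elim: k => [|k [N hN]].
  exists 1; exists 2; apply: mult_small => n hn; rewrite expr1 oppr0 expR0 expr1n mulr1.
  rewrite ger0_norm; first exact: ratio_tau_le.
  exact: mulr_ge0 (ltW (ratio_gt0 n)) (tau_ge0 hn).
(* The highest power of [tau] in the sum is d + 1, and each one takes [N] factors [ratio]; the extra
   factor comes from the left side of the root equation. *)
pose M := (N * d.+1)%N; exists M.+1.
pose H j n := (-1) ^+ j * (expR (- j%:R) ^+ n *
    (ratio n ^+ (M - N * j.+2) * ((ratio n ^+ N * tau n) ^+ j.+2 *
     (gauss (- n%:R) 1 * ladder n j.+2 1)))).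
pose G n := \sum_(j < d) H j n.
have hG : good k.+1 (fun n => expR (- 1) ^+ n * G n).
  suff [C hC] : good k G by exists C; exact: mult_gain.
  apply: (good_sum (g := H)) => j hj; apply: goodM; first by exists `|(-1) ^+ j : R|; exact: mult_cst.
  apply: goodM; first by exists 1; apply: mult_expR.
  apply: goodM; first by apply: goodX; exists 1; exact: mult_ratio.
  apply: goodM; first exact: goodX.
  by exists 1; apply: mult_ladder; rewrite ler01 lexx.
have [C hC] := hG.
exists (1 ^+ M + C); have := multD (multX M (@mult_ratio k.+1)) hC; apply: eq_mult => n hn.
rewrite exprSr -mulrA root_eq// mulrDr mulr1; congr (_ + _).
rewrite mulrCA; congr (_ * _); rewrite mulr_sumr; apply: eq_bigr => j _.
rewrite [RHS]mulrCA; congr (_ * _); rewrite [RHS]mulrCA; congr (_ * _).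
rewrite [(_ * tau n) ^+ _]exprMn -exprM !mulrA -exprD subnK// /M leq_mul2l; apply/orP; right.
by case: j => j /= hj; rewrite ltnS.
Qed.

End Root.

(** * Multiplier bounds uniform in time and space *)

Section Uniform.
Context {R : realType}.

Lemma is_derive1_exprn (x : R) j : is_derive x 1 (fun t => t ^+ j.+1) (j.+1%:R * x ^+ j).
Proof.
elim: j => [|j IH]; first by rewrite expr0 mulr1; exact: is_derive1_id.
have := is_derive1M (is_derive1_id x) IH.
under [X in is_derive _ _ X _]eq_fun do rewrite -exprS.
by congr is_derive; rewrite -[in RHS]natr1 exprS; ring.
Qed.

(** Integrating the estimate of order k from 0 to u gives order k + 1; the coefficients need not be
    identified. *)
Lemma expRN_taylor k : exists c : nat -> R, forall u, 0 <= u ->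
  `|expR (- u) - \sum_(i < k) c i * u ^+ i| <= u ^+ k.
Proof.
elim: k => [|k [c hc]].
  exists (fun=> 0) => u u0; rewrite big_ord0 subr0 ger0_norm ?expR_ge0// expr0.
  by rewrite expR_le1 oppr_le0.
exists (fun i => if i is j.+1 then - c j / j.+1%:R else 1) => u u0.
pose F (t : R) := expR (- t) - (1 + \sum_(i < k) (- c i / i.+1%:R) * t ^+ i.+1).
have dF (t : R) : is_derive t 1 F
    (expR (- t) * -1 - (0 + \sum_(i < k) (- c i / i.+1%:R) * (i.+1%:R * t ^+ i))).
  have hE := is_derive1_comp (is_derive1N (is_derive1_id t)) (is_derive_expR (- t)).
  have hS : is_derive t 1 (fun t => \sum_(i < k) (- c i / i.+1%:R) * t ^+ i.+1)
      (\sum_(i < k) (- c i / i.+1%:R) * (i.+1%:R * t ^+ i)).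
    by apply: is_derive1_sum => i; exact: is_derive1Z (is_derive1_exprn t i).
  exact: is_derive1D hE (is_derive1N (is_derive1D (is_derive1_cst 1 t) hS)).
have := mvt_le (B := u ^+ k) u0 dF.
have -> : F 0 = 0.
  rewrite /F oppr0 expR0 big1 ?addr0 ?subrr// => i _.
  by rewrite expr0n mulr0.
rewrite !subr0 -exprSr => H.
rewrite big_ord_recl /= mul1r; apply: H => t /andP[t0 tu].
have := hc t t0; rewrite -normrN => h.
apply: le_trans (le_trans _ h) _; last by rewrite lerXn2r// nnegrE (le_trans t0).
rewrite le_eqVlt; apply/orP; left; apply/eqP; congr `|_|.
rewrite mulrN1 add0r [LHS]addrC opprB; congr (_ + _).
rewrite -sumrN; apply: eq_bigr => i _.
by rewrite mulrA divfK ?pnatr_eq0// mulNr opprK.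
Qed.

Context (n0 d : nat) (rho : nat -> R).
Context (rho_ge0 : forall n, (n0 <= n)%N -> 0 <= rho n).
Context (rho_le : forall n, (n0 <= n)%N -> rho n <= 2 / ladder n 1 1).
Context (rho_root : forall n, (n0 <= n)%N -> wave n d.+1 (rho n) 1 = 0).
Local Notation ratio := (@ratio R).
Local Notation tau := (tau rho).

Lemma ratio_rho_le n : (n0 <= n)%N -> 0 <= ratio n * rho n <= 2 * expR (- 1) ^+ n.
Proof.
move=> hn; rewrite mulr_ge0 ?rho_ge0 ?(ltW (@ratio_gt0 R n))//=.
have -> : ratio n * rho n = ratio n * tau n * expR (- 1) ^+ n by rewrite (tauE rho) mulrCA mulrC.
apply: ler_wpM2r; first by rewrite exprn_ge0// expR_ge0.
exact: ratio_tau_le rho_le _ hn.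
Qed.

Lemma ratioX_le n i j : (i <= j)%N -> ratio n ^+ j <= ratio n ^+ i.
Proof.
move=> ij; rewrite -(subnK ij) exprD; apply: ler_piMl.
  by rewrite exprn_ge0// (ltW (@ratio_gt0 R _)).
by rewrite exprn_ile1 ?ratio_le1// (ltW (@ratio_gt0 R _)).
Qed.

Lemma mult_ratioX k j : mult n0 k 1 (fun n => ratio n ^+ j).
Proof. by have := multX j (@mult_ratio R n0 k); rewrite expr1n. Qed.

(** Taylor expansion in rho_n s. The powers below k are multipliers once enough factors [ratio]
    accompany them; the remainder is at most (ratio rho s)^k = O(e^(-nk)), hence a multiplier by
    smallness. The constants depend on [T] but not on [s]. *)
Lemma mult_exp_rho k (T : R) : 0 <= T -> exists N C, forall N' (s : R), (N <= N')%N -> 0 <= s <= T ->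
  mult n0 k C (fun n => ratio n ^+ N' * expR (- (rho n * s))).
Proof.
move=> T0; have [N1 [C1 hC1]] := good_tau rho_ge0 rho_le rho_root k.
have C10 : 0 <= C1 := le_trans (normr_ge0 _) (mult_le hC1 (leqnn _)).
have [c hc] := expRN_taylor k.
exists (N1 * k + k)%N; exists (\sum_(i < k) (`|c i| * T ^+ i * C1 ^+ i) + (2 * T) ^+ k).
move=> N' s hN /andP[s0 sT].
pose g i n := (c i * s ^+ i) * (ratio n ^+ (N' - N1 * i) *
   ((ratio n ^+ N1 * tau n) ^+ i * expR (- i%:R) ^+ n)).
have hg i : (i < k)%N -> mult n0 k (`|c i| * T ^+ i * C1 ^+ i) (g i).
  move=> ik.
  have := multM (@mult_cst R n0 k (c i * s ^+ i)) (multM (@mult_ratioX k (N' - N1 * i))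
    (multM (multX i hC1) (@mult_expR R n0 k i%:R (ler0n _ _)))).
  rewrite !mul1r mulr1; apply: mult_weaken.
  rewrite mulrC normrM; apply: ler_wpM2r; first exact: exprn_ge0.
  apply: ler_wpM2l => //; rewrite ger0_norm ?exprn_ge0// lerXn2r// nnegrE.
pose err n := ratio n ^+ N' * (expR (- (rho n * s)) - \sum_(i < k) c i * (rho n * s) ^+ i).
have herr : mult n0 k ((2 * T) ^+ k) err.
  apply: mult_small => n hn.
  have q0 := ltW (@ratio_gt0 R n); have r0 := rho_ge0 hn.
  rewrite /err normrM (ger0_norm (exprn_ge0 _ q0)).
  apply: (@le_trans _ _ (ratio n ^+ k * (rho n * s) ^+ k)).
    apply: ler_pM => //; first exact: exprn_ge0.
      by apply: ratioX_le; apply: leq_trans hN; exact: leq_addl.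
    by apply: hc; rewrite mulr_ge0.
  have -> : expR (- k%:R) ^+ n = (expR (- 1) ^+ n) ^+ k :> R.
    by rewrite -mulrN1 expRM_natl exprAC.
  have /andP[h1 h2] := ratio_rho_le hn.
  rewrite -!exprMn; apply: lerXn2r; rewrite ?nnegrE.
  - by apply: mulr_ge0 => //; exact: mulr_ge0.
  - by apply: mulr_ge0; [exact: mulr_ge0|exact: exprn_ge0 (expR_ge0 _)].
  by rewrite mulrA [leRHS]mulrAC; apply: ler_pM.
have hs := @mult_sum R n0 k k (fun i => `|c i| * T ^+ i * C1 ^+ i) g hg.
have := multD hs herr; apply: eq_mult => n hn.
rewrite /err mulrBr addrC -[RHS]subr0 -addrA; congr (_ + _); rewrite oppr0.
rewrite addrC; apply/eqP; rewrite subr_eq0; apply/eqP; rewrite mulr_sumr; apply: eq_bigr => i _.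
have hi : (N1 * i <= N')%N.
  by apply: leq_trans hN; apply: leq_trans (leq_addr _ _); rewrite leq_mul2l ltnW ?orbT.
rewrite /g [(_ * tau n) ^+ _]exprMn -exprM.
have -> : expR (- i%:R) ^+ n = (expR (- 1) ^+ n) ^+ i :> R.
  by rewrite -mulrN1 expRM_natl exprAC.
rewrite -{2}(subnK hi) exprD (tauE rho) !exprMn; ring.
Qed.

(** For j >= 1, e^(-n x^2/2) rho^j a_j(x) factors as tau^j times e^(-n (j - x^2/2)) times e^(-n x^2)
    a_j(x). The middle exponent has the right sign since x^2 <= 1, and each factor is a multiplier
    after [ratio] powers are added. *)
Lemma mult_wave k : exists N C, forall N' (x : R), (N <= N')%N -> 0 <= x <= 1 ->
  mult n0 k C (fun n => ratio n ^+ N' * (gauss (- n%:R / 2) x * wave n d.+1 (rho n) x)).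
Proof.
have [N1 [C1 hC1]] := good_tau rho_ge0 rho_le rho_root k.
exists (N1 * d.+1)%N; exists (1 + \sum_(j < d.+1) C1 ^+ j.+1) => N' x hN /andP[x0 x1].
have x2 : x ^+ 2 <= 1 by rewrite expr_le1.
pose g j n := (-1) ^+ j.+1 * (ratio n ^+ (N' - N1 * j.+1) * ((ratio n ^+ N1 * tau n) ^+ j.+1 *
  (expR (- (j.+1%:R - x ^+ 2 / 2)) ^+ n * (gauss (- n%:R) x * ladder n j.+1 x)))).
have hx : 0 <= x <= 1 by rewrite x0.
have hg j : (j < d.+1)%N -> mult n0 k (C1 ^+ j.+1) (g j).
  move=> jd; have e0 : 0 <= j.+1%:R - x ^+ 2 / 2.
    by rewrite -natr1; have := ler0n R j; lra.
  have := multM (@mult_cst R n0 k ((-1) ^+ j.+1)) (multM (@mult_ratioX k (N' - N1 * j.+1))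
    (multM (multX j.+1 hC1) (multM (@mult_expR R n0 k _ e0) (@mult_ladder R n0 k j.+1 x hx)))).
  by rewrite !mul1r !mulr1 normrX normrN1 expr1n mulr1.
have h0 : mult n0 k 1 (fun n => ratio n ^+ N' * gauss (- n%:R / 2) x).
  have x20 : 0 <= x ^+ 2 / 2 by rewrite divr_ge0// sqr_ge0.
  have := multM (@mult_ratioX k N') (@mult_expR R n0 k _ x20); rewrite mulr1.
  apply: eq_mult => n _; congr (_ * _); rewrite /gauss -expRM_natl; congr expR; ring.
have hs := @mult_sum R n0 k d.+1 (fun j => C1 ^+ j.+1) g hg.
have := multD h0 hs; apply: eq_mult => n hn.
rewrite /wave [in RHS]big_ord_recl mul1r mulrA [RHS]mulrDr mulr1; congr (_ + _).
rewrite mulr_sumr; apply: eq_bigr => j _.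
have hj : (N1 * j.+1 <= N')%N by apply: leq_trans hN; rewrite leq_mul2l ltn_ord orbT.
rewrite /g [(_ * tau n) ^+ _]exprMn -exprM -[in RHS](subnK hj) [in RHS]exprD.
have -> : (lift ord0 j : nat) = j.+1 by [].
rewrite [(- rho n) ^+ _]exprNn (tauE rho) !exprMn.
have -> : gauss (- n%:R / 2) x = (expR (- (j.+1%:R - x ^+ 2 / 2)) ^+ n * gauss (- n%:R) x) / (expR (- 1) ^+ n) ^+ j.+1.
  rewrite /gauss -exprM -!expRM_natl -expRD -expRN -expRD; congr expR.
  by rewrite natrM; field.
have ne : (expR (- 1) ^+ n) ^+ j.+1 != 0 :> R by rewrite !expf_neq0// gt_eqF// expR_gt0.
by field.
Qed.

End Uniform.

(** * Non-controllability when a strip is avoided *)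

Section Strip.
Context {R : realType}.
Local Notation T2 := (measurableTypeR R * measurableTypeR R)%type.

(** At every height met by [omega] the sine polynomial is bounded for all r in [0, 1], not only for
    small r. This is exactly what the multiplier property takes as input, with coefficients a_i
    sin(i y). *)
Lemma not_null_controllable_strip (omega : set (R * R)) (y0 e T : R) :
  measurable (omega : set T2) -> omega `<=` Omega R -> 0 < y0 < pi -> 0 < e -> 0 < T ->
  (forall x y, omega (x, y) -> e <= `|y - y0|) ->
  ~ null_controllable omega T.
Proof.
move=> mw wO hy0 e0 T0 hw.
have [d kT] : exists d, T + 1 < d.+1%:R.
  have T2' : 0 <= T + 2 by lra.
  by exists (Num.bound (T + 2)); have := archi_boundP T2'; rewrite -natr1; lra.
pose k := d.+1.
have [n1 hn1] := @exists_root R d.+1 (ltn0Sn d).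
pose n0 := n1.+1.
have /choice[rho hrho] : forall n, exists rho : R, (n0 <= n)%N ->
    [/\ 0 <= rho, rho <= 2 / ladder n 1 1, wave n d.+1 rho 1 = 0 &
    forall x, `|x| <= 1 / 2 -> 1 / 2 <= wave n d.+1 rho x].
  move=> n; have [hn|hn] := leqP n0 n; last by exists 0.
  by have [r hr] := hn1 n (ltnW hn); exists r.
have rho_ge0 n : (n0 <= n)%N -> 0 <= rho n by move=> /hrho[].
have rho_le n : (n0 <= n)%N -> rho n <= 2 / ladder n 1 1 by move=> /hrho[].
have rho_root n : (n0 <= n)%N -> wave n d.+1 (rho n) 1 = 0 by move=> /hrho[].
have [N1 [C1 hC1]] := mult_exp_rho rho_ge0 rho_le rho_root k (ltW T0).
have [N2 [C2 hC2]] := mult_wave rho_ge0 rho_le rho_root k.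
(* Half of the power [P] of [ratio] is spent on e^(-rho s), the other half on the wave; [d.+2]
   factors accompany rho^(d+2) in the residual. *)
pose M := (N1 + N2 + d.+2)%N; pose P := (M + M)%N.
(* The power [ratio n ^+ P] then costs at most e^(-n/4) up to a constant. With e^(-n/8) from the
   Gaussian on |x| <= 1/2 this stays above e^(-n/2), the decay permitted by S - T = 1. *)
pose eta : R := (8 * P%:R)^-1.
have P1 : 1 <= P%:R :> R by rewrite ler1n /P /M !addnS.
have eta0 : 0 < eta by rewrite invr_gt0; lra.
have eta8 : eta <= 1 / 2.
  by rewrite /eta -[leRHS]invrK lef_pV2 ?posrE; lra.
have etaP : eta * P%:R = 1 / 8 by rewrite /eta; field; lra.
pose c := (eta ^+ 2) ^+ P / 2.
have c0 : 0 < c by rewrite divr_gt0// !exprn_gt0.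
(* In order: the bound on rho_n, the residual, the lower bound on [Phi], and the observed sum. *)
pose C := 128 + 2 ^+ d.+2 + c^-1 + `|C2 * C1|.
have ci0 : 0 < c^-1 by rewrite invr_gt0.
have p0 : 0 < 2 ^+ d.+2 :> R by rewrite exprn_gt0.
have C12 := normr_ge0 (C2 * C1).
have C0 : 0 < C by rewrite /C; lra.
pose K n : R := ratio n ^+ P.
have q0 n : 0 <= ratio n :> R by rewrite ltW// ratio_gt0.
pose Phi n (x : R) := K n * (gauss (- n%:R / 2) x * wave n d.+1 (rho n) x).
have gauss_even (a x : R) : gauss a `|x| = gauss a x by rewrite /gauss real_normK ?num_real.
have Phi_even n x : Phi n `|x| = Phi n x.
  by rewrite /Phi gauss_even; case: ger0P => // _; rewrite wave_even.
have S12 : T + 1 < T + 2 by lra.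
have TT1 : T < T + 1 by lra.
apply: (not_null_controllable_family (S := T + 1) (S' := T + 2) (J := k%:R) (C := C) (eta := 1 / 2)
  (n0 := n0) (m := fun n => n%:R + rho n) (Phi := Phi) mw wO hy0 e0) => //.
- by apply/andP; split; lra.
- move=> n; apply: smoothM; first exact: smooth_cst.
  by apply: smoothM; [exact: smooth_gauss|exact: smooth_wave].
- move=> n hn; have P10 : Phi n 1 = 0 by rewrite /Phi rho_root// !mulr0.
  by split=> //; rewrite -Phi_even normrN1.
- move=> n hn; rewrite addr_ge0 ?rho_ge0//= lerD2l.
  apply: le_trans (rho_le n hn) _; rewrite ler_pdivrMr ?ladder1_gt0//.
  have E1 : 1 <= expR (n%:R * (3 / 4)) :> R.
    by rewrite -[leLHS]expR0 ler_expR mulr_ge0//; lra.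
  have hE := @ladder1_ge8 R n.
  have L64 : 1 / 64 <= ladder n 1 (1 : R) by lra.
  have C128 : 128 <= C by rewrite /C; lra.
  nra.
- move=> n x hn hx; rewrite residual_wave.
  have E0 : 0 <= expR (- 1) ^+ n :> R by rewrite exprn_ge0// expR_ge0.
  have /andP[h1 h2] := ratio_rho_le rho_ge0 rho_le hn.
  rewrite normrM (ger0_norm (exprn_ge0 P (q0 n) : 0 <= K n)) normrM (gtr0_norm (gauss_gt0 _ _)).
  rewrite normrM normrX normrN (ger0_norm (rho_ge0 n hn)).
  have -> : expR (- k%:R) ^+ n = (expR (- 1) ^+ n) ^+ k :> R.
    by rewrite -mulrN1 expRM_natl exprAC.
  apply: (@le_trans _ _ (ratio n ^+ d.+2 * (gauss (- n%:R / 2) x * (rho n ^+ d.+2 * gauss n%:R x)))).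
    apply: ler_pM.
    - exact: exprn_ge0.
    - apply: mulr_ge0; first exact: ltW (gauss_gt0 _ _).
      by apply: mulr_ge0 => //; exact: exprn_ge0 (rho_ge0 n hn).
    - by apply: ratioX_le; apply: leq_trans (leq_addl M M); exact: leq_addl.
    - apply: ler_wpM2l; first exact: ltW (gauss_gt0 _ _).
      by apply: ler_wpM2l; [rewrite exprn_ge0 ?rho_ge0|exact: ladder_le].
  have -> : ratio n ^+ d.+2 * (gauss (- n%:R / 2) x * (rho n ^+ d.+2 * gauss n%:R x)) =
      (ratio n * rho n) ^+ d.+2 * gauss (n%:R / 2) x.
    rewrite [(_ * rho n) ^+ _]exprMn; have -> : gauss (n%:R / 2) x = gauss (- n%:R / 2) x * gauss n%:R x.
      by rewrite gaussD (_ : - n%:R / 2 + n%:R = n%:R / 2) //; lra.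
    set u := ratio n ^+ _; set v := rho n ^+ _; ring.
  apply: (@le_trans _ _ ((2 * expR (- 1) ^+ n) ^+ d.+2 * expR (n%:R / 2))).
    apply: ler_pM; rewrite ?exprn_ge0 ?(ltW (gauss_gt0 _ _))//.
      by rewrite lerXn2r// nnegrE mulr_ge0.
    rewrite /gauss ler_expR; apply: ler_piMr; first by rewrite divr_ge0.
    by rewrite -(real_normK (num_real x)) expr_le1// ler_norml.
  have hC : 2 ^+ d.+2 <= C by rewrite /C; lra.
  have X0 : 0 <= (expR (- 1) ^+ n) ^+ d.+2 * expR (n%:R / 2) :> R.
    by apply: mulr_ge0; [exact: exprn_ge0|exact: expR_ge0].
  rewrite exprMn -mulrA; apply: ler_pM => //.
  (* One more factor e^(-n) than the [d.+1] required is available, and it absorbs the growth e^(n/2)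
     of the Gaussian. *)
  rewrite [(expR (- 1) ^+ n) ^+ d.+2]exprSr -mulrA; apply: ler_piMr; first exact: exprn_ge0.
  rewrite -expRM_natl -expRD expR_le1; have := ler0n R n; lra.
- move=> n x hn hx.
  have [_ _ _ hpos] := hrho n hn.
  have hx2 : x ^+ 2 <= 1 / 4.
    rewrite -(real_normK (num_real x)); have := normr_ge0 x; nra.
  have rat : eta ^+ 2 * expR (- (n%:R * (2 * eta))) <= ratio n.
    rewrite /ratio gauss1; have := ler_wpM2l (expR_ge0 (- n%:R)) (ladder1_ge n eta0 eta8).
    by rewrite mulrCA -expRD; congr (_ * expR _ <= _); ring.
  have ratP : (eta ^+ 2) ^+ P * expR (- (n%:R / 4)) <= K n.
    have -> : expR (- (n%:R / 4)) = expR (- (n%:R * (2 * eta))) ^+ P :> R.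
      by rewrite -expRM_natl; congr expR; rewrite mulrN mulrCA [P%:R * _](_ : _ = 1 / 4); [field|lra].
    have h0 : 0 <= eta ^+ 2 * expR (- (n%:R * (2 * eta))).
      by apply: mulr_ge0; [exact: exprn_ge0 (ltW eta0)|exact: expR_ge0].
    by rewrite -exprMn; apply: lerXn2r => //; rewrite nnegrE ?(q0 n).
  apply: (@le_trans _ _ ((eta ^+ 2) ^+ P * expR (- (n%:R / 4)) * (expR (- (n%:R / 8)) * (1 / 2)))).
    have -> : (eta ^+ 2) ^+ P * expR (- (n%:R / 4)) * (expR (- (n%:R / 8)) * (1 / 2)) =
        c * expR (- (n%:R / 4) - n%:R / 8).
      by rewrite expRD /c; ring.
    apply: ler_pM; rewrite ?exprn_ge0 ?expR_ge0 ?invr_ge0 ?(ltW C0)//.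
      by rewrite -[leRHS]invrK lef_pV2 ?posrE// /C; lra.
    rewrite -expRM_natl ler_expR; have := ler0n R n; nra.
  apply: ler_pM => //; rewrite ?mulr_ge0 ?expR_ge0 ?exprn_ge0 ?(ltW eta0)//.
  apply: ler_pM; rewrite ?expR_ge0//.
    rewrite /gauss ler_expR; have := ler0n R n; nra.
  exact: hpos.
move=> N a a0 hb lb s x y hs wxy.
have [/= /andP[x1 x2] /andP[y1 y2]] := wO _ wxy.
have ey := hw _ _ wxy.
have x01 : 0 <= `|x| <= 1 by rewrite normr_ge0 ler_norml !ltW.
have hN1 : (N1 <= M)%N by rewrite /M -addnA leq_addr.
have hN2 : (N2 <= M)%N by rewrite /M addnAC leq_addl.
have /andP[s0 _] := hs.
have hm := multM (@mult_expR R n0 k s s0) (multM (hC1 M s hN1 hs) (hC2 M `|x| hN2 x01)).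
have one : 0 <= (1 : R) <= 1 by rewrite ler01 lexx.
have := hm N (fun i => a i * sin (i%:R * y)) 1 _ _ _ 1 one.
set L := `|_|; set L' := `|_|.
have -> : L = L'.
  congr `|_|; apply: eq_bigr => i _; rewrite expr1n mulr1 -/(ratio i) -Phi_even /Phi gauss_even /K.
  rewrite -expRM_natl mulrDl opprD expRD mulrN /P exprD.
  set r := ratio i ^+ M; ring.
move=> H; apply: (@le_trans _ _ (C2 * C1 * 1 * 1)); first apply: H.
- by move=> i /a0 ->; rewrite mul0r.
- move=> r hr; have := hb r y hr; rewrite y1 y2 => /(_ isT (or_intror ey)).
  by congr (`|_| <= _); apply: eq_bigr => i _; ring.
- apply: le_trans lb; apply: ler_sum => i _; apply: ler_wpM2r; first by rewrite exprn_ge0// expR_ge0.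
  by rewrite normrM -[leRHS]mulr1; apply: ler_pM => //; exact: sinn_le1.
by rewrite !mulr1; apply: le_trans (ler_norm _) _; rewrite /C; lra.
Qed.

End Strip.

Unset Implicit Arguments.

Theorem theorem3p3 (R : realType) (omega : set (R * R)) (y0 a T : R)
    (omega_open : open omega)
    (omega_sub : omega `<=` Omega R)
    (y0_bounds : 0 < y0 < pi)
    (a_gt0 : 0 < a)
    (segment_disjoint :
      [set z : R * R | `|z.1| < a /\ z.2 = y0] `&` closure omega = set0)
    (T_gt0 : 0 < T)
    (T_lt : T < a ^+ 2 / 2) :
  ~ null_controllable omega T.
Proof.
have mw := open_measurable_plane omega_open.
(* For T >= 1/2 one has a > 1, so the tube may be taken with half-length 1: a point of [omega] in it
   would have |x| >= 1, which is impossible in the domain. *)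
have [T1|T1] := leP (1 / 2) T.
  have a1 : 0 < (1 : R) < a.
    by rewrite ltr01 /= ltNge; apply/negP => a1; have : a ^+ 2 <= 1; [rewrite expr_le1// ltW|lra].
  have [e e0 he] := tube a1 segment_disjoint.
  apply: (not_null_controllable_strip mw omega_sub y0_bounds e0 T_gt0) => x y wxy.
  rewrite leNgt; apply/negP => hy; have := he x y wxy hy.
  have [/= /andP[x1 x2] _] := omega_sub _ wxy.
  by apply/negP; rewrite -ltNge ltr_norml x1.
(* The short-time argument asks for a half-length below 1. The midpoint of sqrt(2 T) and min(a, 1)
   qualifies, being below [a], below 1 and still above sqrt(2 T). *)
have [b /andP[b0 ba] [b1 bT]] : exists2 b, 0 < b < a & b < 1 /\ T < b ^+ 2 / 2.
  pose s := Num.sqrt (2 * T); have T20 : 0 <= 2 * T by lra.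
  have s0 : 0 <= s by exact: sqrtr_ge0.
  have ss : s ^+ 2 = 2 * T by rewrite sqr_sqrtr.
  have sm : s < Num.min a 1 by rewrite lt_min; apply/andP; split; nra.
  exists ((s + Num.min a 1) / 2).
    have : Num.min a 1 <= a by rewrite ge_min lexx.
    by move=> h; apply/andP; split; lra.
  have : Num.min a 1 <= 1 by rewrite ge_min lexx orbT.
  move: sm; set m := Num.min a 1 => sm m1; split; first lra.
  have : s < (s + m) / 2 by lra.
  set b := (s + m) / 2 => sb; nra.
have [e e0 he] := tube (introT andP (conj b0 ba)) segment_disjoint.
have b01 : 0 < b < 1 by rewrite b0.
exact: not_null_controllable_short_time mw omega_sub y0_bounds e0 T_gt0 b01 bT he.
Qed.
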